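(* Let $\zeta^{in}\in L^1_{0,1}(\mathbb{R}_{>0})$ with $\zeta^{in}\ge 0$ a.e., let $\mathcal{S}$ be a non-negative and exponentially decreasing function on $\mathbb{R}_{>0}$ that satisfies $\mathcal{S}\in L^1_{0,1}(\mathbb{R}_{>0})$, and let $\mathcal{R}:\mathbb{R}_{>0}\to[0,\infty)$ be measurable with $\mathcal{R}(p)\le k(1+p)^{\alpha}$ for all $p\in\mathbb{R}_{>0}$, where $k\ge 0$ and $\alpha\in[0,1)$. Let $\mathcal{A}:\mathbb{R}_{>0}\times\mathbb{R}_{>0}\to[0,\infty)$ be measurable and symmetric. (i) Suppose $\mathcal{A}$ is of Class I (linear kernel). Then there exists at least one weak solution $\zeta$ to the coagulation equation with source $\mathcal{S}$, removal coefficient $\mathcal{R}$ and initial value $\zeta^{in}$ such that $$\zeta\in \mathcal{C}([0,\infty)_w;L^1_{0,1}(\mathbb{R}_{>0}))\cap L^\infty((0,T);L^1_{0,1}(\mathbb{R}_{>0}))\quad\text{for each }T>0.$$ Furthermore, if $$\int_0^\infty p\,\mathcal{S}(p)\,dp=\int_0^\infty p\,\mathcal{R}(p)\,\zeta(s,p)\,dp\quad\text{for all } s\ge 0,$$ then $\zeta$ satisfies the mass conservation property $$\mathcal{M}_1(t):=\int_0^\infty p\,\zeta(t,p)\,dp=\int_0^\infty p\,\zeta^{in}(p)\,dp\quad\text{for all } t\ge 0.$$ (ii) Suppose $\mathcal{A}$ is of Class II (product kernel) and $\mathcal{R}$ is moreover increasing. Then there exists at least one weak solution $\zeta$ to the same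 problem such that $$\zeta\in \mathcal{C}([0,\infty)_w;L^1(\mathbb{R}_{>0}))\cap L^\infty((0,T);L^1_{0,1}(\mathbb{R}_{>0}))\quad\text{for each }T>0.$$ Furthermore, the solution $\zeta$ in both cases satisfies the weak formulation $$\int_0^\infty[\zeta(t,p)-\zeta^{in}(p)]\,\omega(p)\,dp=\frac12\int_0^t\int_0^\infty\int_0^\infty\tilde\omega(p,q)\,\mathcal{A}(p,q)\,\zeta(s,p)\,\zeta(s,q)\,dq\,dp\,ds+\int_0^t\int_0^\infty\omega(p)\,[\mathcal{S}(p)-\mathcal{R}(p)\zeta(s,p)]\,dp\,ds$$ for every $T>0$, every $t\in[0,T]$ and every $\omega\in L^\infty(\mathbb{R}_{>0})$, where $\tilde\omega(p,q):=\omega(p+q)-\omega(p)-\omega(q)$.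
   Context: $\mathbb{R}_{>0}=(0,\infty)$. $L^1_{0,1}(\mathbb{R}_{>0})$ denotes $L^1(\mathbb{R}_{>0};(1+p)\,dp)$ with norm $\|g\|=\int_0^\infty(1+p)|g(p)|\,dp$. The coagulation equation with source and sedimentation is $$\partial_t\zeta(t,p)=\frac12\int_0^p\mathcal{A}(p-q,q)\zeta(t,p-q)\zeta(t,q)\,dq-\int_0^\infty\mathcal{A}(p,q)\zeta(t,p)\zeta(t,q)\,dq+\mathcal{S}(p)-\mathcal{R}(p)\zeta(t,p),\qquad \zeta(0,p)=\zeta^{in}(p),$$ and solutions are non-negative functions $\zeta(t,p)\ge0$ ($\zeta$ is a concentration). A weak solution is a solution in the sense of the weak formulation displayed in the claim. The source $\mathcal{S}$ is assumed to be exponentially decreasing in the particle size $p$ (no particular rate is prescribed), in addition to being non-negative and in $L^1_{0,1}(\mathbb{R}_{>0})$. Class I (linear kernel): for some constant $A\ge0$, $\mathcal{A}(p,q)=A$ if $p+q<1$ and $\mathcal{A}(p,q)=A(p+q)$ if $p+q>1$. Class II (product kernel): for some constant $A\ge0$ and some function $\eta:(0,\infty)\to[1,\infty)$ with $\sup_{p\ge1}\frac{\eta(p)}{1+p}<\infty$ and $\lim_{p\to\infty}\frac{\eta(p)}{p}=0$, $\mathcal{A}(p,q)=A$ if $(p,q)\in(0,1)^2$; $\mathcal{A}(p,q)=A\eta(q)$ if $(p,q)\in(0,1)\times(1,\infty)$; $\mathcal{A}(p,q)=A\eta(p)$ if $(p,q)\in(1,\infty)\times(0,1)$; $\mathcal{A}(p,q)=A\eta(p)\eta(q)$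 if $(p,q)\in(1,\infty)^2$. (The values of $\mathcal{A}$ on the null sets not listed are irrelevant.) $\mathcal{C}([0,\infty)_w;L^1_{0,1}(\mathbb{R}_{>0}))$ is the space of weakly continuous functions from $[0,\infty)$ to $L^1_{0,1}(\mathbb{R}_{>0})$: $g$ belongs to it iff $t\mapsto\int_0^\infty\omega(p)(1+p)g(t,p)\,dp$ is continuous on $[0,\infty)$ for all $\omega\in L^\infty(\mathbb{R}_{>0})$. Similarly $\mathcal{C}([0,\infty)_w;L^1(\mathbb{R}_{>0}))$ is the space of weakly continuous functions with values in $L^1(\mathbb{R}_{>0})$, i.e. $t\mapsto\int_0^\infty\omega(p)g(t,p)\,dp$ is continuous for all $\omega\in L^\infty(\mathbb{R}_{>0})$. *)

(* Defs.v *)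
From HB Require Import structures.
From mathcomp Require Import all_boot all_order all_algebra.
From mathcomp Require Import all_classical all_reals all_analysis.

Set Implicit Arguments.
Unset Strict Implicit.
Unset Printing Implicit Defensive.

Import Order.TTheory GRing.Theory Num.Theory.
Import numFieldNormedType.Exports.

Local Open Scope classical_set_scope.
Local Open Scope ring_scope.

(* Functions on (0, +oo) are represented by total functions on R, of which only
   the restriction to Rpos is ever used; likewise, functions of time are only
   considered at times t >= 0. *)
Definition Rpos (R : realType) : set R := `]0, +oo[.
Arguments Rpos : clear implicits.

Definition L1 (R : realType) (g : R -> R) : Prop :=
  (@lebesgue_measure R).-integrable (Rpos R) (fun p => (g p)%:E).

Definition L1_01 (R : realType) (g : R -> R) : Prop :=
  (@lebesgue_measure R).-integrable (Rpos R) (fun p => ((1 + p) * g p)%:E).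

Definition Linfty (R : realType) (w : R -> R) : Prop :=
  measurable_fun (Rpos R) w /\
  exists M : R, {ae @lebesgue_measure R, forall p : R, Rpos R p -> `|w p| <= M}.

Definition weakly_continuous_L1 (R : realType) (g : R -> R -> R) : Prop :=
  (forall t : R, 0 <= t -> L1 (g t)) /\
  forall w, Linfty w ->
    {within `[0 : R, +oo[, continuous
      (fun t => \int[@lebesgue_measure R]_(p in Rpos R) (w p * g t p))}.

Definition weakly_continuous_L1_01 (R : realType) (g : R -> R -> R) : Prop :=
  (forall t : R, 0 <= t -> L1_01 (g t)) /\
  forall w, Linfty w ->
    {within `[0 : R, +oo[, continuous
      (fun t =>
         \int[@lebesgue_measure R]_(p in Rpos R) (w p * (1 + p) * g t p))}.

(* Strong (Bochner) measurability of t |-> g t is expressed by the joint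
   measurability of g, which every such map has up to modification on null
   sets. *)
Definition Linfty_L1_01 (R : realType) (T : R) (g : R -> R -> R) : Prop :=
  measurable_fun (`]0, T[ `*` Rpos R) (fun z : R * R => g z.1 z.2) /\
  exists M : R, {ae @lebesgue_measure R, forall t : R, `]0, T[%classic t ->
    (\int[@lebesgue_measure R]_(p in Rpos R) ((1 + p) * `|g t p|)%:E
       <= M%:E)%E}.

(* Only the decay for large p is prescribed: no bound is imposed near 0. *)
Definition exponentially_decreasing (R : realType) (S : R -> R) : Prop :=
  exists C lambda : R, 0 < lambda /\
    \forall p \near +oo, S p <= C * expR (- lambda * p).

Definition class_I (R : realType) (K : R -> R -> R) : Prop :=
  exists A : R, 0 <= A /\
  forall p q : R, 0 < p -> 0 < q ->
    (p + q < 1 -> K p q = A) /\ (1 < p + q -> K p q = A * (p + q)).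

Definition class_II (R : realType) (K : R -> R -> R) : Prop :=
  exists (A : R) (eta : R -> R),
  [/\ 0 <= A,
      forall p : R, 0 < p -> 1 <= eta p,
      has_ubound [set eta p / (1 + p) | p in `[1 : R, +oo[],
      eta p / p @[p --> +oo] --> (0 : R) &
      forall p q : R, 0 < p -> 0 < q ->
        [/\ p < 1 -> q < 1 -> K p q = A,
            p < 1 -> 1 < q -> K p q = A * eta q,
            1 < p -> q < 1 -> K p q = A * eta p &
            1 < p -> 1 < q -> K p q = A * eta p * eta q]].

Definition wtilde (R : realType) (w : R -> R) (p q : R) : R :=
  w (p + q) - w p - w q.

Definition weak_formulation (R : realType) (K : R -> R -> R)
    (S Rm zin : R -> R) (zeta : R -> R -> R) (w : R -> R) (t : R) : Prop :=
  let mu := @lebesgue_measure R in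
  (\int[mu]_(p in Rpos R) ((zeta t p - zin p) * w p)%:E
   = (2^-1)%:E *
       \int[mu]_(s in `[0%R, t]) \int[mu]_(p in Rpos R) \int[mu]_(q in Rpos R)
         (wtilde w p q * K p q * zeta s p * zeta s q)%:E
     + \int[mu]_(s in `[0%R, t]) \int[mu]_(p in Rpos R)
         (w p * (S p - Rm p * zeta s p))%:E)%E.

(* The two finiteness conditions say that, for bounded w, the integrals in the
   weak formulation converge absolutely. *)
Definition weak_solution (R : realType) (K : R -> R -> R)
    (S Rm zin : R -> R) (zeta : R -> R -> R) : Prop :=
  let mu := @lebesgue_measure R in
  [/\ measurable_fun (`[0 : R, +oo[ `*` Rpos R) (fun z : R * R => zeta z.1 z.2),
      forall t p : R, 0 <= t -> 0 < p -> 0 <= zeta t p,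
      forall T : R, 0 < T ->
        (\int[mu]_(s in `[0%R, T]) \int[mu]_(p in Rpos R)
           \int[mu]_(q in Rpos R) (K p q * zeta s p * zeta s q)%:E < +oo)%E,
      forall T : R, 0 < T ->
        (\int[mu]_(s in `[0%R, T]) \int[mu]_(p in Rpos R)
           (Rm p * zeta s p)%:E < +oo)%E &
      forall T : R, 0 < T -> forall t : R, 0 <= t <= T -> forall w, Linfty w ->
        weak_formulation K S Rm zin zeta w t].

(* Main.v *)
Require Import Defs.
From HB Require Import structures.
From mathcomp Require Import all_boot all_order all_algebra.
From mathcomp Require Import all_classical all_reals all_analysis.
From mathcomp Require Import measurable_realfun ring lra.
Import Order.TTheory GRing.Theory Num.Theory.
Import numFieldNormedType.Exports.
Local Open Scope classical_set_scope.
Local Open Scope ring_scope.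

Set Implicit Arguments.
Unset Strict Implicit.
Unset Printing Implicit Defensive.

(** The solution is the limit of explicit Euler schemes for truncated kernels. Instead of
weak compactness in L^1, the proof uses a Cauchy estimate in norm: the limit is strong,
so the quadratic collision term passes to the limit without further argument.

Both classes are brought into one form, [coag_data]. After a change on a null set and
extension by 0 to nonpositive sizes, the kernel satisfies [K p q <= b p * b q] for a
weight [b] with [1 <= b p <= c * (1 + p)], the removal rate is at most [b], and for
[1 <= q] the kernel is a sum of two products of a function of [p] and a function of [q]:
for class I because [p + q = p * 1 + 1 * q], for class II with a single product. In class
I the weight is a multiple of [1 + p]; in class II it is of smaller order, beyond size 1
a multiple of [eta p + (1 + p) `^ alpha].

At level [n], kernel and removal are truncated at size [n], and the time step is so small
that explicit steps keep concentrations nonnegative. Testing with the subadditive function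
[1 + p] bounds the moments on bounded time intervals ([euler_conc]). The tails of
the approximations in the norm with weight [b] are small uniformly in the level: for
class II since [b] is of smaller order than [1 + p] ([sublinear_tails]), for class I by
a Gronwall estimate for the test function [(1 + p) * min 1 (p / P)] ([linear_tails]).

Two approximations are compared on the sizes below some [P]. The gain there only involves
partners below [P]. The loss involves all partners, but those beyond 1 enter through just
two numbers, by the product form of the kernel. So the rates below [P] differ by at most
a constant times the difference below [P], the differences of these two numbers, and
the tails ([rate_diff]); a discrete Gronwall argument then bounds the difference of
the approximations by that of the numbers and by the tails ([two_levels]). The
numbers are equicontinuous functions of time, so along a subsequence they converge
uniformly on bounded time intervals ([extraction]), and along that subsequence the
approximations are Cauchy in L^1 below every [P]. Together with the uniform tails they
converge in the weighted norm, uniformly on bounded time intervals ([zeta_conv]).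

The collision term is locally Lipschitz in the weighted norm, so the weak form of
the scheme becomes the weak identity for the limit ([weak_identity]). Continuity in time in
the weighted norm is stronger than the weak continuity that is claimed: the weight is at
least 1, and in class I at least [1 + p]. For conservation of mass in class I the
test function [min p (2 * n)] is used: a collision changes its total by at most the
smaller size, and only if a partner exceeds [n], so the collision terms are bounded
by tails and vanish as [n] grows ([cut_coll]). *)

(** * Integrals of real-valued functions *)

Section realint.
Context d (T : measurableType d) (R : realType) (mu : {measure set T -> \bar R}).
Implicit Types f g : T -> R.

Notation integ f := (mu.-integrable setT (EFin \o f)).

Lemma integD f g : integ f -> integ g -> integ (fun x => f x + g x).
Proof. by move=> fi gi; have := integrableD measurableT fi gi. Qed.

Lemma integB f g : integ f -> integ g -> integ (fun x => f x - g x).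
Proof. by move=> fi gi; have := integrableB measurableT fi gi. Qed.

Lemma integZ (c : R) f : integ f -> integ (fun x => c * f x).
Proof. by move=> fi; have := integrableZl measurableT c fi. Qed.

Lemma integ_abs f : integ f -> integ (fun x => `|f x|).
Proof. by move=> fi; have := integrable_abse fi. Qed.

Lemma integ_mfun f : integ f -> measurable_fun setT f.
Proof. by move=> /measurable_int /measurable_EFinP. Qed.

Lemma integ_le f g : measurable_fun setT f -> (forall x, `|f x| <= g x) ->
  integ g -> integ f.
Proof.
move=> mf fg gi; apply: le_integrable gi => //; first exact/measurable_EFinP.
move=> x _ /=; rewrite lee_fin (le_trans (fg x))// ler_norm//.
Qed.

Lemma integ_ext f g : f =1 g -> integ f -> integ g.
Proof. by move=> /funext ->. Qed.

Lemma intD f g : integ f -> integ g ->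
  \int[mu]_x (f x + g x) = \int[mu]_x f x + \int[mu]_x g x.
Proof. by move=> fi gi; exact: RintegralD. Qed.

Lemma intB f g : integ f -> integ g ->
  \int[mu]_x (f x - g x) = \int[mu]_x f x - \int[mu]_x g x.
Proof. by move=> fi gi; exact: RintegralB. Qed.

Lemma intZ c f : integ f -> \int[mu]_x (c * f x) = c * \int[mu]_x f x.
Proof. by move=> fi; exact: RintegralZl. Qed.

Lemma int_le f g : integ f -> integ g -> (forall x, f x <= g x) ->
  \int[mu]_x f x <= \int[mu]_x g x.
Proof. by move=> fi gi fg; exact: le_Rintegral. Qed.

Lemma int_ge0 f : (forall x, 0 <= f x) -> 0 <= \int[mu]_x f x.
Proof. by move=> f0; exact: Rintegral_ge0. Qed.

Lemma int_abs f : integ f -> `|\int[mu]_x f x| <= \int[mu]_x `|f x|.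
Proof. by move=> fi; exact: le_normr_Rintegral. Qed.

Lemma int_abs_le f g : integ g -> measurable_fun setT f ->
  (forall x, `|f x| <= g x) -> `|\int[mu]_x f x| <= \int[mu]_x g x.
Proof.
move=> gi mf fg; have fi := integ_le mf fg gi.
by apply: le_trans (int_abs fi) _; apply: int_le => //; exact: integ_abs.
Qed.

Lemma int0 : \int[mu]_x (0 : R) = 0 :> R.
Proof. by rewrite /Rintegral integral0. Qed.

Lemma eq_int f g : f =1 g -> \int[mu]_x f x = \int[mu]_x g x.
Proof. by move=> /funext ->. Qed.

Lemma EFin_int f : integ f -> (\int[mu]_x f x)%:E = (\int[mu]_x (f x)%:E)%E.
Proof. by move=> fi; rewrite fineK//; exact: integrable_fin_num. Qed.

(** An infinite integral does no harm here: its real value is 0 by convention, and so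
    is that of any nonzero multiple. *)
Lemma intZ_ge0 c f : measurable_fun setT f -> (forall x, 0 <= f x) ->
  \int[mu]_x (c * f x) = c * \int[mu]_x f x.
Proof.
move=> mf f0.
have mf' : measurable_fun setT (EFin \o f) by exact/measurable_EFinP.
have pos (a : R) : 0 <= a -> \int[mu]_x (a * f x) = a * \int[mu]_x f x.
  move=> a0; rewrite /Rintegral; under eq_integral do rewrite EFinM.
  rewrite ge0_integralZl_EFin//; last by move=> x _; rewrite lee_fin.
  have : (0 <= \int[mu]_x (f x)%:E)%E by apply: integral_ge0 => x _; rewrite lee_fin.
  case: (\int[mu]_x (f x)%:E)%E => [r| |]//= _.
  by case: (ltgtP a 0) a0 => // [a0|->] _; rewrite ?mul0e ?mulr0// gt0_muley.
have [c0|c0] := leP 0 c; first exact: pos.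
rewrite -(opprK c); have := pos (- c); rewrite oppr_ge0 => /(_ (ltW c0)).
move=> E; rewrite [RHS]mulNr -E.
rewrite /Rintegral; under eq_integral do rewrite mulNr EFinN.
rewrite integral_ge0N ?fineN ?mulNr//.
move=> x _; rewrite lee_fin mulr_ge0// oppr_ge0 ltW//.
Qed.

End realint.

Local Notation mu := (@lebesgue_measure _).
Local Notation mu2 := (mu \x mu)%E.
Local Notation integ f := (mu.-integrable setT (EFin \o f)).
Local Notation integ2 u := (mu2.-integrable setT (EFin \o u)).

(** * Fubini, shifts and shears for the Lebesgue measure *)

Section lebesgue.
Context (R : realType).

Section shift.
Variable a : R.
Let sh (x : measurableTypeR R) : measurableTypeR R := x + a.
Let msh : measurable_fun setT sh.
Proof. exact: measurable_funD. Qed.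
HB.instance Definition _ := @isMeasurableFun.Build _ _ _ _ sh msh.

Let shift_meas A : measurable A -> mu A = mu (sh @^-1` A).
Proof.
move=> mA; rewrite -[RHS]/(pushforward mu sh A).
apply: lebesgue_measure_unique => //= _ [[x y]] _ <-.
rewrite /pushforward.
have -> : sh @^-1` `]x, y] = `](x - a), (y - a)]%classic.
  by apply/seteqP; split => z /=; rewrite !in_itv/= /sh ltrBlDr lerBrDr.
rewrite !lebesgue_measure_itv/= !lte_fin ltrD2r.
by case: ifP => // _; rewrite -!EFinB; congr EFin; ring.
Qed.

Lemma ge0_integral_shift (f : R -> \bar R) : measurable_fun setT f ->
  (forall x, 0 <= f x)%E -> (\int[mu]_x f (x + a)%R = \int[mu]_x f x)%E.
Proof.
move=> mf f0.
transitivity (\int[pushforward mu sh]_x f x)%E.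
  by rewrite ge0_integral_pushforward.
by apply: eq_measure_integral => //= A mA _; rewrite shift_meas.
Qed.

End shift.

(** A section need not be integrable; those that are not form a null set, on which
    the inner integral takes a finite default value. *)
Lemma integ_sec (u : R * R -> R) : integ2 u ->
  integ (fun p => \int[mu]_q u (p, q)) /\
  \int[mu]_p (\int[mu]_q u (p, q)) = \int[mu2]_z u z.
Proof.
move=> ui.
have Fi := integrable_fubini_F ui.
have mF := measurable_int mu Fi.
have mf : measurable_fun setT (fun p => \int[mu]_q u (p, q)).
  exact: measurableT_comp mF.
have iF : integ (fun p => \int[mu]_q u (p, q)).
  apply: le_integrable Fi => //; first exact/measurable_EFinP.
  move=> x _ /=; rewrite /Rintegral /fubini_F /=.
  by case: (integral _ _ _) => [r| |]/=; rewrite ?leey.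
split=> //.
rewrite /Rintegral; congr fine; rewrite -(integral12_prod_meas1 ui).
apply: ae_eq_integral => //; first exact/measurable_EFinP.
apply: filterS (integrable_ae measurableT Fi) => x /(_ I) Fx _.
by rewrite /= fineK.
Qed.

Lemma integ2_swap (u : R * R -> R) : integ2 u ->
  integ2 (fun z => u (z.2, z.1)) /\
  \int[mu2]_z u (z.2, z.1) = \int[mu2]_z u z.
Proof.
move=> ui; have mu_ := measurable_int _ ui.
have ms : measurable_fun setT (fun z : R * R => (u (z.2, z.1))%:E).
  apply: (measurableT_comp mu_).
  exact: measurable_fun_pair.
have si : integ2 (fun z => u (z.2, z.1)).
  by apply: ((integrable12ltyP mu mu ms).2) => /=; exact: (integrable21ltyP mu mu mu_).1 ui.
split=> //; rewrite /Rintegral; congr fine.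
by rewrite -(integral12_prod_meas1 si) -(integral21_prod_meas1 ui).
Qed.

Let mshear : measurable_fun setT (fun z : R * R => (z.1 - z.2, z.2)).
Proof.
by apply: measurable_fun_pair => //; apply: measurable_funB.
Qed.

Let shear_ge0 (u : R * R -> \bar R) : measurable_fun setT u ->
  (forall z, 0 <= u z)%E ->
  (\int[mu2]_z u (z.1 - z.2, z.2)%R = \int[mu2]_z u z)%E.
Proof.
move=> mu_ u0.
have ms : measurable_fun setT (fun z : R * R => u (z.1 - z.2, z.2)).
  exact: (measurableT_comp mu_ mshear).
rewrite !fubini_tonelli2//; apply: eq_integral => q _.
rewrite /fubini_G/= (ge0_integral_shift (- q) (f := fun p => u (p, q)))//.
exact: (measurableT_comp mu_ (measurable_pair2 _)).
Qed.

(** The substitution that turns a convolution into an integral over pairs. The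
    shifts of all horizontal lines preserve the measure, hence so does the shear. *)
Lemma integ2_shear (u : R * R -> R) : integ2 u ->
  integ2 (fun z => u (z.1 - z.2, z.2)) /\
  \int[mu2]_z u (z.1 - z.2, z.2) = \int[mu2]_z u z.
Proof.
move=> ui; have mu_ := measurable_int _ ui.
have ms : measurable_fun setT (fun z : R * R => (u (z.1 - z.2, z.2))%:E).
  exact: (measurableT_comp mu_ mshear).
have si : integ2 (fun z => u (z.1 - z.2, z.2)).
  apply/integrableP; split=> //.
  rewrite (shear_ge0 (u := fun z => `|(u z)%:E|)%E)//; last exact: measurableT_comp.
  by have /integrableP[] := ui.
split=> //.
have nn (v : R * R -> R) : integ2 v -> (forall z, 0 <= v z) ->
    \int[mu2]_z v (z.1 - z.2, z.2) = \int[mu2]_z v z.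
  move=> vi v0; rewrite /Rintegral; congr fine.
  by apply: (shear_ge0 (u := EFin \o v)); [exact: measurable_int vi|move=> z /=; rewrite lee_fin].
have ai := integ_abs ui; have asi := integ_abs si.
transitivity (\int[mu2]_z `|u (z.1 - z.2, z.2)| -
    \int[mu2]_z (`|u (z.1 - z.2, z.2)| - u (z.1 - z.2, z.2))).
  by rewrite intB//; ring.
rewrite (nn (fun z => `|u z|))// (nn (fun z => `|u z| - u z)).
- by rewrite intB//; ring.
- exact: integB.
- by move=> z; rewrite subr_ge0 ler_norm.
Qed.

Lemma integ_tensor (f g : R -> R) : integ f -> integ g ->
  integ2 (fun z => f z.1 * g z.2) /\
  \int[mu2]_z (f z.1 * g z.2) = (\int[mu]_p f p) * \int[mu]_q g q.
Proof.
move=> fi gi.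
have mf := integ_mfun fi; have mg := integ_mfun gi.
have m1 : measurable_fun setT (fun z : R * R => f z.1) by exact: measurableT_comp.
have m2 : measurable_fun setT (fun z : R * R => g z.2) by exact: measurableT_comp.
have ms : measurable_fun setT (EFin \o (fun z : R * R => f z.1 * g z.2)).
  by apply/measurable_EFinP; exact: measurable_funM.
have si : integ2 (fun z => f z.1 * g z.2).
  apply: ((integrable12ltyP mu mu ms).2) => /=.
  have E x : (\int[mu]_y (`|f x * g y|)%:E = ((\int[mu]_y `|g y|) * `|f x|)%:E)%E.
    under eq_integral do rewrite normrM.
    rewrite -(EFin_int (integZ `|f x| (integ_abs gi))).
    by rewrite (intZ _ (integ_abs gi)) mulrC.
  under eq_integral do rewrite E.
  by apply: integrable_lty => //; apply: integZ; exact: integ_abs.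
split=> //; have [_ <-] := integ_sec si => /=.
under eq_Rintegral do rewrite intZ//.
by rewrite mulrC -intZ//; apply: eq_int => x; rewrite mulrC.
Qed.

(** A pair (p, q) of partners produces a particle of size p + q, which is where the
    test function is evaluated. *)
Lemma integ_gain (u : R * R -> R) (w : R -> R) :
  measurable_fun setT u -> (forall z, 0 <= u z) -> measurable_fun setT w ->
  integ2 (fun z => w (z.1 + z.2) * u z) ->
  integ (fun p => w p * \int[mu]_q u (p - q, q)) /\
  \int[mu]_p (w p * \int[mu]_q u (p - q, q)) =
  \int[mu2]_z (w (z.1 + z.2) * u z).
Proof.
move=> mu_ u0 mw ui; have [si <-] := integ2_shear ui.
have [/= iF <-] := integ_sec si.
have E p : \int[mu]_q (w (p - q + q) * u (p - q, q)) =
    w p * \int[mu]_q u (p - q, q).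
  rewrite -intZ_ge0//; first by apply: eq_int => q; rewrite subrK.
  apply: (measurableT_comp mu_).
  by apply: measurable_fun_pair => //; exact: measurable_funB.
split; last by apply: eq_int.
exact: integ_ext iF.
Qed.

End lebesgue.

(** * The coagulation operator for a bounded kernel *)

Section operator.
Context (R : realType).

Definition wt (p : R) : R := 1 + `|p|.

Definition chi (P p : R) : R := (p < P)%R%:R.

Lemma chi_ge0 P p : 0 <= chi P p. Proof. exact: ler0n. Qed.
Lemma chi_le1 P p : chi P p <= 1. Proof. by rewrite /chi lern1 leq_b1. Qed.
Lemma wt_ge1 p : 1 <= wt p. Proof. by rewrite /wt lerDl. Qed.
Lemma wt_ge0 p : 0 <= wt p. Proof. by rewrite (le_trans _ (wt_ge1 p)). Qed.
Lemma wtD p q : wt (p + q) <= wt p * wt q.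
Proof.
rewrite /wt (le_trans (_ : _ <= 1 + (`|p| + `|q|)))//.
  by rewrite lerD2l ler_normD.
have := mulr_ge0 (normr_ge0 p) (normr_ge0 q); lra.
Qed.

Lemma measurable_wt : measurable_fun setT wt.
Proof. by apply: measurable_funD => //; exact: measurableT_comp. Qed.

Lemma measurable_chi P : measurable_fun setT (chi P).
Proof.
rewrite (_ : chi P = \1_(`]-oo, P[%classic)); last first.
  by apply/funext => p; rewrite /chi indicE mem_setE in_itv.
exact: measurable_indic.
Qed.

(** Concentrations vanish at nonpositive sizes, so that the convolution over
    0 < q < p in the gain term is an integral over the whole line. *)
Definition conc (z : R -> R) : Prop :=
  [/\ measurable_fun setT z, forall p, 0 <= z p, forall p, p <= 0 -> z p = 0 &
      integ (fun p => wt p * z p)].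

Definition mom (z : R -> R) : R := \int[mu]_p (wt p * z p).

Lemma conc_integ z : conc z -> integ z.
Proof.
move=> [mz z0 _ zi]; apply: integ_le zi => // p.
by rewrite ger0_norm// ler_peMl// wt_ge1.
Qed.

Lemma conc_integ_le z (g : R -> R) c : measurable_fun setT g ->
  (forall p, `|g p| <= c * wt p) -> conc z -> integ (fun p => g p * z p).
Proof.
move=> mg gc [mz z0 zp zi].
apply: integ_le (integZ c zi) => [|p]; first exact: measurable_funM.
by rewrite normrM (ger0_norm (z0 p)) mulrA ler_wpM2r.
Qed.

Lemma int_conc_le z (g : R -> R) c : measurable_fun setT g ->
  (forall p, `|g p| <= c * wt p) -> conc z ->
  \int[mu]_p (g p * z p) <= c * mom z.
Proof.
move=> mg gc cz; have [mz z0 zp zi] := cz.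
rewrite /mom -intZ//; apply: int_le.
- exact: conc_integ_le gc cz.
- exact: integZ.
- move=> p; rewrite mulrA ler_wpM2r// (le_trans (ler_norm _))//.
Qed.

Lemma mom_ge0 z : conc z -> 0 <= mom z.
Proof. by move=> [_ z0 _ _]; apply: int_ge0 => p; rewrite mulr_ge0// wt_ge0. Qed.

Lemma int_conc_le_mom z : conc z -> \int[mu]_p z p <= mom z.
Proof.
move=> cz; have := @int_conc_le z (fun=> 1) 1 (measurable_cst _).
under eq_Rintegral do rewrite mul1r.
by rewrite mul1r; apply => // p; rewrite normr1 mul1r wt_ge1.
Qed.

Lemma integ2_le (v : R * R -> R) (f g : R -> R) : measurable_fun setT v ->
  integ f -> integ g -> (forall z, `|v z| <= f z.1 * g z.2) ->
  integ2 v /\ `|\int[mu2]_z v z| <= (\int[mu]_p f p) * \int[mu]_q g q.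
Proof.
move=> mv fi gi vfg; have [ti <-] := integ_tensor fi gi.
by split; [exact: (integ_le (mu := mu2) mv vfg ti) | exact: (int_abs_le (mu := mu2) ti mv vfg)].
Qed.

Lemma measurable_fst (f : R -> R) : measurable_fun setT f ->
  measurable_fun setT (fun z : R * R => f z.1).
Proof. by move=> mf; exact: measurableT_comp. Qed.

Lemma measurable_snd (f : R -> R) : measurable_fun setT f ->
  measurable_fun setT (fun z : R * R => f z.2).
Proof. by move=> mf; exact: measurableT_comp. Qed.

Lemma measurable_sum2 (f : R -> R) : measurable_fun setT f ->
  measurable_fun setT (fun z : R * R => f (z.1 + z.2)).
Proof. by move=> mf; apply: (measurableT_comp mf); exact: measurable_funD. Qed.

Lemma measurable_pair (k : R -> R -> R) (f g : R -> R) :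
  measurable_fun setT (fun z : R * R => k z.1 z.2) ->
  measurable_fun setT f -> measurable_fun setT g ->
  measurable_fun setT (fun q => k (f q) (g q)).
Proof.
move=> mk mf mg; have := measurableT_comp mk (measurable_fun_pair mf mg).
exact.
Qed.

Definition gain (k : R -> R -> R) (z : R -> R) (p : R) : R :=
  \int[mu]_q (k (p - q) q * (z (p - q) * z q)).

Definition loss (k : R -> R -> R) (z : R -> R) (p : R) : R :=
  \int[mu]_q (k p q * z q).

Definition pair_int (k : R -> R -> R) (w : R * R -> R) (z : R -> R) : R :=
  \int[mu2]_x (w x * (k x.1 x.2 * (z x.1 * z x.2))).

(** What the merger of two particles adds to the total of [w]. *)
Definition coll_incr (w : R -> R) (x : R * R) : R := w (x.1 + x.2) - w x.1 - w x.2.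

Section bounded_kernel.
Variables (k : R -> R -> R) (r s : R -> R) (kap rho c : R).
Hypothesis k_m : measurable_fun setT (fun x : R * R => k x.1 x.2).
Hypothesis k_ge0 : forall p q, 0 <= k p q.
Hypothesis k_le : forall p q, k p q <= kap.
Hypothesis k_sym : forall p q, k p q = k q p.
Hypothesis k_pos : forall p q, p <= 0 -> k p q = 0.
Hypothesis r_m : measurable_fun setT r.
Hypothesis r_ge0 : forall p, 0 <= r p.
Hypothesis r_le : forall p, r p <= rho.
Hypothesis s_conc : conc s.

Definition rate (z : R -> R) (p : R) : R :=
  2^-1 * gain k z p - z p * loss k z p + (s p - r p * z p).

Variable z : R -> R.
Hypothesis cz : conc z.
Let mz : measurable_fun setT z. Proof. by case: cz. Qed.
Let z0 p : 0 <= z p. Proof. by case: cz. Qed.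
Let zp p : p <= 0 -> z p = 0. Proof. by case: cz => [_ _ h _]; exact: h. Qed.

Let u (x : R * R) := k x.1 x.2 * (z x.1 * z x.2).

Let mu_ : measurable_fun setT u.
Proof.
by apply: measurable_funM => //; apply: measurable_funM;
  [exact: measurable_fst|exact: measurable_snd].
Qed.

Let u0 x : 0 <= u x. Proof. by rewrite mulr_ge0// mulr_ge0. Qed.

Let kap0 : 0 <= kap. Proof. exact: le_trans (k_ge0 0 0) (k_le 0 0). Qed.

Lemma integ2_pair_int (w : R * R -> R) : measurable_fun setT w ->
  (forall x, `|w x| <= c * (wt x.1 * wt x.2)) -> 0 <= c ->
  integ2 (fun x => w x * u x).
Proof.
move=> mw wc c0; have [_ _ _ zi] := cz.
apply: (integ2_le _ (integZ (c * kap) zi) zi _).1 => /=.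
  exact: measurable_funM.
move=> x; rewrite normrM (ger0_norm (u0 x)).
rewrite (_ : _ * _ * _ = c * (wt x.1 * wt x.2) * (kap * (z x.1 * z x.2))); last ring.
by rewrite ler_pM// ler_wpM2r// mulr_ge0.
Qed.

Let wc1 (w : R -> R) : (forall p, `|w p| <= c * wt p) -> 0 <= c ->
  forall x : R * R, `|w x.1| <= c * (wt x.1 * wt x.2).
Proof.
move=> wc c0 x; rewrite (le_trans (wc _))// ler_wpM2l//.
by rewrite ler_peMr ?wt_ge0 ?wt_ge1.
Qed.

Let wc12 (w : R -> R) : (forall p, `|w p| <= c * wt p) -> 0 <= c ->
  forall x : R * R, `|w (x.1 + x.2)| <= c * (wt x.1 * wt x.2).
Proof. by move=> wc c0 x; rewrite (le_trans (wc _))// ler_wpM2l// wtD. Qed.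

Lemma int_gain (w : R -> R) : measurable_fun setT w ->
  (forall p, `|w p| <= c * wt p) -> 0 <= c ->
  integ (fun p => w p * gain k z p) /\
  \int[mu]_p (w p * gain k z p) = \int[mu2]_x (w (x.1 + x.2) * u x).
Proof.
move=> mw wc c0; apply: integ_gain => //.
apply: integ2_pair_int => //; first exact: measurable_sum2.
exact: wc12.
Qed.

Lemma int_loss (w : R -> R) : measurable_fun setT w ->
  (forall p, `|w p| <= c * wt p) -> 0 <= c ->
  integ (fun p => w p * (z p * loss k z p)) /\
  \int[mu]_p (w p * (z p * loss k z p)) = \int[mu2]_x (w x.1 * u x).
Proof.
move=> mw wc c0.
have ui : integ2 (fun x => w x.1 * u x).
  apply: integ2_pair_int => //; first exact: measurable_fst.
  exact: wc1.
have [/= iF <-] := integ_sec ui.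
have E p : \int[mu]_q (w p * u (p, q)) = w p * (z p * loss k z p).
  rewrite mulrA /loss -intZ_ge0.
  - by apply: eq_int => q; rewrite /u/=; ring.
  - apply: measurable_funM => //.
    exact: (@measurable_pair k (fun=> p) id).
  - by move=> q; rewrite mulr_ge0.
split; last by apply: eq_int.
exact: integ_ext iF.
Qed.

(** The weak form of the equation: the gain is carried to the pairs by the shear, and
    symmetry of the kernel divides the loss evenly between the two partners. *)
Lemma int_rate (w : R -> R) : measurable_fun setT w ->
  (forall p, `|w p| <= c * wt p) -> 0 <= c ->
  integ (fun p => w p * rate z p) /\
  \int[mu]_p (w p * rate z p) =
    2^-1 * pair_int k (coll_incr w) z + \int[mu]_p (w p * (s p - r p * z p)).
Proof.
move=> mw wc c0.
have [gi gE] := int_gain mw wc c0.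
have [li lE] := int_loss mw wc c0.
have si : integ (fun p => w p * (s p - r p * z p)).
  apply: (integ_ext (mu := mu) (f := fun p => w p * s p - (w p * r p) * z p)).
    by move=> p; ring.
  apply: integB; first exact: conc_integ_le wc s_conc.
  apply: (@conc_integ_le z (fun p => w p * r p) (c * rho)) => //; first exact: measurable_funM.
  move=> p; rewrite normrM mulrAC ler_pM// (ger0_norm (r_ge0 p))//.
have E p : w p * rate z p = 2^-1 * (w p * gain k z p) - w p * (z p * loss k z p) +
   w p * (s p - r p * z p) by rewrite /rate; ring.
have gli : integ (fun p => 2^-1 * (w p * gain k z p) - w p * (z p * loss k z p)).
  by apply: integB => //; exact: integZ.
split; first by apply: integ_ext (integD gli si).
under eq_Rintegral do rewrite E.
rewrite intD// intB//; last exact: integZ.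
rewrite intZ// gE lE; congr (_ + _).
have i12 : integ2 (fun x => w (x.1 + x.2) * u x).
  apply: integ2_pair_int => //; first exact: measurable_sum2.
  exact: wc12.
have i1 : integ2 (fun x => w x.1 * u x).
  apply: integ2_pair_int => //; first exact: measurable_fst.
  exact: wc1.
have [] := integ2_swap i1 => /= i2 E2.
have usym x : u (x.2, x.1) = u x.
  by rewrite /u/= k_sym (mulrC (z x.2)).
have i2' : integ2 (fun x => w x.2 * u x).
  by apply: integ_ext i2 => x; rewrite usym.
rewrite /pair_int.
transitivity (2^-1 * \int[mu2]_x (w (x.1 + x.2) * u x - w x.1 * u x - w x.2 * u x)).
  rewrite intB//; last exact: integB.
  rewrite intB//.
  have -> : \int[mu2]_x (w x.2 * u x) = \int[mu2]_x (w x.1 * u x).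
    by rewrite -E2; apply: eq_int => x; rewrite usym.
  lra.
by congr (_ * _); apply: eq_int => x; rewrite /coll_incr -/(u x); ring.
Qed.

Lemma loss_le p : loss k z p <= kap * mom z.
Proof.
have [_ _ _ zi] := cz; have iz := conc_integ cz.
apply: (@le_trans _ _ (kap * \int[mu]_q z q)); last first.
  by rewrite ler_wpM2l// int_conc_le_mom.
rewrite -intZ//; apply: int_le => //.
- apply: integ_le (integZ kap iz) => [|q].
    apply: measurable_funM => //; exact: (@measurable_pair k (fun=> p) id).
  by rewrite normrM !ger0_norm// ler_wpM2r.
- exact: integZ.
- by move=> q; rewrite ler_wpM2r.
Qed.

Lemma rate_pos p : p <= 0 -> rate z p = 0.
Proof.
move=> p0; have [_ _ sp _] := s_conc.
have k0 q : k (p - q) q = 0.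
  have [q0|q0] := leP q 0; first by rewrite k_sym k_pos.
  by rewrite k_pos// lerBlDr (le_trans p0)// add0r ltW.
rewrite /rate zp// sp// /gain.
under eq_Rintegral do rewrite k0 mul0r.
by rewrite int0; ring.
Qed.

End bounded_kernel.

Section step.
Variables (k : R -> R -> R) (r s : R -> R) (kap rho : R).
Hypothesis k_m : measurable_fun setT (fun x : R * R => k x.1 x.2).
Hypothesis k_ge0 : forall p q, 0 <= k p q.
Hypothesis k_le : forall p q, k p q <= kap.
Hypothesis k_sym : forall p q, k p q = k q p.
Hypothesis k_pos : forall p q, p <= 0 -> k p q = 0.
Hypothesis r_m : measurable_fun setT r.
Hypothesis r_ge0 : forall p, 0 <= r p.
Hypothesis r_le : forall p, r p <= rho.
Hypothesis s_conc : conc s.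
Variables (z : R -> R) (cz : conc z).

Lemma integ_rate : integ (rate k r s z) /\
  integ (fun p => wt p * rate k r s z p).
Proof.
have intr := int_rate k_m k_ge0 k_le k_sym r_m r_ge0 r_le s_conc cz.
split; last first.
  apply: (intr 1 _ measurable_wt _ ler01).1.
  by move=> p; rewrite mul1r ger0_norm ?wt_ge0.
have : integ (fun p => 1 * rate k r s z p).
  apply: (intr 1 (fun=> 1) (measurable_cst _) _ ler01).1.
  by move=> p; rewrite mul1r normr1 wt_ge1.
by apply: integ_ext => p; rewrite mul1r.
Qed.

(** The restriction on [h] says that one explicit step removes no more than what
    is present. *)
Lemma step_conc (h : R) : 0 <= h -> h * (kap * mom z + rho) <= 1 ->
  conc (fun p => z p + h * rate k r s z p).
Proof.
move=> h0 h1; have [ri rwi] := integ_rate; have [mz z0 zp zi] := cz.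
have [ms s0 sp si] := s_conc.
split.
- apply: measurable_funD => //; apply: measurable_funM => //.
  exact: integ_mfun ri.
- move=> p; rewrite /rate.
  have g0 : 0 <= gain k z p by apply: int_ge0 => q; rewrite !mulr_ge0.
  have lz : h * (loss k z p + r p) <= 1.
    apply: le_trans h1; rewrite ler_wpM2l// lerD//.
    exact: loss_le.
  have : 0 <= h * (2^-1 * gain k z p + s p).
    by rewrite mulr_ge0// addr_ge0// mulr_ge0// invr_ge0.
  have : 0 <= z p * (1 - h * (loss k z p + r p)).
    by rewrite mulr_ge0// subr_ge0.
  lra.
- by move=> p p0; rewrite zp// rate_pos// mulr0 addr0.
- have := integD zi (integZ h rwi); apply: integ_ext => p; ring.
Qed.

Lemma step_weak (h : R) (w : R -> R) (c : R) : measurable_fun setT w ->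
  (forall p, `|w p| <= c * wt p) -> 0 <= c ->
  \int[mu]_p (w p * (z p + h * rate k r s z p)) =
  \int[mu]_p (w p * z p) +
  h * (2^-1 * pair_int k (coll_incr w) z + \int[mu]_p (w p * (s p - r p * z p))).
Proof.
move=> mw wc c0.
have [ri rE] := int_rate k_m k_ge0 k_le k_sym r_m r_ge0 r_le s_conc cz mw wc c0.
under eq_Rintegral do rewrite mulrDr mulrCA.
by rewrite intD ?intZ ?rE//; [exact: conc_integ_le wc cz|exact: integZ].
Qed.

End step.
End operator.

(** * Data common to both classes, and the Euler scheme *)

(** What the two classes have in common. The weight [bd] dominates kernel and removal
    rate, and the scheme converges in the L^1 norm with this weight. By [ker_sep] the
    loss rate caused by partners of size at least 1 depends on the concentration only
    through two numbers, its integrals against [sb true] and [sb false] beyond 1. For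
    the linear kernel these are number and mass of the particles beyond 1; for the
    product kernel the second one is absent. *)
Record coag_data (R : realType) := CoagData {
  zin : R -> R; src : R -> R; rem : R -> R; ker : R -> R -> R;
  bd : R -> R; cb : R; sa : bool -> R -> R; sb : bool -> R -> R;
  zin_conc : conc zin;
  src_conc : conc src;
  rem_m : measurable_fun setT rem;
  rem_ge0 : forall p, 0 <= rem p;
  rem_pos : forall p, p <= 0 -> rem p = 0;
  rem_le : forall p, rem p <= bd p;
  ker_m : measurable_fun setT (fun x : R * R => ker x.1 x.2);
  ker_ge0 : forall p q, 0 <= ker p q;
  ker_sym : forall p q, ker p q = ker q p;
  ker_pos : forall p q, p <= 0 -> ker p q = 0;
  ker_le : forall p q, ker p q <= bd p * bd q;
  bd_m : measurable_fun setT bd;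
  bd_ge1 : forall p, 1 <= bd p;
  bd_le : forall p, bd p <= cb * wt p;
  ker_sep : forall p q, 1 <= q ->
    ker p q = sa true p * sb true q + sa false p * sb false q;
  sa_ge0 : forall i p, 0 <= sa i p;
  sa_le : forall i p, sa i p <= bd p;
  sb_m : forall i, measurable_fun setT (sb i);
  sb_ge0 : forall i p, 0 <= sb i p;
  sb_le : forall i p, sb i p <= bd p }.

Section scheme.
Context (R : realType) (D : coag_data R).
Notation bd := (bd D).
Notation cb := (cb D).
Notation ker := (ker D).

Lemma bd_ge0 p : 0 <= bd p. Proof. exact: le_trans (bd_ge1 D p). Qed.

Lemma cb_ge1 : 1 <= cb.
Proof. by have := le_trans (bd_ge1 D 0) (bd_le D 0); rewrite /wt normr0 addr0 mulr1. Qed.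
Lemma cb_ge0 : 0 <= cb. Proof. exact: le_trans cb_ge1. Qed.

Lemma ker_pos2 p q : q <= 0 -> ker p q = 0.
Proof. by move=> q0; rewrite ker_sym ker_pos. Qed.

Definition kern (n : nat) (p q : R) : R := ker p q * (chi n%:R p * chi n%:R q).
Definition remn (n : nat) (p : R) : R := rem D p * chi n%:R p.
Definition rho (n : nat) : R := cb * (1 + n%:R).
Definition kap (n : nat) : R := rho n * rho n.

Lemma rho_ge0 n : 0 <= rho n.
Proof. by rewrite mulr_ge0 ?cb_ge0// addr_ge0. Qed.

Lemma kap_ge0 n : 0 <= kap n. Proof. by rewrite mulr_ge0 ?rho_ge0. Qed.

Lemma bd_rho n p : 0 < p -> p < n%:R -> bd p <= rho n.
Proof.
move=> p0 pn; rewrite (le_trans (bd_le D p))// ler_wpM2l ?cb_ge0//.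
by rewrite /wt lerD2l gtr0_norm// ltW.
Qed.

Lemma kern_ge0 n p q : 0 <= kern n p q.
Proof. by rewrite mulr_ge0 ?ker_ge0// mulr_ge0 ?chi_ge0. Qed.

Lemma kern_le_ker n p q : kern n p q <= ker p q.
Proof. by rewrite ler_piMr ?ker_ge0// mulr_ile1 ?chi_ge0 ?chi_le1. Qed.

Lemma kern_le n p q : kern n p q <= kap n.
Proof.
have k0 := kap_ge0 n.
rewrite /kern; have [p0|p0] := leP p 0; first by rewrite ker_pos// mul0r.
have [q0|q0] := leP q 0; first by rewrite ker_pos2// mul0r.
rewrite /chi; have [pn|pn] := ltP p n%:R; last by rewrite mul0r mulr0.
have [qn|qn] := ltP q n%:R; last by rewrite !mulr0.
rewrite !mulr1 (le_trans (ker_le D p q))// ler_pM ?bd_ge0// bd_rho//.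
Qed.

Lemma kern_sym n p q : kern n p q = kern n q p.
Proof. by rewrite /kern ker_sym (mulrC (chi _ p)). Qed.

Lemma kern_pos n p q : p <= 0 -> kern n p q = 0.
Proof. by move=> p0; rewrite /kern ker_pos// mul0r. Qed.

Lemma kern_m n : measurable_fun setT (fun x : R * R => kern n x.1 x.2).
Proof.
apply: measurable_funM; first exact: ker_m.
by apply: measurable_funM; [apply: measurable_fst|apply: measurable_snd];
  exact: measurable_chi.
Qed.

Lemma remn_m n : measurable_fun setT (remn n).
Proof. by apply: measurable_funM; [exact: rem_m|exact: measurable_chi]. Qed.

Lemma remn_ge0 n p : 0 <= remn n p.
Proof. by rewrite mulr_ge0 ?rem_ge0 ?chi_ge0. Qed.

Lemma remn_le_rem n p : remn n p <= rem D p.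
Proof. by rewrite ler_piMr ?rem_ge0 ?chi_le1. Qed.

Lemma remn_le n p : remn n p <= rho n.
Proof.
rewrite /remn; have [p0|p0] := leP p 0; first by rewrite rem_pos// mul0r rho_ge0.
rewrite /chi; have [pn|pn] := ltP p n%:R; last by rewrite mulr0 rho_ge0.
by rewrite mulr1 (le_trans (rem_le D p))// bd_rho.
Qed.

Definition bnd (t : R) : R := mom (zin D) + t * mom (src D).

Lemma bnd_ge0 t : 0 <= t -> 0 <= bnd t.
Proof.
by move=> t0; rewrite addr_ge0 ?mulr_ge0 ?mom_ge0//;
  [exact: zin_conc|exact: src_conc].
Qed.

Lemma le_bnd s t : s <= t -> bnd s <= bnd t.
Proof. by move=> st; rewrite lerD2l ler_wpM2r// mom_ge0//; exact: src_conc. Qed.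

(** The time step of a level is a power of 1/2 with an exponent that accumulates over
    the levels: every grid refines the previous ones. It is so small that explicit
    steps preserve positivity up to time [n]. *)
Definition expo (n : nat) : nat :=
  (Num.truncn (kap n * bnd n%:R + rho n)).+1.
Definition level (n : nat) : nat := \sum_(i < n.+1) expo i.
Definition dt (n : nat) : R := 2 ^- level n.

Lemma dt_gt0 n : 0 < dt n. Proof. by rewrite invr_gt0 exprn_gt0. Qed.
Lemma dt_ge0 n : 0 <= dt n. Proof. exact: ltW (dt_gt0 n). Qed.

Lemma level_mono n m : (n <= m)%N -> (level n <= level m)%N.
Proof.
move=> /subnK <-; elim: (m - n)%N => [|i IH]; first by rewrite add0n.
by rewrite addSn (leq_trans IH)// /level (big_ord_recr (i + n).+1)/= leq_addr.
Qed.

Lemma dt_nested n m : (n <= m)%N -> dt n = (2 ^ (level m - level n))%N%:R * dt m.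
Proof.
move=> /level_mono nm; rewrite /dt natrX -{2}(subnK nm) exprD invfM mulrA.
by rewrite mulfV ?mul1r// expf_neq0.
Qed.

Lemma dt_lt n : dt n <= n.+1%:R^-1.
Proof.
rewrite lef_pV2 ?posrE ?exprn_gt0// -natrX ler_nat.
apply: leq_trans (_ : level n <= _)%N; last exact/ltnW/ltn_expl.
rewrite /level -[X in (X <= _)%N]card_ord -sum1_card.
by apply: leq_sum => i _.
Qed.

Lemma dt_cfl n : dt n * (kap n * bnd n%:R + rho n) <= 1.
Proof.
rewrite /dt mulrC ler_pdivrMr ?exprn_gt0// mul1r.
apply: (@le_trans _ _ (expo n)%:R); first exact/ltW/truncnS_gt.
rewrite -natrX ler_nat.
apply: leq_trans (_ : level n <= _)%N; last exact/ltnW/ltn_expl.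
by rewrite /level big_ord_recr /= leq_addl.
Qed.

Notation rt n := (rate (kern n) (remn n) (src D)).

Fixpoint euler (n j : nat) : R -> R :=
  if j is i.+1 then fun p => euler n i p + dt n * rt n (euler n i) p else zin D.

Lemma euler_weak n j (w : R -> R) (c : R) : conc (euler n j) ->
  measurable_fun setT w -> (forall p, `|w p| <= c * wt p) -> 0 <= c ->
  \int[mu]_p (w p * euler n j.+1 p) = \int[mu]_p (w p * euler n j p) +
  dt n * (2^-1 * pair_int (kern n) (coll_incr w) (euler n j) +
          \int[mu]_p (w p * (src D p - remn n p * euler n j p))).
Proof.
move=> cz mw wc c0.
exact: (step_weak (kern_m n) (kern_ge0 n) (kern_le n) (kern_sym n)
  (remn_m n) (remn_ge0 n) (remn_le n) (src_conc D) cz _ mw wc c0).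
Qed.

(** The moment bound is the weak form tested with [wt]: this function is subadditive,
    so collisions contribute nothing positive. *)
Lemma euler_conc n j : j%:R * dt n <= n%:R ->
  conc (euler n j) /\ mom (euler n j) <= bnd (j%:R * dt n).
Proof.
elim: j => [_|j IH jn].
  by split; [exact: zin_conc|rewrite /bnd mul0r mul0r addr0].
have jn' : j%:R * dt n <= n%:R.
  by rewrite (le_trans _ jn)// ler_wpM2r ?dt_ge0// ler_nat.
have [cz mz] := IH jn'.
have cz1 : conc (euler n j.+1).
  apply: (step_conc (kern_m n) (kern_ge0 n) (kern_le n) (kern_sym n) (@kern_pos n)
    (remn_m n) (remn_ge0 n) (remn_le n) (src_conc D) cz (dt_ge0 n)).
  apply: le_trans (dt_cfl n); rewrite ler_wpM2l ?dt_ge0// lerD2r.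
  by rewrite ler_wpM2l ?kap_ge0// (le_trans mz)// le_bnd.
split=> //.
rewrite {1}/mom (@euler_weak n j (@wt R) 1)//; last 2 first.
- exact: measurable_wt.
- by move=> p; rewrite mul1r ger0_norm ?wt_ge0.
have -> : bnd (j.+1%:R * dt n) = bnd (j%:R * dt n) + dt n * mom (src D).
  by rewrite /bnd -natr1; ring.
rewrite lerD//.
rewrite ler_wpM2l ?dt_ge0//.
have [mz1 z0 _ zi] := cz; have [ms s0 _ si] := src_conc D.
(* Collisions decrease the moment, and so does removal. *)
rewrite -[leRHS]add0r lerD//.
  rewrite mulr_ge0_le0 ?invr_ge0//.
  rewrite -oppr_ge0 -mulN1r -intZ; last first.
    apply: (integ2_pair_int (kern_m n) (kern_ge0 n) (kern_le n) cz (c := 3)) => //.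
      by apply: measurable_funB; [apply: measurable_funB|];
      [apply: measurable_sum2|apply: measurable_fst|apply: measurable_snd];
      exact: measurable_wt.
    move=> x; rewrite /coll_incr.
    have := wtD x.1 x.2; have := wt_ge1 x.1; have := wt_ge1 x.2.
    have := wt_ge1 (x.1 + x.2).
    move=> h1 h2 h3 h4; rewrite ler_norml; nra.
  apply: int_ge0 => x; rewrite mulN1r oppr_ge0 mulr_le0_ge0//.
    rewrite /coll_incr /wt; have := ler_normD x.1 x.2; lra.
  by rewrite mulr_ge0 ?kern_ge0// mulr_ge0.
have ri : integ (fun p => wt p * (remn n p * euler n j p)).
  apply: integ_le (integZ (rho n) zi) => [|p].
    apply: measurable_funM; first exact: measurable_wt.
    by apply: measurable_funM => //; exact: remn_m.
  rewrite ger0_norm; last by rewrite mulr_ge0 ?wt_ge0// mulr_ge0 ?remn_ge0.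
  by rewrite mulrCA ler_wpM2r ?remn_le// mulr_ge0 ?wt_ge0.
apply: int_le => //.
  by apply: integ_ext (integB si ri) => p; ring.
move=> p; rewrite ler_wpM2l ?wt_ge0// gerBl mulr_ge0 ?remn_ge0//.
Qed.

End scheme.

(** * The weighted norm, tails and collision forms *)

Section weighted.
Context (R : realType) (D : coag_data R).
Notation bd := (bd D).
Notation cb := (cb D).
Notation ker := (ker D).
Notation kern := (kern D).

Definition bd_integrable (x : R -> R) : Prop :=
  measurable_fun setT x /\ integ (fun p => bd p * `|x p|).
Definition bd_norm (x : R -> R) : R := \int[mu]_p (bd p * `|x p|).
Definition bd_tail (Q : R) (x : R -> R) : R :=
  \int[mu]_p ((1 - chi Q p) * (bd p * `|x p|)).
Definition head (P : R) (x : R -> R) : R := \int[mu]_p (chi P p * `|x p|).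
(** The part of the loss rate that comes from partners beyond 1; see [ker_sep]. *)
Definition far_mom (i : bool) (x : R -> R) : R :=
  \int[mu]_q ((1 - chi 1 q) * (sb D i q * x q)).

Lemma chi_compl_ge0 Q p : 0 <= 1 - chi Q p :> R.
Proof. by rewrite subr_ge0 chi_le1. Qed.
Lemma chi_compl_le1 Q p : 1 - chi Q p <= 1 :> R.
Proof. by rewrite gerBl chi_ge0. Qed.
Lemma measurable_chi_compl Q : measurable_fun setT (fun p : R => 1 - chi Q p).
Proof. by apply: measurable_funB => //; exact: measurable_chi. Qed.

Lemma chi_compl_le P Q p : P <= Q -> 1 - chi Q p <= 1 - chi P p :> R.
Proof.
move=> PQ; rewrite lerD2l lerN2 /chi.
by case: (ltP p P) => [pP|_]; rewrite ?(lt_le_trans pP PQ)// ler0n.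
Qed.

Lemma abs_m (x : R -> R) : measurable_fun setT x ->
  measurable_fun setT (fun p => `|x p|).
Proof. by move=> mx; exact: measurableT_comp. Qed.

Lemma integ_chi P (f : R -> R) : integ f -> integ (fun p => chi P p * `|f p|).
Proof.
move=> fi; apply: integ_le (integ_abs fi) => [|p].
  apply: measurable_funM; first exact: measurable_chi.
  by apply: abs_m; exact: integ_mfun fi.
by rewrite ger0_norm ?mulr_ge0 ?chi_ge0// ler_piMl// chi_le1.
Qed.

Lemma head_tri P (x y z : R -> R) : integ (fun p => x p - y p) ->
  integ (fun p => y p - z p) ->
  head P (fun p => x p - z p) <=
  head P (fun p => x p - y p) + head P (fun p => y p - z p).
Proof.
move=> i1 i2; have j1 := integ_chi P i1; have j2 := integ_chi P i2.
have i3 : integ (fun p => x p - z p) by apply: integ_ext (integD i1 i2) => p; ring.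
rewrite /head -intD//; apply: int_le => [|| p].
- exact: integ_chi.
- exact: integD.
rewrite -mulrDr ler_wpM2l ?chi_ge0//.
by rewrite (_ : x p - z p = (x p - y p) + (y p - z p)) ?ler_normD//; ring.
Qed.

Lemma integ_bd_integrable x (f : R -> R) : bd_integrable x -> measurable_fun setT f ->
  (forall p, `|f p| <= bd p * `|x p|) -> integ f.
Proof. by move=> [mx xi] mf fx; exact: (integ_le (mu := mu) mf fx xi). Qed.

Lemma integ_bd_tail Q x : bd_integrable x -> integ (fun p => (1 - chi Q p) * (bd p * `|x p|)).
Proof.
move=> bx; have [mx xi] := bx; apply: (integ_bd_integrable bx).
  apply: measurable_funM; first exact: measurable_chi_compl.
  by apply: measurable_funM; [exact: bd_m|exact: abs_m].
move=> p; have h : 0 <= bd p * `|x p| by rewrite mulr_ge0 ?bd_ge0.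
by rewrite ger0_norm ?ler_piMl ?chi_compl_le1// mulr_ge0 ?chi_compl_ge0.
Qed.

Lemma integ_head P x : bd_integrable x -> integ (fun p => chi P p * `|x p|).
Proof.
move=> bx; have [mx xi] := bx; apply: (integ_bd_integrable bx).
  by apply: measurable_funM; [exact: measurable_chi|exact: abs_m].
move=> p; rewrite ger0_norm ?mulr_ge0 ?chi_ge0//.
by rewrite ler_wpM2r// (le_trans (chi_le1 _ _)) ?bd_ge1.
Qed.

Lemma far_mom_integ i x : bd_integrable x -> integ (fun q => (1 - chi 1 q) * (sb D i q * x q)).
Proof.
move=> bx; have [mx _] := bx; apply: (integ_bd_integrable bx).
  apply: measurable_funM; first exact: measurable_chi_compl.
  by apply: measurable_funM => //; exact: sb_m.
move=> q; rewrite !normrM (ger0_norm (chi_compl_ge0 _ _)) (ger0_norm (sb_ge0 _ _ _)).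
rewrite -[leRHS]mul1r ler_pM ?chi_compl_ge0 ?chi_compl_le1// ?mulr_ge0 ?sb_ge0//.
by rewrite ler_wpM2r// sb_le.
Qed.

Lemma far_mom_le i x : bd_integrable x -> `|far_mom i x| <= bd_norm x.
Proof.
move=> bx; have [_ xi] := bx; apply: le_trans (int_abs (far_mom_integ i bx)) _.
apply: int_le => // [|q]; first exact/integ_abs/far_mom_integ.
rewrite !normrM (ger0_norm (chi_compl_ge0 _ _)) (ger0_norm (sb_ge0 _ _ _)).
rewrite -[leRHS]mul1r ler_pM ?chi_compl_ge0 ?chi_compl_le1// ?mulr_ge0 ?sb_ge0//.
by rewrite ler_wpM2r// sb_le.
Qed.

Lemma bd_norm_ge0 x : 0 <= bd_norm x.
Proof. by apply: int_ge0 => p; rewrite mulr_ge0 ?bd_ge0. Qed.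
Lemma bd_tail_ge0 Q x : 0 <= bd_tail Q x.
Proof.
by apply: int_ge0 => p; rewrite mulr_ge0 ?chi_compl_ge0// mulr_ge0 ?bd_ge0.
Qed.
Lemma head_ge0 P x : 0 <= head P x.
Proof. by apply: int_ge0 => p; rewrite mulr_ge0 ?chi_ge0. Qed.

Lemma bd_tail_le P Q x : bd_integrable x -> P <= Q -> bd_tail Q x <= bd_tail P x.
Proof.
move=> bx PQ; apply: int_le; [exact: integ_bd_tail|exact: integ_bd_tail|] => p.
by rewrite ler_wpM2r ?chi_compl_le// mulr_ge0 ?bd_ge0.
Qed.

Lemma bd_integrableB x y : bd_integrable x -> bd_integrable y -> bd_integrable (fun p => x p - y p).
Proof.
move=> [mx xi] [my yi]; have mxy := measurable_funB mx my; split=> //.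
apply: integ_le (integD xi yi) => [|p].
  by apply: measurable_funM; [exact: bd_m|exact: abs_m].
rewrite ger0_norm ?mulr_ge0 ?bd_ge0// -mulrDr ler_wpM2l ?bd_ge0//.
by rewrite (le_trans (ler_normB _ _)).
Qed.

Lemma conc_bd_integrable z : conc z -> bd_integrable z.
Proof.
move=> cz; have [mz z0 _ _] := cz; split=> //.
have : integ (fun p => bd p * z p).
  apply: (conc_integ_le (bd_m D) _ cz (c := cb)) => p.
  by rewrite ger0_norm ?bd_ge0 ?bd_le.
by apply: integ_ext => p; rewrite ger0_norm.
Qed.

Lemma bd_norm_mom z : conc z -> bd_norm z <= cb * mom z.
Proof.
move=> cz; have [_ z0 _ _] := cz.
have := int_conc_le (bd_m D) (fun p => _ : `|bd p| <= cb * wt p) cz.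
rewrite /bd_norm; under [X in _ -> X <= _]eq_Rintegral do rewrite ger0_norm//.
by apply => p; rewrite ger0_norm ?bd_ge0 ?bd_le.
Qed.

Definition form (k : R -> R -> R) (w : R * R -> R) (x y : R -> R) : R :=
  \int[mu2]_a (w a * (k a.1 a.2 * (x a.1 * y a.2))).

Section form.
Variables (k : R -> R -> R) (w : R * R -> R) (W : R).
Hypothesis k_m : measurable_fun setT (fun a : R * R => k a.1 a.2).
Hypothesis k_ge0 : forall p q, 0 <= k p q.
Hypothesis k_le : forall p q, k p q <= ker p q.
Hypothesis w_m : measurable_fun setT w.
Hypothesis w_le : forall a, `|w a| <= W.

Let W0 : 0 <= W. Proof. exact: le_trans (w_le (0, 0)). Qed.

Lemma form_m (x y : R -> R) : measurable_fun setT x -> measurable_fun setT y ->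
  measurable_fun setT (fun a : R * R => w a * (k a.1 a.2 * (x a.1 * y a.2))).
Proof.
move=> mx my; apply: measurable_funM => //; apply: measurable_funM => //.
by apply: measurable_funM; [exact: measurable_fst|exact: measurable_snd].
Qed.

Lemma form_le x y : bd_integrable x -> bd_integrable y ->
  integ2 (fun a => w a * (k a.1 a.2 * (x a.1 * y a.2))) /\
  `|form k w x y| <= W * (bd_norm x * bd_norm y).
Proof.
move=> [mx xi] [my yi].
have := integ2_le (form_m mx my) (integZ W xi) yi.
rewrite intZ// -mulrA; apply => -[p q] /=; rewrite !normrM (ger0_norm (k_ge0 _ _)).
rewrite -[leRHS]mulrA ler_pM// ?mulr_ge0//.
rewrite mulrACA ler_wpM2r ?mulr_ge0//.
exact: le_trans (k_le _ _) (ker_le _ _ _).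
Qed.

(** Bilinearity: x x - y y = (x - y) x + y (x - y). *)
Lemma pair_int_diff x y : bd_integrable x -> bd_integrable y ->
  `|pair_int k w x - pair_int k w y| <= W * ((bd_norm x + bd_norm y) * bd_norm (fun p => x p - y p)).
Proof.
move=> bx by_; have bxy := bd_integrableB bx by_.
have [i1 e1] := form_le bxy bx; have [i2 e2] := form_le by_ bxy.
have [ix _] := form_le bx bx; have [iy _] := form_le by_ by_.
rewrite /pair_int -intB//.
have -> : \int[mu2]_a (w a * (k a.1 a.2 * (x a.1 * x a.2)) -
    w a * (k a.1 a.2 * (y a.1 * y a.2))) =
    form k w (fun p => x p - y p) x + form k w y (fun p => x p - y p).
  by rewrite /form -intD//; apply: eq_int => a; ring.
apply: le_trans (ler_normD _ _) _; apply: le_trans (lerD e1 e2) _.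
by rewrite le_eqVlt; apply/orP; left; apply/eqP; ring.
Qed.

End form.

Lemma pair_int_trunc n (w : R * R -> R) (W : R) x : measurable_fun setT w -> (forall a, `|w a| <= W) ->
  bd_integrable x -> `|pair_int (kern n) w x - pair_int ker w x| <= W * (2 * (bd_norm x * bd_tail n%:R x)).
Proof.
move=> mw wW bx; have [mx xi] := bx; have ti := integ_bd_tail n%:R bx.
have W0 : 0 <= W := le_trans (normr_ge0 _) (wW (0, 0)).
have [i1 _] := form_le (kern_m D n) (kern_ge0 D n) (kern_le_ker D n) mw wW bx bx.
have [i2 _] := form_le (ker_m D) (ker_ge0 D) (fun _ _ => lexx _) mw wW bx bx.
have [t1 e1] := integ_tensor ti xi.
have [t2 e2] := integ_tensor xi ti.
rewrite /pair_int -intB//.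
have -> : W * (2 * (bd_norm x * bd_tail n%:R x)) =
  \int[mu2]_a (W * ((1 - chi n%:R a.1) * (bd a.1 * `|x a.1|) * (bd a.2 * `|x a.2|) +
    (bd a.1 * `|x a.1|) * ((1 - chi n%:R a.2) * (bd a.2 * `|x a.2|)))).
  rewrite intZ; last exact: integD.
  rewrite intD// e1 e2 -/(bd_norm x) -/(bd_tail n%:R x); ring.
apply: int_abs_le.
- by apply: integZ; exact: integD.
- by apply: measurable_funB; [exact: integ_mfun i1|exact: integ_mfun i2].
move=> [p q] /=; rewrite -mulrBr -mulrBl normrM ler_pM// normrM.
rewrite -{1}[ker p q]mulr1 -mulrBr normrM (ger0_norm (ker_ge0 _ _ _)) normrM.
rewrite ler0_norm; last by rewrite subr_le0 mulr_ile1 ?chi_ge0 ?chi_le1.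
rewrite opprB.
have h : 1 - chi n%:R p * chi n%:R q <= (1 - chi n%:R p) + (1 - chi n%:R q).
  have := mulr_ge0 (chi_compl_ge0 n%:R p) (chi_compl_ge0 n%:R q); lra.
apply: (@le_trans _ _ (bd p * bd q * ((1 - chi n%:R p) + (1 - chi n%:R q)) * (`|x p| * `|x q|))).
  rewrite ler_wpM2r ?mulr_ge0// ler_pM ?ker_ge0 ?ker_le//.
  by rewrite subr_ge0 mulr_ile1 ?chi_ge0 ?chi_le1.
by rewrite le_eqVlt; apply/orP; left; apply/eqP; ring.
Qed.

Notation rt n := (rate (kern n) (remn D n) (src D)).

Section rate_est.
Variable n : nat.
Variables (z : R -> R) (cz : conc z).
Let mz : measurable_fun setT z. Proof. by case: cz. Qed.
Let z0 p : 0 <= z p. Proof. by case: cz. Qed.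
Let zE p : `|z p| = z p. Proof. by rewrite ger0_norm. Qed.
Let bz : bd_integrable z. Proof. exact: conc_bd_integrable. Qed.

Lemma gain_test (w : R -> R) (W : R) : measurable_fun setT w ->
  (forall p, `|w p| <= W) ->
  integ (fun p => w p * gain (kern n) z p) /\
  \int[mu]_p (w p * gain (kern n) z p) = form (kern n) (fun a => w (a.1 + a.2)) z z.
Proof.
move=> mw wW; have W0 : 0 <= W := le_trans (normr_ge0 _) (wW 0).
have := int_gain (kern_m D n) (kern_ge0 D n) (kern_le D n) cz mw _ W0; apply => p.
by rewrite (le_trans (wW p))// ler_peMr// wt_ge1.
Qed.

Lemma loss_test (w : R -> R) (W : R) : measurable_fun setT w ->
  (forall p, `|w p| <= W) ->
  integ (fun p => w p * (z p * loss (kern n) z p)) /\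
  \int[mu]_p (w p * (z p * loss (kern n) z p)) = form (kern n) (fun a => w a.1) z z.
Proof.
move=> mw wW; have W0 : 0 <= W := le_trans (normr_ge0 _) (wW 0).
have := int_loss (kern_m D n) (kern_ge0 D n) (kern_le D n) cz mw _ W0; apply => p.
by rewrite (le_trans (wW p))// ler_peMr// wt_ge1.
Qed.

Lemma integ_rt : integ (rt n z).
Proof.
exact: (integ_rate (kern_m D n) (kern_ge0 D n) (kern_le D n) (kern_sym D n)
  (remn_m D n) (remn_ge0 D n) (remn_le D n) (src_conc D) cz).1.
Qed.

Lemma integ_remn : integ (fun p => remn D n p * z p).
Proof.
apply: (integ_bd_integrable bz).
  by apply: measurable_funM => //; exact: remn_m.
move=> p; rewrite ger0_norm; last by rewrite mulr_ge0 ?remn_ge0.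
by rewrite zE ler_wpM2r// (le_trans (remn_le_rem _ _ _))// rem_le.
Qed.

Lemma rate_L1 : \int[mu]_p `|rt n z p| <=
  2 * (bd_norm z * bd_norm z) + mom (src D) + bd_norm z.
Proof.
have one T (p : T) : `|(1 : R)| <= 1 by rewrite normr1.
have [gi gE] := gain_test (measurable_cst (1 : R)) (@one _).
have [li lE] := loss_test (measurable_cst (1 : R)) (@one _).
have g1 : integ (gain (kern n) z) by apply: integ_ext gi => p; rewrite mul1r.
have l1 : integ (fun p => z p * loss (kern n) z p).
  by apply: integ_ext li => p; rewrite mul1r.
have si : integ (src D) by exact/conc_integ/src_conc.
have ri := integ_remn.
have [_ s0 _ _] := src_conc D.
have ig : \int[mu]_p gain (kern n) z p <= bd_norm z * bd_norm z.
  have [_] := form_le (kern_m D n) (kern_ge0 D n) (kern_le_ker D n)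
    (measurable_cst (1 : R)) (@one _) bz bz.
  rewrite mul1r; apply: le_trans; apply: le_trans (ler_norm _).
  by rewrite -gE; under [leRHS]eq_Rintegral do rewrite mul1r.
have il : \int[mu]_p (z p * loss (kern n) z p) <= bd_norm z * bd_norm z.
  have [_] := form_le (kern_m D n) (kern_ge0 D n) (kern_le_ker D n)
    (measurable_cst (1 : R)) (@one _) bz bz.
  rewrite mul1r; apply: le_trans; apply: le_trans (ler_norm _).
  by rewrite -lE; under [leRHS]eq_Rintegral do rewrite mul1r.
have ir : \int[mu]_p (remn D n p * z p) <= bd_norm z.
  apply: int_le => //; first by case: bz.
  by move=> p; rewrite zE ler_wpM2r// (le_trans (remn_le_rem _ _ _))// rem_le.
have is_ : \int[mu]_p src D p <= mom (src D) by apply/int_conc_le_mom/src_conc.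
have I1 := integZ 2^-1 g1.
have I2 := integD I1 l1.
have I3 := integD I2 si.
have I4 := integD I3 ri.
apply: (@le_trans _ _ (2^-1 * \int[mu]_p gain (kern n) z p +
  \int[mu]_p (z p * loss (kern n) z p) + \int[mu]_p src D p +
  \int[mu]_p (remn D n p * z p))); last first.
  have : 0 <= \int[mu]_p gain (kern n) z p.
    by apply: int_ge0 => p; apply: int_ge0 => q; rewrite mulr_ge0 ?kern_ge0// mulr_ge0.
  lra.
rewrite -intZ// -!intD//.
apply: int_le => //; first exact: (integ_abs integ_rt).
move=> p; have := s0 p.
have g0 : 0 <= gain (kern n) z p.
  by apply: int_ge0 => q; rewrite mulr_ge0 ?kern_ge0// mulr_ge0.
have l0 : 0 <= z p * loss (kern n) z p.
  by rewrite mulr_ge0//; apply: int_ge0 => q; rewrite mulr_ge0 ?kern_ge0.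
have r0 : 0 <= remn D n p * z p by rewrite mulr_ge0 ?remn_ge0.
by rewrite /rate => s0p; rewrite ler_norml; apply/andP; split; lra.
Qed.

End rate_est.

End weighted.

(** * Comparison of the rates of two concentrations *)

Ltac nneg := repeat first [apply: mulr_ge0 | apply: addr_ge0];
  rewrite ?chi_ge0 ?normr_ge0 ?cb_ge0 ?bd_ge0 ?bd_tail_ge0 ?bd_norm_ge0 ?head_ge0 //.

Lemma measurable_sgr (R : realType) :
  measurable_fun [set: R] (fun x : R => Num.sg x).
Proof.
rewrite (_ : (fun x : R => Num.sg x) = fun x => chi 0 (- x) - chi 0 x); last first.
  apply/funext => x; rewrite /chi oppr_lt0.
  by case: sgrP => _; rewrite ?subr0 ?subrr ?sub0r.
apply: measurable_funB; last exact: measurable_chi.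
exact: (measurableT_comp (measurable_chi _)).
Qed.

Section rate_diff.
Context (R : realType) (D : coag_data R).
Notation bd := (bd D).
Notation cb := (cb D).
Notation ker := (ker D).
Notation kern := (kern D).
Notation bd_integrable := (bd_integrable D).
Notation bd_norm := (bd_norm D).
Notation bd_tail := (bd_tail D).
Notation far_mom := (far_mom D).
Notation rt n := (rate (kern n) (remn D n) (src D)).

Variables (n m : nat) (P : R) (x y : R -> R).
Hypothesis P1 : 1 <= P.
Hypothesis Pn : P <= n%:R.
Hypothesis nm : (n <= m)%N.
Hypothesis cx : conc x.
Hypothesis cy : conc y.

Let beta : R := cb * (1 + P).
Let H : R := head P (fun p => x p - y p).
Let S : R := `|far_mom true x - far_mom true y| + `|far_mom false x - far_mom false y|.
Let T : R := bd_tail n%:R x + bd_tail n%:R y.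

Let mx : measurable_fun setT x. Proof. by case: cx. Qed.
Let my : measurable_fun setT y. Proof. by case: cy. Qed.
Let x0 p : 0 <= x p. Proof. by case: cx. Qed.
Let y0 p : 0 <= y p. Proof. by case: cy. Qed.
Let xp p : p <= 0 -> x p = 0. Proof. by case: cx => [_ _ h _]; exact: h. Qed.
Let yp p : p <= 0 -> y p = 0. Proof. by case: cy => [_ _ h _]; exact: h. Qed.
Let bx : bd_integrable x. Proof. exact: conc_bd_integrable. Qed.
Let by_ : bd_integrable y. Proof. exact: conc_bd_integrable. Qed.
Let bxy : bd_integrable (fun p => x p - y p). Proof. exact: bd_integrableB. Qed.
Let Pm : P <= m%:R. Proof. by rewrite (le_trans Pn)// ler_nat. Qed.
Let P0 : 0 <= P. Proof. exact: le_trans P1. Qed.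

Let beta_ge1 : 1 <= beta.
Proof. by rewrite mulr_ege1 ?cb_ge1// lerDl. Qed.
Let beta_ge0 : 0 <= beta. Proof. exact: le_trans beta_ge1. Qed.

Let bd_beta p : 0 < p -> p < P -> bd p <= beta.
Proof.
move=> p0 pP; rewrite (le_trans (bd_le D p))// ler_wpM2l ?cb_ge0//.
by rewrite /wt lerD2l gtr0_norm// ltW.
Qed.

Let H0 : 0 <= H. Proof. exact: head_ge0. Qed.
Let S0 : 0 <= S. Proof. by rewrite addr_ge0. Qed.
Let T0 : 0 <= T. Proof. by rewrite addr_ge0 ?bd_tail_ge0. Qed.

Let ker_sec p : measurable_fun setT (ker p).
Proof. exact: (@measurable_pair R ker (fun=> p) id (ker_m D)). Qed.

Let integ_sec_ker p v (g : R -> R) : bd_integrable v -> measurable_fun setT g ->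
  (forall q, `|g q| <= `|v q|) -> integ (fun q => ker p q * g q).
Proof.
move=> [mv vi] mg gv; apply: integ_le (integZ (bd p) vi) => [|q].
  by apply: measurable_funM => //; exact: ker_sec.
rewrite normrM (ger0_norm (ker_ge0 _ _ _)) mulrA ler_pM ?ker_ge0//.
exact: ker_le.
Qed.

Lemma loss_le_bd_norm k z p : conc z -> loss (kern k) z p <= bd p * bd_norm z.
Proof.
move=> cz; have [mz z0 _ _] := cz; have [_ zi] := conc_bd_integrable D cz.
rewrite -intZ//; apply: int_le; last 2 first.
- exact: integZ.
- move=> q; rewrite (ger0_norm (z0 q)) mulrA ler_wpM2r//.
  exact: le_trans (kern_le_ker _ _ _ _) (ker_le _ _ _).
apply: integ_le (integZ (bd p) zi) => [|q].
  apply: measurable_funM => //.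
  exact: (@measurable_pair R (kern k) (fun=> p) id (kern_m D k)).
rewrite normrM (ger0_norm (kern_ge0 D k p q)) (ger0_norm (z0 q)) mulrA ler_wpM2r//.
exact: le_trans (kern_le_ker _ _ _ _) (ker_le _ _ _).
Qed.

Let loss_split k (z : R -> R) p : conc z -> p < k%:R ->
  loss (kern k) z p = \int[mu]_q (ker p q * z q) -
    \int[mu]_q (ker p q * ((1 - chi k%:R q) * z q)).
Proof.
move=> cz pk; have [mz z0 _ _] := cz; have bz := conc_bd_integrable D cz.
rewrite -intB.
- apply: eq_int => q; rewrite /kern.
  by have -> : chi k%:R p = 1 :> R; [rewrite /chi pk|ring].
- exact: (@integ_sec_ker p z z bz mz (fun _ => lexx _)).
- apply: (@integ_sec_ker p z (fun q => (1 - chi k%:R q) * z q) bz).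
    by apply: measurable_funM => //; exact: measurable_chi_compl.
  move=> q; rewrite normrM ler_piMl// ger0_norm ?chi_compl_ge0//.
  exact: chi_compl_le1.
Qed.

Let tail_le k (z : R -> R) p : conc z ->
  `|\int[mu]_q (ker p q * ((1 - chi k%:R q) * z q))| <= bd p * bd_tail k%:R z.
Proof.
move=> cz; have [mz z0 _ _] := cz; have bz := conc_bd_integrable D cz.
have ti := integ_bd_tail k%:R bz.
rewrite -intZ//; apply: int_abs_le; first exact: integZ.
  apply: measurable_funM; first exact: ker_sec.
  by apply: measurable_funM => //; exact: measurable_chi_compl.
move=> q; rewrite normrM (ger0_norm (ker_ge0 _ _ _)).
rewrite normrM (ger0_norm (chi_compl_ge0 _ _)).
rewrite [leRHS](_ : _ = bd p * bd q * ((1 - chi k%:R q) * `|z q|)); last ring.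
by rewrite ler_wpM2r ?ker_le// mulr_ge0 ?chi_compl_ge0.
Qed.

Let main_le p : 0 < p -> p < P ->
  `|\int[mu]_q (ker p q * (x q - y q))| <= beta * (beta * H + S).
Proof.
move=> p0 pP.
have bp := bd_beta p0 pP.
(* Partners below 1; beyond 1 the kernel is separated. *)
pose f q := chi 1 q * (ker p q * (x q - y q)).
have kxy : integ (fun q => ker p q * (x q - y q)).
  by apply: (@integ_sec_ker p _ (fun q => x q - y q) bxy) => //; exact: measurable_funB.
have mf : measurable_fun setT f.
  apply: measurable_funM; first exact: measurable_chi.
  exact: integ_mfun kxy.
have ih := integ_head P bxy.
have fb q : `|f q| <= beta * beta * (chi P q * `|x q - y q|).
  rewrite /f; have [q0|q0] := leP q 0.
    by rewrite xp// yp// subr0 normr0 !mulr0 normr0.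
  rewrite /chi; have [q1|q1] := ltP q 1; last first.
    by rewrite mul0r normr0; nneg.
  rewrite (lt_le_trans q1 P1) !mul1r normrM (ger0_norm (ker_ge0 _ _ _)).
  rewrite ler_wpM2r// (le_trans (ker_le _ _ _))//.
  by rewrite ler_pM ?bd_ge0// bd_beta// (lt_le_trans q1).
have fi : integ f by exact: (integ_le (mu := mu) mf fb (integZ _ ih)).
have fle : `|\int[mu]_q f q| <= beta * beta * H.
  by rewrite -intZ//; apply: (int_abs_le (mu := mu)) => //; exact: integZ.
have E : \int[mu]_q (ker p q * (x q - y q)) = \int[mu]_q f q +
   (sa D true p * (far_mom true x - far_mom true y) + sa D false p * (far_mom false x - far_mom false y)).
  have i1 := far_mom_integ true bx; have i2 := far_mom_integ true by_.
  have i3 := far_mom_integ false bx; have i4 := far_mom_integ false by_.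
  rewrite /far_mom -!intB// -!intZ; [|exact: integB|exact: integB].
  rewrite -!intD//; last 3 first.
  - by apply: integD; apply: integZ; exact: integB.
  - by apply: integZ; exact: integB.
  - by apply: integZ; exact: integB.
  apply: eq_int => q; rewrite /f /chi; case: (ltP q 1) => q1.
    by rewrite subrr !mul0r subrr !mulr0 !addr0 mul1r.
  by rewrite (ker_sep D p q1); ring.
rewrite E (le_trans (ler_normD _ _))// [beta * _]mulrDr lerD//.
  by rewrite mulrA.
rewrite (le_trans (ler_normD _ _))// [beta * _]mulrDr.
by apply: lerD; rewrite normrM ler_wpM2r// ger0_norm ?sa_ge0//
  (le_trans (sa_le _ _ _)).
Qed.

(** Partners below 1 are compared below [P], partners beyond 1 through the two
    numbers [far_mom], and the partners removed by the truncation are in the tails. *)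
Lemma loss_diff p : 0 < p -> p < P ->
  `|loss (kern n) x p - loss (kern m) y p| <= beta * (beta * H + S + T).
Proof.
move=> p0 pP.
rewrite (loss_split cx (lt_le_trans pP Pn)) (loss_split cy (lt_le_trans pP Pm)).
have := main_le p0 pP.
have iX : integ (fun q => ker p q * x q) by exact: (@integ_sec_ker p x x bx mx (fun _ => lexx _)).
have iY : integ (fun q => ker p q * y q) by exact: (@integ_sec_ker p y y by_ my (fun _ => lexx _)).
rewrite [X in `|X| <= _ -> _](_ : _ = \int[mu]_q (ker p q * x q) -
    \int[mu]_q (ker p q * y q)); last first.
  by rewrite -intB//; apply: eq_int => q; ring.
have := tail_le n p cx; have := tail_le m p cy.
move: (\int[mu]_q (ker p q * x q)) (\int[mu]_q (ker p q * y q)) => a b.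
move: (\int[mu]_q _) (\int[mu]_q _) => d c hc hd hab.
have tlm : bd_tail m%:R y <= bd_tail n%:R y by rewrite bd_tail_le// ler_nat.
have hb := bd_beta p0 pP.
have b0 := bd_ge0 D p.
have hc' : `|c| <= beta * bd_tail n%:R y.
  by rewrite (le_trans hc)// ler_pM ?bd_tail_ge0.
have hd' : `|d| <= beta * bd_tail n%:R x.
  by rewrite (le_trans hd)// ler_wpM2r// bd_tail_ge0.
rewrite (_ : a - d - (b - c) = (a - b) + (c - d)); last ring.
rewrite (le_trans (ler_normD _ _))// (mulrDr beta (_ + _)) lerD//.
by rewrite (le_trans (ler_normB _ _))// /T mulrDr addrC lerD.
Qed.

Variable M : R.
Hypothesis xM : mom x <= M.
Hypothesis yM : mom y <= M.

Let M0 : 0 <= M. Proof. exact: le_trans (mom_ge0 cx) xM. Qed.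
Let xn : bd_norm x <= cb * M.
Proof. by rewrite (le_trans (bd_norm_mom D cx))// ler_wpM2l// cb_ge0. Qed.

Let one T' (p : T') : `|(1 : R)| <= 1. Proof. by rewrite normr1. Qed.

Let gain_integ k z : conc z -> integ (gain (kern k) z).
Proof.
move=> cz; have [gi _] := gain_test D k cz (measurable_cst (1 : R)) (@one _).
by apply: integ_ext gi => p; rewrite mul1r.
Qed.

Let loss_integ k z : conc z -> integ (fun p => z p * loss (kern k) z p).
Proof.
move=> cz; have [gi _] := loss_test D k cz (measurable_cst (1 : R)) (@one _).
by apply: integ_ext gi => p; rewrite mul1r.
Qed.

(** Tested with the sign of the difference, the norm becomes a weak form. A particle
    below [P] arises from partners below [P] only, so nothing beyond [P] enters. *)
Lemma gain_diff :
  \int[mu]_p (chi P p * `|gain (kern n) x p - gain (kern m) y p|) <=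
  beta * beta * (2 * M) * H.
Proof.
have gx := gain_integ n cx; have gy := gain_integ m cy.
pose s p := Num.sg (gain (kern n) x p - gain (kern m) y p).
pose w p := chi P p * s p.
have mg := integ_mfun (integB gx gy).
have ms : measurable_fun setT s.
  exact: (measurableT_comp (@measurable_sgr R) mg).
have mw : measurable_fun setT w.
  by apply: measurable_funM => //; exact: measurable_chi.
have w1 p : `|w p| <= 1.
  rewrite normrM ger0_norm ?chi_ge0// mulr_ile1 ?chi_ge0 ?chi_le1//.
  by rewrite /s normr_sg lern1 leq_b1.
have [wxi wxE] := gain_test D n cx mw w1.
have [wyi wyE] := gain_test D m cy mw w1.
have -> : \int[mu]_p (chi P p * `|gain (kern n) x p - gain (kern m) y p|) =
    form (kern n) (fun a => w (a.1 + a.2)) x x -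
    form (kern m) (fun a => w (a.1 + a.2)) y y.
  rewrite -wxE -wyE -intB//; apply: eq_int => p.
  by rewrite /w -mulrBr -mulrA -normrEsg.
have ms2 := measurable_sum2 mw.
have [ix _] := form_le (kern_m D n) (kern_ge0 D n) (kern_le_ker D n) ms2
   (fun a => w1 _) bx bx.
have [iy _] := form_le (kern_m D m) (kern_ge0 D m) (kern_le_ker D m) ms2
   (fun a => w1 _) by_ by_.
have ih := integ_head P bxy.
have ihx := conc_integ cx; have ihy := conc_integ cy.
have [t1 e1] := integ_tensor ih ihx; have [t2 e2] := integ_tensor ihy ih.
apply: (@le_trans _ _ (beta * beta * (H * \int[mu]_p x p + (\int[mu]_p y p) * H))); last first.
  rewrite -[leRHS]mulrA; apply: ler_wpM2l; first by nneg.
  rewrite (_ : 2 * M * H = H * M + M * H); last by ring.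
  by rewrite lerD// ?ler_wpM2l ?ler_wpM2r// ?(le_trans (int_conc_le_mom cx))
    ?(le_trans (int_conc_le_mom cy)).
rewrite -e1 -e2 -intD// -intZ; last exact: integD.
apply: le_trans (ler_norm _) _.
rewrite /form -intB//; apply: int_abs_le.
- by apply: integZ; exact: integD.
- by apply: measurable_funB; [exact: integ_mfun ix|exact: integ_mfun iy].
move=> [p q] /=.
have rhs0 : 0 <= beta * beta * (chi P p * `|x p - y p| * x q + y p * (chi P q * `|x q - y q|)).
  by nneg.
have [p0|p0] := leP p 0.
  by rewrite !kern_pos// !mul0r !mulr0 subrr normr0.
have [q0|q0] := leP q 0.
  by rewrite !(kern_sym D _ p q) !kern_pos// !mul0r !mulr0 subrr normr0.
have [pq|pq] := ltP (p + q) P; last first.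
  by rewrite /w /chi (ltNge (p + q)) pq/= !mul0r subrr normr0.
have pP : p < P by lra.
have qP : q < P by lra.
rewrite -mulrBr normrM -[leRHS]mul1r ler_pM//.
rewrite /kern /chi pP qP !(lt_le_trans pP Pn) !(lt_le_trans qP Pn).
rewrite !(lt_le_trans pP Pm) !(lt_le_trans qP Pm) !mul1r !mulr1.
rewrite -mulrBr normrM (ger0_norm (ker_ge0 _ _ _)) ler_pM ?ker_ge0//.
  by rewrite (le_trans (ker_le _ _ _))// ler_pM ?bd_ge0 ?bd_beta.
rewrite (_ : x p * x q - y p * y q = (x p - y p) * x q + y p * (x q - y q)); last ring.
by rewrite (le_trans (ler_normD _ _))// !normrM (ger0_norm (x0 q)) (ger0_norm (y0 p)).
Qed.

Definition diff_const : R :=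
  beta * beta * M + beta * cb * M + M * beta * (beta + 1) + beta.

(** On sizes below [P] the rates differ by no more than the concentrations below
    [P], two numbers and the tails. The norm beyond [P] does not occur, so the estimate
    closes for each [P] separately. *)
Lemma rate_diff : \int[mu]_p (chi P p * `|rt n x p - rt m y p|) <=
  diff_const * (H + S + T).
Proof.
have gx := gain_integ n cx; have gy := gain_integ m cy.
have lx := loss_integ n cx; have ly := loss_integ m cy.
have rx := integ_rt D n cx; have ry := integ_rt D m cy.
have ihx := conc_integ cx; have ihy := conc_integ cy.
have ih := integ_head P bxy.
have I1 := integ_chi P (integB gx gy).
pose G := beta * (beta * H + S + T).
have I2 := integZ (beta * (cb * M)) ih.
have I3 := integZ G ihy.
have I4 := integZ beta ih.
apply: (@le_trans _ _ (2^-1 * \int[mu]_p (chi P p * `|gain (kern n) x p - gain (kern m) y p|) +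
  beta * (cb * M) * H + G * \int[mu]_p y p + beta * H)); last first.
  have := gain_diff.
  have : G * \int[mu]_p y p <= G * M.
    rewrite ler_wpM2l ?(le_trans (int_conc_le_mom cy))// /G.
    by nneg.
  rewrite /diff_const /G.
  set ig := \int[mu]_p _; set iy := _ * \int[mu]_p _.
  have c0 := cb_ge0 D.
  have h1 : 0 <= beta * beta * M * (S + T) by nneg.
  have h2 : 0 <= beta * cb * M * (S + T) by nneg.
  have h3 : 0 <= M * beta * H by nneg.
  have h4 : 0 <= M * beta * beta * (S + T) by nneg.
  have h5 : 0 <= beta * (S + T) by nneg.
  lra.
have J1 := integZ 2^-1 I1; have J2 := integD J1 I2.
have J3 := integD J2 I3; have J4 := integD J3 I4.
rewrite /H /head -!intZ// -!intD//; apply: int_le => //.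
  exact: (integ_chi P (integB rx ry)).
move=> p; have G0 : 0 <= G by rewrite /G; nneg.
rewrite /chi; case: (ltP p P) => pP; last first.
  by rewrite !mul0r !mulr0 !add0r addr0 mulr_ge0.
rewrite !mul1r; have [p0|p0] := leP p 0.
  by rewrite !rate_pos ?xp ?yp//; try exact: kern_sym; try exact: kern_pos;
  try exact: src_conc; rewrite subrr normr0 !mulr0 !addr0 mulr_ge0// invr_ge0.
have hb := bd_beta p0 pP.
have hl := loss_diff p0 pP; rewrite -/G in hl.
have hlx : loss (kern n) x p <= beta * (cb * M).
  rewrite (le_trans (loss_le_bd_norm n p cx))// ler_pM ?bd_ge0 ?bd_norm_ge0//.
have lx0 : 0 <= loss (kern n) x p.
  by apply: int_ge0 => q; rewrite mulr_ge0 ?kern_ge0.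
have hr : `|remn D n p * x p - remn D m p * y p| <= beta * `|x p - y p|.
  rewrite /remn /chi (lt_le_trans pP Pn) (lt_le_trans pP Pm) !mulr1 -mulrBr normrM.
  by rewrite ler_wpM2r// ger0_norm ?rem_ge0// (le_trans (rem_le _ _)).
have hL : `|x p * loss (kern n) x p - y p * loss (kern m) y p| <=
    beta * (cb * M) * `|x p - y p| + G * y p.
  rewrite (_ : _ - _ = (x p - y p) * loss (kern n) x p +
    y p * (loss (kern n) x p - loss (kern m) y p)); last ring.
  rewrite (le_trans (ler_normD _ _))// !normrM lerD//.
    by rewrite mulrC ler_wpM2r// ger0_norm.
  by rewrite mulrC (ger0_norm (y0 p)) ler_wpM2r.
rewrite /rate.
rewrite (_ : _ - _ = 2^-1 * (gain (kern n) x p - gain (kern m) y p) -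
  (x p * loss (kern n) x p - y p * loss (kern m) y p) -
  (remn D n p * x p - remn D m p * y p)); last ring.
rewrite (le_trans (ler_normB _ _))// lerD//.
rewrite (le_trans (ler_normB _ _))// -addrA lerD//.
by rewrite normrM ger0_norm ?invr_ge0.
Qed.

End rate_diff.

(** * Comparison of two approximations *)

Section comparison.
Context (R : realType) (D : coag_data R).
Notation bd := (bd D).
Notation cb := (cb D).
Notation kern := (kern D).
Notation bd_integrable := (bd_integrable D).
Notation bd_norm := (bd_norm D).
Notation bd_tail := (bd_tail D).
Notation far_mom := (far_mom D).
Notation dt := (dt D).
Notation level := (level D).
Notation euler := (euler D).
Notation bnd := (bnd D).
Notation rt n := (rate (kern n) (remn D n) (src D)).

Lemma discrete_gronwall (d : nat -> R) (a g v : R) (L : nat) : 0 <= a -> 0 <= g ->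
  0 <= v -> d 0 <= v -> (forall l, (l < L)%N -> d l.+1 <= (1 + a) * d l + g) ->
  d L <= (v + L%:R * g) * expR (L%:R * a).
Proof.
move=> a0 g0 v0 d0 dS.
have a1 : 1 <= 1 + a by rewrite lerDl.
suff h l : (l <= L)%N -> d l <= (v + l%:R * g) * (1 + a) ^+ l.
  rewrite (le_trans (h L (leqnn L)))// ler_wpM2l ?addr_ge0 ?mulr_ge0// expRM_natl.
  by rewrite lerXn2r ?nnegrE ?expR_ge0 ?expR_ge1Dx// (le_trans _ a1).
elim: l => [_|l IH lL]; first by rewrite mul0r addr0 expr0 mulr1.
rewrite (le_trans (dS l lL))//.
apply: (@le_trans _ _ ((1 + a) * ((v + l%:R * g) * (1 + a) ^+ l) + g * (1 + a) ^+ l.+1)).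
  rewrite lerD// ?ler_wpM2l ?IH 1?ltnW// ?(le_trans _ a1)//.
  by rewrite ler_peMr// exprn_ege1.
by rewrite -natr1 exprS le_eqVlt; apply/orP; left; apply/eqP; ring.
Qed.

Definition rate_bound (M : R) : R := 2 * ((cb * M) * (cb * M)) + mom (src D) + cb * M.

Lemma rate_bound_ge0 M : 0 <= M -> 0 <= rate_bound M.
Proof.
move=> M0; rewrite /rate_bound; nneg.
exact/mom_ge0/src_conc.
Qed.

Lemma rate_bounded n z M : conc z -> mom z <= M -> \int[mu]_p `|rt n z p| <= rate_bound M.
Proof.
move=> cz zM; have b0 := bd_norm_ge0 D z.
have bM : bd_norm z <= cb * M by rewrite (le_trans (bd_norm_mom D cz))// ler_wpM2l// cb_ge0.
by rewrite (le_trans (rate_L1 D n cz))// !lerD// ler_wpM2l// ler_pM.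
Qed.

Definition idx (n : nat) (t : R) : nat := Num.truncn (t / dt n).
(** Piecewise constant in time: the value at the last grid point. *)
Definition approx (n : nat) (t : R) : R -> R := euler n (idx n t).

Lemma idx_itv n t : 0 <= t ->
  (idx n t)%:R * dt n <= t < (idx n t).+1%:R * dt n.
Proof.
move=> t0; have := truncn_itv (divr_ge0 t0 (dt_ge0 D n)).
by rewrite ler_pdivlMr ?dt_gt0// ltr_pdivrMr ?dt_gt0.
Qed.

Lemma idx_grid n l : idx n (l%:R * dt n) = l.
Proof. by rewrite /idx mulfK ?natrK// gt_eqF// dt_gt0. Qed.

Lemma approx_conc n t T : 0 <= t <= T -> T <= n%:R ->
  conc (approx n t) /\ mom (approx n t) <= bnd T.
Proof.
move=> /andP[t0 tT] Tn; have /andP[it _] := idx_itv n t0.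
have [] := @euler_conc _ D n (idx n t).
  by rewrite (le_trans it)// (le_trans tT).
by move=> cz mz; split=> //; rewrite (le_trans mz)// le_bnd// (le_trans it).
Qed.

Lemma euler_conc_bnd n j T : T <= n%:R -> j%:R * dt n <= T ->
  conc (euler n j) /\ mom (euler n j) <= bnd T.
Proof.
move=> Tn jT; have [] := @euler_conc _ D n j; first exact: le_trans Tn.
by move=> cz mz; split=> //; rewrite (le_trans mz)// le_bnd.
Qed.

Lemma euler_lip n j i T : T <= n%:R -> (j + i)%:R * dt n <= T ->
  \int[mu]_p `|euler n (j + i) p - euler n j p| <= i%:R * dt n * rate_bound (bnd T).
Proof.
move=> Tn; elim: i => [|i IH] jT.
  rewrite addn0 !mul0r; under eq_Rintegral do rewrite subrr normr0.
  by rewrite int0.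
have jT' : (j + i)%:R * dt n <= T.
  by rewrite (le_trans _ jT)// ler_wpM2r ?dt_ge0// ler_nat leq_add2l.
have jT0 : j%:R * dt n <= T.
  by rewrite (le_trans _ jT)// ler_wpM2r ?dt_ge0// ler_nat leq_addr.
have [cz mz] := euler_conc_bnd Tn jT'.
have [cz0 mz0] := euler_conc_bnd Tn jT0.
have ri := integ_abs (integ_rt D n cz).
have di := integ_abs (integB (conc_integ cz) (conc_integ cz0)).
have [c1 _] := euler_conc_bnd Tn jT.
have d1 := integ_abs (integB (conc_integ c1) (conc_integ cz0)).
apply: (@le_trans _ _ (\int[mu]_p `|euler n (j + i) p - euler n j p| +
    dt n * \int[mu]_p `|rt n (euler n (j + i)) p|)).
  rewrite -intZ// -intD//; last exact: integZ.
  apply: int_le => //; first by apply: integD => //; exact: integZ.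
  move=> p; rewrite addnS /= addrAC (le_trans (ler_normD _ _))// lerD//.
  by rewrite normrM (ger0_norm (dt_ge0 D n)).
rewrite -natr1 mulrDl mul1r mulrDl lerD ?IH// ler_wpM2l ?dt_ge0//.
exact: rate_bounded.
Qed.

Lemma approx_lip n s t T : 0 <= s -> s <= t -> t <= T -> T <= n%:R ->
  \int[mu]_p `|approx n t p - approx n s p| <= (t - s + dt n) * rate_bound (bnd T).
Proof.
move=> s0 st tT Tn.
have t0 := le_trans s0 st.
have /andP[s1 s2] := idx_itv n s0; have /andP[t1 t2] := idx_itv n t0.
have ij : (idx n s <= idx n t)%N.
  rewrite leqNgt; apply/negP => lt.
  have : (idx n t).+1%:R * dt n <= (idx n s)%:R * dt n.
    by rewrite ler_wpM2r ?dt_ge0// ler_nat.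
  by move=> h; have := lt_le_trans t2 (le_trans h (le_trans s1 st)); rewrite ltxx.
rewrite /approx -(subnKC ij).
apply: le_trans (euler_lip Tn _) _.
  by rewrite subnKC// (le_trans t1).
apply: ler_wpM2r; first by rewrite rate_bound_ge0// bnd_ge0// (le_trans t0).
rewrite natrB// mulrBl.
move: s2; rewrite -natr1 mulrDl mul1r; lra.
Qed.

Lemma diff_const_ge0 P M : 1 <= P -> 0 <= M -> 0 <= diff_const D P M.
Proof.
move=> P1 M0; have P0 : 0 <= P := le_trans ler01 P1.
by rewrite /diff_const; nneg.
Qed.

Section two_levels.
Variables (n m : nat) (P T delta tau : R).
Hypothesis P1 : 1 <= P.
Hypothesis Pn : P <= n%:R.
Hypothesis T0 : 0 <= T.
Hypothesis Tn : T <= n%:R.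
Hypothesis nm : (n <= m)%N.
Hypothesis far_mom_close : forall t, 0 <= t <= T ->
  `|far_mom true (approx n t) - far_mom true (approx m t)| +
  `|far_mom false (approx n t) - far_mom false (approx m t)| <= delta.
Hypothesis tln : forall t, 0 <= t <= T -> bd_tail n%:R (approx n t) <= tau.
Hypothesis tlm : forall t, 0 <= t <= T -> bd_tail n%:R (approx m t) <= tau.

Let Tm : T <= m%:R. Proof. by rewrite (le_trans Tn)// ler_nat. Qed.
Let r : nat := (2 ^ (level m - level n))%N.
Let r0 : (0 < r)%N. Proof. by rewrite expn_gt0. Qed.
Let dtE : dt n = r%:R * dt m. Proof. exact: dt_nested. Qed.
Let dm0 := dt_ge0 D m.
Let dn0 := dt_ge0 D n.
Let M : R := bnd T.
Let M0 : 0 <= M. Proof. exact: bnd_ge0. Qed.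
Let E : R := diff_const D P M.
Let E0 : 0 <= E.
Proof. exact: diff_const_ge0. Qed.

Lemma idx_div t : 0 <= t -> idx n t = (idx m t %/ r)%N.
Proof.
move=> t0; apply/eqP; rewrite /idx truncn_eq ?divr_ge0// ler_pdivlMr ?dt_gt0//.
rewrite ltr_pdivrMr ?dt_gt0// dtE !mulrA -!natrM.
have /andP[h1 h2] := idx_itv m t0.
apply/andP; split.
  by rewrite (le_trans _ h1)// ler_wpM2r// ler_nat leq_trunc_div.
by rewrite (lt_le_trans h2)// ler_wpM2r// ler_nat ltn_ceil.
Qed.

(* The coarse scheme, interpolated affinely on the fine grid. *)
Let intp l (p : R) : R :=
  euler n (l %/ r) p + (l %% r)%:R * dt m * rt n (euler n (l %/ r)) p.

Let intpS l p : intp l.+1 p = intp l p + dt m * rt n (euler n (l %/ r)) p.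
Proof.
rewrite /intp; have lr := ltn_pmod l r0.
have [h|h] := ltnP (l %% r).+1 r.
  have Em : (l.+1 %% r)%N = (l %% r).+1 by rewrite -addn1 -modnDml addn1 modn_small.
  have Ed : (l.+1 %/ r)%N = (l %/ r)%N.
    by rewrite {1}(divn_eq l r) -addnS divnMDl// (divn_small h) addn0.
  by rewrite Em Ed -natr1; ring.
have h' : (l %% r).+1 = r by apply/eqP; rewrite eqn_leq lr h.
have E1 : l.+1 = ((l %/ r).+1 * r)%N.
  by rewrite {1}(divn_eq l r) -addnS h' mulSn addnC.
have Er : r%:R = (l %% r)%:R + 1 :> R by rewrite -{1}h' -natr1.
by rewrite E1 mulnK// modnMl mul0r mul0r addr0 /= dtE Er; ring.
Qed.

Let time_div l : (l %/ r)%:R * dt n <= l%:R * dt m.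
Proof. by rewrite dtE mulrA -natrM ler_wpM2r// ler_nat leq_trunc_div. Qed.

Let d l := head P (fun p => intp l p - euler m l p).

Let x l := euler n (l %/ r).
Let xc l : l%:R * dt m <= T -> conc (x l) /\ mom (x l) <= M.
Proof. by move=> lT; apply: (euler_conc_bnd Tn); rewrite (le_trans (time_div l)). Qed.
Let yc l : l%:R * dt m <= T -> conc (euler m l) /\ mom (euler m l) <= M.
Proof. exact: euler_conc_bnd. Qed.

Let intp_i l : l%:R * dt m <= T -> integ (intp l).
Proof.
move=> lT; have [cx _] := xc lT.
by apply: integD; [exact: conc_integ|apply: integZ; exact: integ_rt].
Qed.

Let modle l : 0 <= (l %% r)%:R * dt m <= dt n.
Proof. by rewrite mulr_ge0//= dtE ler_wpM2r// ler_nat ltnW// ltn_mod. Qed.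

Let head_intp l : l%:R * dt m <= T ->
  head P (fun p => x l p - intp l p) <= dt n * rate_bound M.
Proof.
move=> lT; have [cx xM] := xc lT; have ri := integ_abs (integ_rt D n cx).
apply: (@le_trans _ _ (dt n * \int[mu]_p `|rt n (x l) p|)); last first.
  by rewrite ler_wpM2l// rate_bounded.
rewrite -intZ//; apply: int_le.
- by apply: integ_chi; apply: integB; [exact: conc_integ|exact: intp_i].
- exact: integZ.
move=> p; rewrite /intp -/(x l) opprD addrA subrr sub0r normrN normrM.
have /andP[c0 c1] := modle l; rewrite (ger0_norm c0).
apply: le_trans (_ : (l %% r)%:R * dt m * `|rt n (x l) p| <= _).
  by rewrite ler_piMl ?chi_le1// mulr_ge0.
by rewrite ler_wpM2r.
Qed.

(* Errors made by freezing the coarse rate, by the far moments and by the tails. *)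
Let G : R := dt n * rate_bound M + delta + (tau + tau).

Let d_step l : l.+1%:R * dt m <= T -> d l.+1 <= (1 + dt m * E) * d l + dt m * E * G.
Proof.
move=> l1T.
have lT : l%:R * dt m <= T by rewrite (le_trans _ l1T)// ler_wpM2r// ler_nat.
have tT : 0 <= l%:R * dt m <= T by rewrite mulr_ge0.
have [cx xM] := xc lT; have [cy yM] := yc lT; have [cy1 _] := yc l1T.
have ix : approx n (l%:R * dt m) = x l.
  by rewrite /approx idx_div ?idx_grid//; case/andP: tT.
have iy : approx m (l%:R * dt m) = euler m l by rewrite /approx idx_grid.
have := far_mom_close tT; have := tln tT; have := tlm tT; rewrite ix iy => t2 t1 cl.
have := rate_diff D P1 Pn nm cx cy xM yM; rewrite -/E => rd.
have Ii := intp_i lT; have ci := conc_integ cy; have cxi := conc_integ cx.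
have rxi := integ_rt D n cx; have ryi := integ_rt D m cy.
have Hle : head P (fun p => x l p - euler m l p) <= dt n * rate_bound M + d l.
  apply: le_trans (head_tri P (integB cxi Ii) (integB Ii ci)) _.
  by rewrite lerD2r head_intp.
have dS : d l.+1 <= d l + dt m * \int[mu]_p (chi P p * `|rt n (x l) p - rt m (euler m l) p|).
  have J2 := integ_chi P (integB Ii ci); have J3 := integ_chi P (integB rxi ryi).
  rewrite /d /head -intZ// -intD//; last exact: integZ.
  apply: int_le.
  - apply: integ_chi; apply: integB; last exact: conc_integ.
    exact: intp_i.
  - by apply: integD => //; exact: integZ.
  move=> p; rewrite intpS /= mulrCA -mulrDr ler_wpM2l ?chi_ge0//.
  rewrite -[X in _ <= _ + X * _](ger0_norm dm0) -normrM.
  rewrite [X in `|X| <= _](_ : _ = (intp l p - euler m l p) +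
     dt m * (rt n (x l) p - rt m (euler m l) p)); first exact: ler_normD.
  by rewrite /x; ring.
apply: le_trans dS _.
rewrite mulrDl mul1r -addrA lerD2l -mulrA -mulrA -!mulrDr ler_wpM2l//.
apply: le_trans rd _; rewrite ler_wpM2l// /G.
move: (head P _) (`|_| + `|_|) Hle cl => a b; lra.
Qed.

(** Seen on the fine grid, the coarse scheme follows the same equation up to the
    error [G], so the discrete Gronwall lemma applies. *)
Lemma two_levels t : 0 <= t <= T ->
  head P (fun p => approx n t p - approx m t p) <=
  dt n * rate_bound M + T * (E * G) * expR (E * T).
Proof.
move=> tT; have /andP[t0 tT'] := tT; set l := idx m t.
have /andP[h1 h2] := idx_itv m t0; rewrite -/l in h1 h2.
have lT : l%:R * dt m <= T := le_trans h1 tT'.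
have G0 : 0 <= G.
  have tau0 : 0 <= tau by rewrite (le_trans _ (tln tT))// bd_tail_ge0.
  have delta0 : 0 <= delta by rewrite (le_trans _ (far_mom_close tT))// addr_ge0.
  have L0 : 0 <= rate_bound M by exact: rate_bound_ge0.
  by apply: addr_ge0; [apply: addr_ge0 => //; exact: mulr_ge0|exact: addr_ge0].
have [cx xM] := xc lT; have [cy yM] := yc lT.
have Ii := intp_i lT; have ci := conc_integ cy; have cxi := conc_integ cx.
apply: (@le_trans _ _ (head P (fun p => x l p - intp l p) + d l)).
  by rewrite /approx idx_div//; exact: (head_tri P (integB cxi Ii) (integB Ii ci)).
rewrite lerD ?head_intp//.
apply: le_trans (@discrete_gronwall d (dt m * E) (dt m * E * G) 0 l _ _ _ _ _) _.
- by rewrite mulr_ge0.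
- by rewrite !mulr_ge0.
- by [].
- rewrite /d /head.
  under eq_Rintegral => p _ do rewrite /intp div0n mod0n mul0r mul0r addr0 subrr normr0 mulr0.
  by rewrite int0.
- move=> i il; apply: d_step.
  by rewrite (le_trans _ lT)// ler_wpM2r// ler_nat.
rewrite add0r (_ : l%:R * (dt m * E * G) = (l%:R * dt m) * (E * G)); last ring.
rewrite (_ : l%:R * (dt m * E) = E * (l%:R * dt m)); last ring.
apply: ler_pM; rewrite ?expR_ge0//.
- by rewrite !mulr_ge0.
- by rewrite ler_wpM2r// mulr_ge0.
- by rewrite ler_expR ler_wpM2l.
Qed.

End two_levels.

Definition uniform_tails : Prop := forall T e, 0 <= T -> 0 < e -> exists2 Q, 0 <= Q &
  forall n t, T <= n%:R -> 0 <= t <= T -> bd_tail Q (approx n t) <= e.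

End comparison.

(** * Extraction and almost everywhere convergence *)

Section extraction.
Context (R : realType).
Implicit Types (t T e : R).

Lemma ultra_lim (U : set_system nat) (w : nat -> R) (B : R) : UltraFilter U ->
  U [set n | `|w n| <= B] ->
  exists v, forall e, 0 < e -> U [set n | `|w n - v| < e].
Proof.
move=> UU UB.
have [] := @segment_compact R (- B) B (w @ U) _ _.
  change (U (w @^-1` `[- B, B]%classic)).
  by apply: filterS UB => n /=; rewrite in_itv/= ler_norml.
move=> v [_ clv]; exists v => e e0.
have [//|UC] := in_ultra_setVsetC [set n | `|w n - v| < e] UU.
have [] := clv [set y | ~ `|y - v| < e] (ball v e) _ _.
- exact: UC.
- exact: nbhsx_ballx.
- by move=> y [/= nyv]; rewrite /ball/= distrC.
Qed.

(** A free ultrafilter provides a limit at all times at once, and equicontinuity turns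
    it into a uniform limit on bounded time intervals: finitely many times suffice. *)
Lemma extraction (u : bool -> nat -> R -> R) :
  (forall T, 0 <= T -> exists B N, forall i n t, (N <= n)%N -> 0 <= t <= T ->
     `|u i n t| <= B) ->
  (forall T e, 0 <= T -> 0 < e -> exists2 h, 0 < h & exists N, forall i n s t,
     (N <= n)%N -> 0 <= s -> s <= t -> t <= T -> t - s <= h ->
     `|u i n t - u i n s| <= e) ->
  exists v : bool -> R -> R, forall T e (N : nat), 0 <= T -> 0 < e ->
    exists2 n, (N <= n)%N & forall i t, 0 <= t <= T -> `|u i n t - v i t| <= e.
Proof.
move=> ub ueq.
have [U [UU Uoo]] := ultraFilterLemma eventually_filter.
have Uge N : U [set n | (N <= n)%N] by apply: Uoo; exists N.
have Hlim i t : exists v, 0 <= t -> forall e, 0 < e -> U [set n | `|u i n t - v| < e].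
  have [t0|t0] := leP 0 t; last by exists 0.
  have [B [N BN]] := ub t t0.
  have [|v hv] := @ultra_lim U (fun n => u i n t) B UU; last by exists v.
  by apply: filterS (Uge N) => n /= Nn; apply: BN => //; rewrite t0/=.
pose v i t := projT1 (cid (Hlim i t)).
have vP i t : 0 <= t -> forall e, 0 < e -> U [set n | `|u i n t - v i t| < e].
  exact: (projT2 (cid (Hlim i t))).
exists v => T e N T0 e0.
have e5 : 0 < e / 5 by rewrite divr_gt0.
have [h h0 [N0 hN]] := ueq T (e / 5) T0 e5.
have veq i s t : 0 <= s -> s <= t -> t <= T -> t - s <= h ->
    `|v i t - v i s| <= e / 5 * 3.
  move=> s0 st tT tsh; have t0 := le_trans s0 st.
  have [n [/= n1 [/= n2 n3]]] := filter_ex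
    (filterI (vP i t t0 _ e5) (filterI (vP i s s0 _ e5) (Uge N0))).
  have := hN i n s t n3 s0 st tT tsh.
  rewrite (_ : v i t - v i s = - (u i n t - v i t) + (u i n t - u i n s) +
     (u i n s - v i s)); last ring.
  move=> n4; rewrite (le_trans (ler_normD _ _))//.
  have := ler_normD (- (u i n t - v i t)) (u i n t - u i n s).
  rewrite normrN; lra.
pose K := (Num.truncn (T / h)).+1.
have grid : U [set n | forall ik : bool * 'I_K,
    `|u ik.1 n (ik.2%:R * h) - v ik.1 (ik.2%:R * h)| < e / 5].
  apply: filter_forall => -[i k] /=; apply: vP => //.
  by rewrite mulr_ge0// ltW.
have [n [/= n1 [/= n2 n3]]] := filter_ex (filterI grid (filterI (Uge N) (Uge N0))).
exists n => // i t /andP[t0 tT].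
pose k := Num.truncn (t / h).
have kK : (k < K)%N by rewrite ltnS le_truncn// ler_pM2r ?invr_gt0.
have := truncn_itv (divr_ge0 t0 (ltW h0)); rewrite -/k.
rewrite ler_pdivlMr// ltr_pdivrMr// => /andP[k1 k2].
have kh0 : 0 <= k%:R * h by rewrite mulr_ge0// ltW.
have kh : t - k%:R * h <= h by move: k2; rewrite -natr1 mulrDl mul1r; lra.
have := n1 (i, Ordinal kK) => /= a1.
have a2 := hN i n _ _ n3 kh0 k1 tT kh.
have a3 := veq i _ _ kh0 k1 tT kh.
rewrite (_ : u i n t - v i t = (u i n t - u i n (k%:R * h)) +
   (u i n (k%:R * h) - v i (k%:R * h)) - (v i t - v i (k%:R * h))); last ring.
rewrite (le_trans (ler_normB _ _))//.
have := ler_normD (u i n t - u i n (k%:R * h)) (u i n (k%:R * h) - v i (k%:R * h)).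
lra.
Qed.

End extraction.

Section ae_limits.
Context (R : realType).

Lemma aeS (P Q : R -> Prop) : (forall p, P p -> Q p) ->
  {ae mu, forall p, P p} -> {ae mu, forall p, Q p}.
Proof. by move=> PQ; apply: negligibleS => p /= nQ Pp; exact/nQ/PQ. Qed.

Lemma ae_forall (P : nat -> R -> Prop) :
  (forall n, {ae mu, forall p, P n p}) -> {ae mu, forall p, forall n, P n p}.
Proof.
move=> h; have := negligible_bigcup h; apply: negligibleS => p /= nP.
apply: contrapT => nn; apply: nP => n; apply: contrapT => nPn.
by apply: nn; exists n.
Qed.

Lemma fatou_le (f : nat -> R -> R) (g : R -> R) (C : R) (N : nat) :
  (forall k, measurable_fun setT (f k)) -> (forall k p, 0 <= f k p) ->
  measurable_fun setT g -> (forall p, 0 <= g p) ->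
  {ae mu, forall p, f k p @[k --> \oo] --> g p} ->
  (forall k, (N <= k)%N -> (\int[mu]_p (f k p)%:E <= C%:E)%E) ->
  integ g /\ \int[mu]_p g p <= C.
Proof.
move=> mf f0 mg g0 fg fC.
have mE k : measurable_fun setT (EFin \o f k) by exact/measurable_EFinP.
have key : (\int[mu]_p (g p)%:E <= C%:E)%E.
  have -> : (\int[mu]_p (g p)%:E = \int[mu]_p limn_einf (fun k => (f k p)%:E))%E.
    apply: ae_eq_integral => //; first exact/measurable_EFinP.
      rewrite (_ : (fun p => _) = fun p => (- limn_esup (-%E \o (fun k => (f k p)%:E)))%E).
        apply: measurableT_comp => //; apply: measurable_fun_limn_esup => k.
        exact: (measurableT_comp (f := -%E) _ (mE k)).
      by apply/funext => p; rewrite limn_esupN oppeK.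
    apply: aeS fg => p fgp _; apply/esym.
    have c : (f k p)%:E @[k --> \oo] --> (g p)%:E.
      by apply: cvg_EFin => //; exact: nearW.
    rewrite is_cvg_limn_einfE; first exact/cvg_lim.
    by apply/cvg_ex; exists (g p)%:E.
  apply: le_trans (@fatou _ _ _ mu _ measurableT _ mE _) _.
    by move=> k p _ /=; rewrite lee_fin.
  rewrite limn_einf_lim; apply: lime_le; first exact: is_cvg_einfs.
  exists N => // k /= Nk; apply: le_trans (fC k Nk).
  by apply: ereal_inf_lbound; exists k => /=.
have gi : integ g.
  apply/integrableP; split; first exact/measurable_EFinP.
  under eq_integral do rewrite /= ger0_norm//.
  by rewrite (le_lt_trans key)// ltry.
by split=> //; rewrite -lee_fin EFin_int.
Qed.

(** The increments have a finite sum in the mean, hence almost everywhere. *)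
Lemma ae_cvg_series (f : nat -> R -> R) (N : nat) (w : R -> R) :
  (forall k, measurable_fun setT (f k)) -> measurable_fun setT w ->
  (forall p, 0 <= w p) ->
  (forall k, (N <= k)%N ->
    (\int[mu]_p (w p * `|f k p - f k.+1 p|)%:E <= (2 ^- k)%:E)%E) ->
  {ae mu, forall p, 0 < w p -> cvgn (fun k => f k p)}.
Proof.
move=> mf mw w0 fC.
pose a k p := w p * `|f (k + N)%N p - f (k + N).+1 p|.
have ma k : measurable_fun setT (EFin \o a k).
  apply/measurable_EFinP; apply: measurable_funM => //.
  by apply: measurableT_comp => //; exact: measurable_funB.
have a0 k p : (0 <= (a k p)%:E)%E by rewrite lee_fin mulr_ge0.
have mS : measurable_fun setT (fun p => \sum_(k <oo) (a k p)%:E)%E.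
  apply: ge0_emeasurable_sum => [k p *|k _]; first exact: a0.
  exact: ma.
have Si : mu.-integrable setT (fun p => \sum_(k <oo) (a k p)%:E)%E.
  apply/integrableP; split=> //.
  under eq_integral do rewrite gee0_abs ?nneseries_ge0//.
  rewrite integral_nneseries//.
  apply: (@le_lt_trans _ _ (\sum_(k <oo) (2 ^- k)%:E)%E).
    apply: lee_nneseries => k *.
      by apply: integral_ge0 => p _; exact: a0.
    apply: le_trans (fC _ (leq_addl _ _)) _; rewrite lee_fin.
    by rewrite lef_pV2 ?posrE ?exprn_gt0// ler_weXn2l ?ler1n// leq_addr.
  apply: (@le_lt_trans _ _ 2%:E); last exact: ltry.
  apply: lime_le; first exact: is_cvg_nneseries.
  apply: nearW => n; rewrite sumEFin lee_fin.
  suff -> : \sum_(0 <= k < n) (2 ^- k : R) = 2 - 2 * 2 ^- n.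
    by rewrite gerBl mulr_ge0// invr_ge0 exprn_ge0.
  elim: n => [|n IH]; first by rewrite big_nil expr0 invr1 mulr1 subrr.
  rewrite big_nat_recr//= IH exprS invfM mulrA mulfV// mul1r; ring.
apply: aeS (integrable_ae measurableT Si) => p /(_ I) Sp wp.
have cvS : cvgn [normed series (telescope (fun k => f (k + N)%N p))].
  apply: nondecreasing_is_cvgn.
    by apply: nondecreasing_series => k _ _; exact: normr_ge0.
  exists (fine (\sum_(k <oo) (a k p)%:E)%E / w p) => _ [n _ <-] /=.
  rewrite ler_pdivlMr// -lee_fin fineK//.
  apply: le_trans (nneseries_lim_ge n _); last by move=> k _ _; exact: a0.
  rewrite sumEFin lee_fin mulr_suml; apply: ler_sum => k _.
  by rewrite /a /telescope/= mulrC distrC.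
have := normed_cvg cvS; rewrite telescopeK => /cvg_ex[l /= hl].
apply/cvg_ex; exists (l + f N p).
rewrite -(cvg_shiftn N).
have c : (fun k => f (k + N)%N p - f (0 + N)%N p + f N p) @ \oo --> l + f N p.
  by apply: cvgD => //; exact: cvg_cst.
by rewrite (_ : [sequence _]_n = (fun k => f (k + N)%N p - f (0 + N)%N p + f N p))//;
  apply/funext => k; rewrite add0n subrK.
Qed.

End ae_limits.

(** * A subsequence of the scheme that is Cauchy below every size *)

Section limit.
Context (R : realType) (D : coag_data R).
Notation cb := (cb D).
Notation bd_integrable := (bd_integrable D).
Notation bd_norm := (bd_norm D).
Notation bd_tail := (bd_tail D).
Notation far_mom := (far_mom D).
Notation dt := (dt D).
Notation bnd := (bnd D).
Notation approx := (approx D).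
Notation rate_bound := (rate_bound D).

Lemma headB_sym P (x y : R -> R) :
  head P (fun p => x p - y p) = head P (fun p => y p - x p).
Proof. by apply: eq_int => p; rewrite distrC. Qed.

(** Below [Q] the weight is bounded, beyond [Q] there are the tails. *)
Lemma bd_norm_split (x y : R -> R) Q : conc x -> conc y -> 0 <= Q ->
  bd_norm (fun p => x p - y p) <=
  cb * (1 + Q) * head Q (fun p => x p - y p) + bd_tail Q x + bd_tail Q y.
Proof.
move=> cx cy Q0.
have bx := conc_bd_integrable D cx; have by_ := conc_bd_integrable D cy.
have [mx x0 xp _] := cx; have [my y0 yp _] := cy.
have bxy := bd_integrableB bx by_.
have I1 := integZ (cb * (1 + Q)) (integ_head Q bxy).
have I2 := integ_bd_tail Q bx; have I3 := integ_bd_tail Q by_.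
have I12 := integD I1 I2; have I := integD I12 I3.
rewrite /head /bd_tail -(intZ _ (integ_head Q bxy)).
have [_ bi] := bxy.
rewrite -!intD//; apply: int_le => //.
move=> p; have b0 := bd_ge0 D p.
have [p0|p0] := leP p 0.
  by rewrite xp// yp// subrr normr0 !mulr0 !addr0.
rewrite /chi; case: (ltP p Q) => pQ.
  rewrite subrr !mul0r !addr0 mul1r ler_wpM2r// (le_trans (bd_le D p))//.
  by rewrite ler_wpM2l ?cb_ge0// /wt lerD2l gtr0_norm// ltW.
rewrite mul0r mulr0 add0r subr0 !mul1r -mulrDr ler_wpM2l//.
exact: ler_normB.
Qed.

Lemma far_momB i (x y : R -> R) : bd_integrable x -> bd_integrable y ->
  far_mom i x - far_mom i y = far_mom i (fun p => x p - y p).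
Proof.
move=> bx by_; rewrite /far_mom -intB; [|exact: far_mom_integ|exact: far_mom_integ].
by apply: eq_int => q; ring.
Qed.

Hypothesis tails : uniform_tails D.

Lemma nat_above (a b c d : R) : exists N : nat,
  [/\ a <= N%:R, b <= N%:R, c <= N%:R & d <= N%:R].
Proof.
exists (Num.truncn (`|a| + `|b| + `|c| + `|d|)).+1.
have := ltW (truncnS_gt (`|a| + `|b| + `|c| + `|d|)).
have := ler_norm a; have := ler_norm b; have := ler_norm c; have := ler_norm d.
have := normr_ge0 a; have := normr_ge0 b; have := normr_ge0 c; have := normr_ge0 d.
by move=> *; split; lra.
Qed.

Lemma dt_small e : 0 < e -> forall n : nat, e^-1 <= n%:R -> dt n <= e.
Proof.
move=> e0 n en; rewrite (le_trans (dt_lt D n))// invf_ple ?posrE//.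
by rewrite (le_trans en)// ler_nat.
Qed.

(** The Gronwall constant depends on [T] and [P] only; the threshold [h] for the far
    moments is chosen so as to absorb it. *)
Lemma approx_cauchy T P e : 0 <= T -> 1 <= P -> 0 < e ->
  exists2 h, 0 < h & exists N, forall n m, (N <= n)%N -> (N <= m)%N ->
    (forall i t, 0 <= t <= T -> `|far_mom i (approx n t) - far_mom i (approx m t)| <= h) ->
    forall t, 0 <= t <= T -> head P (fun p => approx n t p - approx m t p) <= e.
Proof.
move=> T0 P1 e0.
have M0 := bnd_ge0 D T0; have L0 := rate_bound_ge0 D M0; have E0 := diff_const_ge0 D P1 M0.
set M := bnd T in M0 L0 E0; set L := rate_bound M in L0; set E := diff_const D P M in E0.
pose X := expR (E * T).
have X0 : 0 <= X := expR_ge0 _.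
pose Cst := L + T * E * (L + 4) * X.
have Cst0 : 0 <= Cst.
  rewrite /Cst; apply: addr_ge0 => //; apply: mulr_ge0 => //.
  by apply: mulr_ge0; [exact: mulr_ge0|exact: addr_ge0].
pose h := e / (Cst + 1).
have h0 : 0 < h by rewrite divr_gt0// ltr_wpDl.
exists h => //; have [Q Q0 tQ] := tails T0 h0.
have [N [NT NP NQ Nh]] := nat_above T P Q h^-1.
exists N.
have main n m : (N <= n)%N -> (n <= m)%N ->
    (forall i t, 0 <= t <= T -> `|far_mom i (approx n t) - far_mom i (approx m t)| <= h) ->
    forall t, 0 <= t <= T -> head P (fun p => approx n t p - approx m t p) <= e.
  move=> Nn nm hm t tT.
  have Nn' : N%:R <= n%:R :> R by rewrite ler_nat.
  have nm' : n%:R <= m%:R :> R by rewrite ler_nat.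
  have Tn : T <= n%:R by exact: le_trans NT _.
  have Tm : T <= m%:R by exact: le_trans Tn _.
  have tlQ k s : (n <= k)%N -> 0 <= s <= T -> bd_tail n%:R (approx k s) <= h.
    move=> nk sT; have Tk : T <= k%:R by rewrite (le_trans Tn)// ler_nat.
    apply: le_trans (tQ k s Tk sT); apply: bd_tail_le; last by rewrite (le_trans NQ).
    by apply: conc_bd_integrable; exact: (approx_conc D sT Tk).1.
  have := @two_levels R D n m P T (h + h) h P1 (le_trans NP Nn') T0 Tn nm _ _ _ t tT.
  move=> two; apply: le_trans (two _ _ _) _.
  - by move=> s sT; rewrite lerD// hm.
  - by move=> s sT; apply: tlQ.
  - by move=> s sT; apply: tlQ.
  have dh : dt n <= h by apply: dt_small => //; exact: le_trans Nh _.
  rewrite -/M -/L -/E -/X.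
  have dL : dt n * L <= h * L by rewrite ler_wpM2r.
  apply: (@le_trans _ _ (h * Cst)); last first.
    by rewrite /h mulrAC ler_pdivrMr ?ltr_wpDl// ler_wpM2l ?lerDl// ltW.
  have TEX : 0 <= T * E * X by rewrite !mulr_ge0.
  have := ler_wpM2l TEX dL; rewrite /Cst; lra.
move=> n m Nn Nm hm t tT; have [nm|/ltnW mn] := leqP n m; first exact: main.
by rewrite headB_sym; apply: main => // i s sT; rewrite distrC; exact: hm.
Qed.

(** Rates are bounded in L^1, so in that norm the scheme is Lipschitz in time up to
    one step; the uniform tails improve this to the weighted norm. *)
Lemma approx_equi T e : 0 <= T -> 0 < e -> exists2 h, 0 < h & exists N : nat,
  T <= N%:R /\ forall n s t, (N <= n)%N -> 0 <= s -> s <= t -> t <= T -> t - s <= h ->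
    bd_norm (fun p => approx n t p - approx n s p) <= e.
Proof.
move=> T0 e0; have e4 : 0 < e / 4 by rewrite divr_gt0.
have [Q Q0 tQ] := tails T0 e4.
have M0 := bnd_ge0 D T0; have L0 := rate_bound_ge0 D M0.
pose c := cb * (1 + Q) * rate_bound (bnd T).
have c0 : 0 <= c by rewrite mulr_ge0// mulr_ge0 ?cb_ge0// addr_ge0.
pose h := e / 4 / (c + 1).
have h0 : 0 < h by rewrite divr_gt0// ltr_wpDl.
have hc : c * h <= e / 4.
  by rewrite /h mulrCA ler_piMr ?(ltW e4)// ler_pdivrMr ?ltr_wpDl// mul1r lerDl.
exists h => //; have [N [NT Nh _ _]] := nat_above T h^-1 0 0.
exists N; split=> // n s t Nn s0 st tT tsh.
have Nn' : N%:R <= n%:R :> R by rewrite ler_nat.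
have Tn : T <= n%:R by exact: le_trans NT _.
have t0 := le_trans s0 st.
have tT' : 0 <= t <= T by rewrite t0.
have sT' : 0 <= s <= T by rewrite s0 (le_trans st).
have [ct _] := approx_conc D tT' Tn; have [cs _] := approx_conc D sT' Tn.
have bt := conc_bd_integrable D ct; have bs := conc_bd_integrable D cs.
rewrite (le_trans (bd_norm_split ct cs Q0))//.
have := tQ n t Tn tT'; have := tQ n s Tn sT'.
have hd : head Q (fun p => approx n t p - approx n s p) <= (t - s + dt n) * rate_bound (bnd T).
  apply: le_trans (approx_lip D s0 st tT Tn); apply: int_le.
  - exact: integ_head (bd_integrableB bt bs).
  - exact: integ_abs (integB (conc_integ ct) (conc_integ cs)).
  - by move=> p; rewrite ler_piMl// chi_le1.
have dh : dt n <= h by apply: dt_small => //; exact: le_trans Nh _.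
have h1 : cb * (1 + Q) * head Q (fun p => approx n t p - approx n s p) <= c * (h + h).
  rewrite /c -[leRHS]mulrA; apply: ler_wpM2l.
    by rewrite mulr_ge0 ?cb_ge0 ?addr_ge0.
  by rewrite (le_trans hd)// mulrC ler_wpM2l// lerD.
lra.
Qed.

Lemma far_mom_extract : exists v : bool -> R -> R, forall T e (N : nat), 0 <= T -> 0 < e ->
  exists2 n, (N <= n)%N & forall i t, 0 <= t <= T -> `|far_mom i (approx n t) - v i t| <= e.
Proof.
apply: (extraction (u := fun i n t => far_mom i (approx n t))) => [T T0|T e T0 e0].
  have [N [NT _ _ _]] := nat_above T 0 0 0.
  exists (cb * bnd T), N => i n t Nn tT.
  have Tn : T <= n%:R by rewrite (le_trans NT)// ler_nat.
  have [cz mz] := approx_conc D tT Tn.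
  rewrite (le_trans (far_mom_le i (conc_bd_integrable D cz)))// (le_trans (bd_norm_mom D cz))//.
  by rewrite ler_wpM2l// cb_ge0.
have [h h0 [N [NT hN]]] := approx_equi T0 e0.
exists h => //; exists N => i n s t Nn s0 st tT tsh.
have Tn : T <= n%:R by rewrite (le_trans NT)// ler_nat.
have t0 := le_trans s0 st.
have tT' : 0 <= t <= T by rewrite t0.
have sT' : 0 <= s <= T by rewrite s0 (le_trans st).
have [ct _] := approx_conc D tT' Tn; have [cs _] := approx_conc D sT' Tn.
have bt := conc_bd_integrable D ct; have bs := conc_bd_integrable D cs.
by rewrite far_momB// (le_trans (far_mom_le _ (bd_integrableB bt bs)))// hN.
Qed.

(** At stage [k] the far moments are made to follow their limit up to time k + 1 with
    the accuracy demanded by all stages up to [k], so consecutive members can be compared. *)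
Lemma cauchy_subsequence : exists2 phi : nat -> nat, (forall k, (k <= phi k)%N) &
  forall k t, 0 <= t <= k.+1%:R ->
    head k.+1%:R (fun p => approx (phi k) t p - approx (phi k.+1) t p) <= 2 ^- k.
Proof.
have [v vP] := far_mom_extract.
have C k : exists hN : R * nat, 0 < hN.1 /\ forall n m, (hN.2 <= n)%N -> (hN.2 <= m)%N ->
    (forall i t, 0 <= t <= k.+1%:R -> `|far_mom i (approx n t) - far_mom i (approx m t)| <= hN.1) ->
    forall t, 0 <= t <= k.+1%:R ->
      head k.+1%:R (fun p => approx n t p - approx m t p) <= 2 ^- k.
  have [||h h0 [N hN]] := @approx_cauchy k.+1%:R k.+1%:R (2 ^- k) (ler0n _ _).
  - by rewrite ler1n.
  - by rewrite invr_gt0 exprn_gt0.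
  by exists (h, N).
pose hN k := projT1 (cid (C k)).
have hNP k := projT2 (cid (C k)).
(* The finest accuracy and the largest rank demanded up to stage k. *)
have U k : exists eM : R * nat, 0 < eM.1 /\ forall j, (j <= k)%N ->
    eM.1 <= (hN j).1 / 2 /\ ((hN j).2 <= eM.2)%N.
  elim: k => [|k [[e M] /= [e0 eM]]].
    exists ((hN 0).1 / 2, (hN 0).2); split=> /=.
      by rewrite divr_gt0//; case: (hNP 0).
    by move=> j; rewrite leqn0 => /eqP ->.
  exists (Num.min e ((hN k.+1).1 / 2), maxn M (hN k.+1).2); split=> /=.
    by rewrite lt_min e0/= divr_gt0//; case: (hNP k.+1).
  move=> j; rewrite leq_eqVlt => /predU1P[->|]; first by rewrite ge_min lexx orbT leq_maxr.
  rewrite ltnS => /eM[h1 h2]; split; first by rewrite ge_min h1.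
  by rewrite (leq_trans h2)// leq_maxl.
have Phi k : exists n, [/\ (k <= n)%N, forall j, (j <= k)%N -> ((hN j).2 <= n)%N &
    forall j i t, (j <= k)%N -> 0 <= t <= k.+1%:R ->
      `|far_mom i (approx n t) - v i t| <= (hN j).1 / 2].
  have [[e M] /= [e0 eM]] := U k.
  have [n Mn nv] := vP k.+1%:R e (maxn M k) (ler0n _ _) e0.
  exists n; split.
  - by rewrite (leq_trans _ Mn)// leq_maxr.
  - by move=> j jk; rewrite (leq_trans (eM j jk).2)// (leq_trans _ Mn)// leq_maxl.
  - by move=> j i t jk tk; rewrite (le_trans (nv i t tk))// (eM j jk).1.
exists (fun k => projT1 (cid (Phi k))).
  by move=> k; case: (projT2 (cid (Phi k))).
move=> k t tk /=; have [_ n2 n3] := projT2 (cid (Phi k)).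
have [_ m2 m3] := projT2 (cid (Phi k.+1)).
have [_] := hNP k; rewrite -/(hN k); apply => //; [exact: n2|exact: m2|].
move=> i s sk; have sk' : 0 <= s <= k.+2%:R.
  by case/andP: sk => -> /le_trans ->//; rewrite ler_nat.
have := n3 k i s (leqnn _) sk; have := m3 k i s (leqnSn _) sk'.
set a := far_mom i _; set b := far_mom i _ => h1 h2.
rewrite (_ : b - a = (b - v i s) - (a - v i s)); last ring.
by rewrite (le_trans (ler_normB _ _))// [leRHS](splitr) lerD.
Qed.

End limit.

(** * The limit of the subsequence *)

Section limit_solution.
Context (R : realType) (D : coag_data R).
Notation bd := (bd D).
Notation cb := (cb D).
Notation bd_integrable := (bd_integrable D).
Notation bd_norm := (bd_norm D).
Notation bd_tail := (bd_tail D).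
Notation dt := (dt D).
Notation euler := (euler D).
Notation bnd := (bnd D).
Notation approx := (approx D).
Notation idx := (idx D).

Hypothesis tails : uniform_tails D.

Variable phi : nat -> nat.
Hypothesis phi_ge : forall k, (k <= phi k)%N.
Hypothesis phi_cauchy : forall k t, 0 <= t <= k.+1%:R ->
  head k.+1%:R (fun p => approx (phi k) t p - approx (phi k.+1) t p) <= 2 ^- k.

(** The approximation, written as a sum over the cells of its time grid, which makes
    its joint measurability in time and size visible. *)
Definition approx_cells (k : nat) (t p : R) : R :=
  \sum_(j < (idx (phi k) k%:R).+1)
    ((1 - chi (j%:R * dt (phi k)) t) * chi (j.+1%:R * dt (phi k)) t) *
    euler (phi k) j p.

(** An upper limit is defined everywhere and jointly measurable; almost everywhere it
    is a limit. *)
Definition zeta (t p : R) : R := fine (limn_esup (fun k => (approx_cells k t p)%:E)).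

Let cell_conc k (j : 'I_(idx (phi k) k%:R).+1) : conc (euler (phi k) j).
Proof.
have kp : k%:R <= (phi k)%:R :> R by rewrite ler_nat.
have /andP[h _] := idx_itv D (phi k) (ler0n R k).
have jk : j%:R * dt (phi k) <= k%:R.
  by rewrite (le_trans _ h)// ler_wpM2r ?dt_ge0// ler_nat -ltnS.
by case: (euler_conc_bnd kp jk).
Qed.

Lemma approx_cells_approx k t p : 0 <= t <= k%:R -> approx_cells k t p = approx (phi k) t p.
Proof.
move=> /andP[t0 tk]; set n := phi k.
have jk : (idx n t < (idx n k%:R).+1)%N.
  by rewrite ltnS le_truncn// ler_pM2r ?invr_gt0 ?dt_gt0.
have /andP[h1 h2] := idx_itv D n t0.
rewrite /approx_cells (bigD1 (Ordinal jk))//= big1 ?addr0 => [|j jn].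
  by rewrite /chi h2 (ltNge t) h1/= subr0 !mul1r.
rewrite /chi; case: (ltP t _) => jt; first by rewrite subrr !mul0r.
case: (ltP t _) => tj; last by rewrite mulr0 mul0r.
case/eqP: jn; apply/val_inj => /=; apply/eqP.
by rewrite /idx eq_sym truncn_eq ?divr_ge0 ?dt_ge0// ler_pdivlMr ?dt_gt0// jt
  ltr_pdivrMr ?dt_gt0.
Qed.

Lemma approx_cells_m k : measurable_fun setT (fun z : R * R => approx_cells k z.1 z.2).
Proof.
rewrite /approx_cells; apply: measurable_sum => j.
apply: measurable_funM; last first.
  by apply: measurable_snd; case: (cell_conc j).
apply: (measurable_fst (f := fun t => (1 - chi _ t) * chi _ t)).
by apply: measurable_funM; [exact: measurable_chi_compl|exact: measurable_chi].
Qed.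

Lemma approx_cells_ge0 k t p : 0 <= approx_cells k t p.
Proof.
apply: sumr_ge0 => j _; have [_ z0 _ _] := cell_conc j.
by rewrite mulr_ge0// mulr_ge0 ?chi_compl_ge0 ?chi_ge0.
Qed.

Lemma approx_cells_pos k t p : p <= 0 -> approx_cells k t p = 0.
Proof.
move=> p0; apply: big1 => j _; have [_ _ zp _] := cell_conc j.
by rewrite zp// mulr0.
Qed.

Lemma approx_cells_sec k t : measurable_fun setT (approx_cells k t).
Proof. exact: (measurable_pair (approx_cells_m k) (measurable_cst t) (@measurable_id _ _ _)). Qed.

Lemma zeta_m : measurable_fun setT (fun z : R * R => zeta z.1 z.2).
Proof.
apply: measurableT_comp => //; apply: measurable_fun_limn_esup => k.
by apply/measurable_EFinP; exact: (approx_cells_m k).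
Qed.

Lemma zeta_sec t : measurable_fun setT (zeta t).
Proof. exact: (measurable_pair zeta_m (measurable_cst t) (@measurable_id _ _ _)). Qed.

Lemma zeta_lim t p (l : R) : approx_cells k t p @[k --> \oo] --> l -> zeta t p = l.
Proof.
move=> cl; have c : (approx_cells k t p)%:E @[k --> \oo] --> l%:E.
  by apply: cvg_EFin => //; exact: nearW.
rewrite /zeta is_cvg_limn_esupE; last by apply/cvg_ex; exists l%:E.
by rewrite (cvg_lim (@ereal_hausdorff R) c).
Qed.

Lemma zeta_pos t p : p <= 0 -> zeta t p = 0.
Proof.
move=> p0; apply: zeta_lim.
by under eq_fun do rewrite approx_cells_pos//; exact: cvg_cst.
Qed.

Lemma zeta0 p : zeta 0 p = zin D p.
Proof.
apply: zeta_lim; rewrite (_ : (fun k => approx_cells k 0 p) = fun=> zin D p); first exact: cvg_cst.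
by apply/funext => k; rewrite approx_cells_approx ?lexx ?ler0n// /approx /idx mul0r truncn0.
Qed.

Lemma zeta_ge0 t p : 0 <= zeta t p.
Proof.
apply: fine_ge0; rewrite limn_esup_lim; apply: lime_ge; first exact: is_cvg_esups.
apply: nearW => k; apply: (@le_trans _ _ (approx_cells k t p)%:E); first by rewrite lee_fin approx_cells_ge0.
by apply: ereal_sup_ubound; exists k => /=.
Qed.

Let approx_cells_conc k t T : 0 <= t <= T -> T <= k%:R -> conc (approx_cells k t) /\ mom (approx_cells k t) <= bnd T.
Proof.
move=> tT Tk; have Tp : T <= (phi k)%:R by rewrite (le_trans Tk)// ler_nat.
have -> : approx_cells k t = approx (phi k) t.
  apply/funext => p; apply: approx_cells_approx; case/andP: tT => -> tT.
  by rewrite (le_trans tT).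
exact: approx_conc.
Qed.

Lemma headP_le P Q (x : R -> R) : bd_integrable x -> P <= Q -> head P x <= head Q x.
Proof.
move=> bx PQ; apply: int_le; [exact: (integ_head P bx)|exact: (integ_head Q bx)|] => p.
rewrite ler_wpM2r// /chi; case: (ltP p P) => pP; rewrite ?ler0n//.
by rewrite (lt_le_trans pP PQ).
Qed.

Lemma zeta_ae t : 0 <= t -> {ae mu, forall p, approx_cells k t p @[k --> \oo] --> zeta t p}.
Proof.
move=> t0; have [N [tN _ _ _]] := nat_above t 0 0 0.
have step (P : nat) : {ae mu, forall p, 0 < chi P%:R p -> cvgn (fun k => approx_cells k t p)}.
  apply: (@ae_cvg_series _ (fun k => approx_cells k t) (maxn N P)).
  - by move=> k; exact: approx_cells_sec.
  - exact: measurable_chi.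
  - by move=> p; exact: chi_ge0.
  move=> k; rewrite geq_max => /andP[Nk Pk].
  have tk : t <= k%:R by rewrite (le_trans tN)// ler_nat.
  have tk1 : t <= k.+1%:R by rewrite (le_trans tk)// ler_nat.
  have [c1 _] := @approx_cells_conc k t t (introT andP (conj t0 (lexx t))) tk.
  have [c2 _] := @approx_cells_conc k.+1 t t (introT andP (conj t0 (lexx t))) tk1.
  have b12 := bd_integrableB (conc_bd_integrable D c1) (conc_bd_integrable D c2).
  rewrite -EFin_int; last exact: (integ_head P%:R b12).
  rewrite lee_fin; apply: le_trans (@headP_le P%:R k.+1%:R _ b12 _) _.
    by rewrite ler_nat (leq_trans Pk).
  have := @phi_cauchy k t; rewrite t0 tk1 => /(_ isT); apply: le_trans.
  rewrite le_eqVlt; apply/orP; left; apply/eqP; apply: eq_int => p.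
  by rewrite !approx_cells_approx// t0.
apply: aeS (ae_forall step) => p hp.
have [P [pP _ _ _]] := nat_above (p + 1) 0 0 0.
have /cvg_ex[l hl] : cvgn (fun k => approx_cells k t p).
  by apply: (hp P); rewrite /chi (lt_le_trans _ pP) ?ltrDl.
by rewrite (zeta_lim hl).
Qed.

Lemma zeta_conc t T : 0 <= t <= T -> conc (zeta t) /\ mom (zeta t) <= bnd T.
Proof.
move=> tT; have /andP[t0 _] := tT; have [N [TN _ _ _]] := nat_above T 0 0 0.
have [] := @fatou_le _ (fun k p => wt p * approx_cells k t p) (fun p => wt p * zeta t p) (bnd T) N.
- by move=> k; apply: measurable_funM; [exact: measurable_wt|exact: approx_cells_sec].
- by move=> k p; rewrite mulr_ge0 ?wt_ge0 ?approx_cells_ge0.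
- by apply: measurable_funM; [exact: measurable_wt|exact: zeta_sec].
- by move=> p; rewrite mulr_ge0 ?wt_ge0 ?zeta_ge0.
- by apply: aeS (zeta_ae t0) => p; exact: cvgMr.
- move=> k Nk; have Tk : T <= k%:R by rewrite (le_trans TN)// ler_nat.
  have [c m] := approx_cells_conc tT Tk.
  by case: (c) => _ _ _ zi; rewrite -EFin_int// lee_fin.
move=> zi zb; split=> //; split; last exact: zi.
- exact: zeta_sec.
- by move=> p; exact: zeta_ge0.
- by move=> p; exact: zeta_pos.
Qed.

Lemma zeta_bd_tail t T Q e (N : nat) : 0 <= t <= T ->
  (forall k, (N <= k)%N -> bd_tail Q (approx (phi k) t) <= e) -> bd_tail Q (zeta t) <= e.
Proof.
move=> tT tle; have /andP[t0 _] := tT; have [N1 [TN _ _ _]] := nat_above T 0 0 0.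
have [] := @fatou_le _ (fun k p => (1 - chi Q p) * (bd p * `|approx_cells k t p|))
  (fun p => (1 - chi Q p) * (bd p * `|zeta t p|)) e (maxn N N1) => //.
- move=> k; apply: measurable_funM; first exact: measurable_chi_compl.
  by apply: measurable_funM; [exact: bd_m|apply: abs_m; exact: approx_cells_sec].
- by move=> k p; rewrite mulr_ge0 ?chi_compl_ge0// mulr_ge0 ?bd_ge0.
- apply: measurable_funM; first exact: measurable_chi_compl.
  by apply: measurable_funM; [exact: bd_m|apply: abs_m; exact: zeta_sec].
- by move=> p; rewrite mulr_ge0 ?chi_compl_ge0// mulr_ge0 ?bd_ge0.
- apply: aeS (zeta_ae t0) => p h.
  by apply: cvgMr; apply: cvgMr; exact: cvg_norm.
move=> k; rewrite geq_max => /andP[Nk N1k].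
have Tk : T <= k%:R by rewrite (le_trans TN)// ler_nat.
have [c m] := approx_cells_conc tT Tk.
rewrite -EFin_int; last exact: (integ_bd_tail Q (conc_bd_integrable D c)).
rewrite lee_fin; apply: le_trans (tle k Nk).
rewrite le_eqVlt; apply/orP; left; apply/eqP; apply: eq_int => p.
by rewrite approx_cells_approx//; case/andP: tT => -> /le_trans ->.
Qed.

Lemma zeta_head k t : 0 <= t <= k%:R ->
  head k.+1%:R (fun p => approx (phi k) t p - zeta t p) <= 2 * 2 ^- k.
Proof.
move=> tk; have /andP[t0 tk'] := tk.
have ck j : (k <= j)%N -> conc (approx_cells j t).
  by move=> kj; apply: (approx_cells_conc tk _).1; rewrite ler_nat.
have bk j : (k <= j)%N -> bd_integrable (fun p => approx_cells k t p - approx_cells j t p).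
  by move=> kj; apply: bd_integrableB; apply: conc_bd_integrable; apply: ck.
have [] := @fatou_le _ (fun j p => chi k.+1%:R p * `|approx_cells k t p - approx_cells j t p|)
  (fun p => chi k.+1%:R p * `|approx_cells k t p - zeta t p|) (2 * 2 ^- k) k.
- move=> j; apply: measurable_funM; first exact: measurable_chi.
  by apply: abs_m; apply: measurable_funB; exact: approx_cells_sec.
- by move=> j p; rewrite mulr_ge0 ?chi_ge0.
- apply: measurable_funM; first exact: measurable_chi.
  by apply: abs_m; apply: measurable_funB; [exact: approx_cells_sec|exact: zeta_sec].
- by move=> p; rewrite mulr_ge0 ?chi_ge0.
- apply: aeS (zeta_ae t0) => p h.
  by apply: cvgMr; apply: cvg_norm; apply: cvgB => //; exact: cvg_cst.
- move=> j kj; rewrite -EFin_int; last exact: (integ_head k.+1%:R (bk j kj)).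
  rewrite lee_fin -/(head k.+1%:R (fun p => approx_cells k t p - approx_cells j t p)).
  suff h i : head k.+1%:R (fun p => approx_cells k t p - approx_cells (k + i)%N t p) <=
      2 * 2 ^- k - 2 * 2 ^- (k + i).
    by rewrite -(subnKC kj) (le_trans (h _))// gerBl mulr_ge0// invr_ge0 exprn_ge0.
  elim: i => [|i IH].
    rewrite addn0 subrr /head; under eq_Rintegral do rewrite subrr normr0 mulr0.
    by rewrite int0.
  have b1 := bk _ (leq_addr i k); have b2 := bk _ (leq_addr i.+1 k).
  have ki : (k <= k + i)%N by rewrite leq_addr.
  have b3 : bd_integrable (fun p => approx_cells (k + i)%N t p - approx_cells (k + i.+1)%N t p).
    by apply: bd_integrableB; apply: conc_bd_integrable; apply: ck; rewrite leq_addr.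
  have c : head k.+1%:R (fun p => approx_cells (k + i)%N t p - approx_cells (k + i.+1)%N t p) <= 2 ^- (k + i).
    apply: le_trans (@headP_le k.+1%:R (k + i).+1%:R _ b3 _) _.
      by rewrite ler_nat ltnS.
    have tki : t <= (k + i)%:R by rewrite (le_trans tk')// ler_nat.
    have tki1 : t <= (k + i).+1%:R by rewrite (le_trans tki)// ler_nat.
    have := @phi_cauchy (k + i)%N t; rewrite t0 tki1 => /(_ isT); apply: le_trans.
    rewrite le_eqVlt; apply/orP; left; apply/eqP; apply: eq_int => p.
    by rewrite addnS !approx_cells_approx ?t0.
  have E : 2 * 2 ^- (k + i) = 2 ^- (k + i) + 2 * 2 ^- (k + i.+1) :> R.
    by rewrite addnS exprS invfM mulrA mulfV// mul1r mulr2n mulrDl mul1r.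
  have tri : head k.+1%:R (fun p => approx_cells k t p - approx_cells (k + i.+1)%N t p) <=
      head k.+1%:R (fun p => approx_cells k t p - approx_cells (k + i)%N t p) +
      head k.+1%:R (fun p => approx_cells (k + i)%N t p - approx_cells (k + i.+1)%N t p).
    have ci l : (k <= l)%N -> integ (approx_cells l t) by move=> kl; exact/conc_integ/ck.
    have kS : (k <= k + i.+1)%N by rewrite leq_addr.
    exact: (head_tri _ (integB (ci k (leqnn k)) (ci _ ki)) (integB (ci _ ki) (ci _ kS))).
  move: tri c IH E; lra.
move=> _; apply: le_trans; rewrite le_eqVlt; apply/orP; left; apply/eqP.
by apply: eq_int => p; rewrite approx_cells_approx.
Qed.

(** Below [Q] the Cauchy estimates are summed, beyond [Q] tails are uniformly small. *)
Lemma zeta_conv T e : 0 <= T -> 0 < e -> exists K : nat, T <= K%:R /\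
  forall k t, (K <= k)%N -> 0 <= t <= T -> bd_norm (fun p => approx (phi k) t p - zeta t p) <= e.
Proof.
move=> T0 e0; have e3 : 0 < e / 3 by rewrite divr_gt0.
have [Q Q0 tQ] := tails T0 e3.
pose c := cb * (1 + Q) * 2.
have c0 : 0 <= c by rewrite mulr_ge0// mulr_ge0 ?cb_ge0// addr_ge0.
have [K [KT KQ Kc _]] := nat_above T Q (c / (e / 3)) 0.
exists K; split=> // k t Kk tT.
have Kk' : K%:R <= k%:R :> R by rewrite ler_nat.
have Tk : T <= k%:R := le_trans KT Kk'.
have Tp : T <= (phi k)%:R by rewrite (le_trans Tk)// ler_nat.
have tk : 0 <= t <= k%:R by case/andP: tT => -> /le_trans ->.
have [cz _] := approx_conc D tT Tp; have [c' _] := zeta_conc tT.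
have bb := bd_integrableB (conc_bd_integrable D cz) (conc_bd_integrable D c').
rewrite (le_trans (bd_norm_split D cz c' Q0))//.
have t1 := tQ (phi k) t Tp tT.
have t2 : bd_tail Q (zeta t) <= e / 3.
  apply: (@zeta_bd_tail t T Q _ K) => // j Kj; apply: tQ => //.
  by rewrite (le_trans KT)// ler_nat (leq_trans Kj).
have t3 : cb * (1 + Q) * head Q (fun p => approx (phi k) t p - zeta t p) <= e / 3.
  apply: (@le_trans _ _ (c * 2 ^- k)).
    rewrite /c -[leRHS]mulrA; apply: ler_wpM2l.
      by rewrite mulr_ge0 ?cb_ge0// addr_ge0.
    apply: le_trans (zeta_head tk); apply: headP_le => //.
    by rewrite (le_trans KQ)// ler_nat (leq_trans Kk).
  rewrite ler_pdivrMr ?exprn_gt0// mulrC -ler_pdivrMr//.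
  rewrite (le_trans Kc)// (le_trans Kk')// -natrX ler_nat.
  exact/ltnW/ltn_expl.
have -> : e = e / 3 + e / 3 + e / 3 by field.
exact: lerD (lerD t3 t1) t2.
Qed.

Lemma bd_norm_tri (x y z : R -> R) : conc x -> conc y -> conc z ->
  bd_norm (fun p => x p - z p) <= bd_norm (fun p => x p - y p) + bd_norm (fun p => y p - z p).
Proof.
move=> cx cy cz.
have [_ i1] := bd_integrableB (conc_bd_integrable D cx) (conc_bd_integrable D cy).
have [_ i2] := bd_integrableB (conc_bd_integrable D cy) (conc_bd_integrable D cz).
have [_ i3] := bd_integrableB (conc_bd_integrable D cx) (conc_bd_integrable D cz).
rewrite /bd_norm -intD//; apply: int_le => //; first exact: integD.
move=> p; rewrite -mulrDr ler_wpM2l ?bd_ge0//.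
rewrite (_ : x p - z p = (x p - y p) + (y p - z p)); first exact: ler_normD.
by ring.
Qed.

Lemma bd_norm_sym (x y : R -> R) : bd_norm (fun p => x p - y p) = bd_norm (fun p => y p - x p).
Proof. by apply: eq_int => p; rewrite distrC. Qed.

Lemma zeta_cont T e : 0 <= T -> 0 < e -> exists2 h, 0 < h &
  forall s t, 0 <= s -> s <= t -> t <= T -> t - s <= h ->
    bd_norm (fun p => zeta t p - zeta s p) <= e.
Proof.
move=> T0 e0; have e3 : 0 < e / 3 by rewrite divr_gt0.
have [h h0 [N [NT hN]]] := approx_equi tails T0 e3.
have [K [KT hK]] := zeta_conv T0 e3.
exists h => // s t s0 st tT tsh.
have t0 := le_trans s0 st.
have tT' : 0 <= t <= T by rewrite t0.
have sT' : 0 <= s <= T by rewrite s0 (le_trans st).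
pose k := maxn N K.
have kn : (N <= phi k)%N by rewrite (leq_trans _ (phi_ge k))// leq_maxl.
have Kk : (K <= k)%N by rewrite leq_maxr.
have Tp : T <= (phi k)%:R by rewrite (le_trans NT)// ler_nat.
have [ct _] := zeta_conc tT'; have [cs _] := zeta_conc sT'.
have [czt _] := approx_conc D tT' Tp; have [czs _] := approx_conc D sT' Tp.
have b1 := hK k t Kk tT'; rewrite bd_norm_sym in b1.
have b2 := hN (phi k) s t kn s0 st tT tsh.
have b3 := hK k s Kk sT'.
have -> : e = e / 3 + (e / 3 + e / 3) by field.
apply: le_trans (bd_norm_tri ct czt cs) (lerD b1 _).
exact: le_trans (bd_norm_tri czt czs cs) (lerD b2 b3).
Qed.

End limit_solution.

(** * A fundamental theorem of calculus *)

Section ftc_unif.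
Context (R : realType).

Definition unif_cont (f : R -> R) : Prop := forall T e : R, 0 <= T -> 0 < e ->
  exists2 h, 0 < h & forall s t : R, 0 <= s -> s <= t -> t <= T -> t - s <= h ->
    `|f t - f s| <= e.

Lemma unif_cont_within (f : R -> R) (A : set R) : unif_cont f ->
  (forall t, A t -> 0 <= t) -> {within A, continuous f}.
Proof.
move=> uf A0; pose g t := f (Num.max 0 t).
apply: (@subspace_eq_continuous _ _ _ g).
  by move=> t; rewrite inE => /A0 t0; rewrite /g max_r.
apply: continuous_subspaceT => t; apply/cvgrPdist_le => e e0.
have T0 : 0 <= `|t| + 1 by rewrite addr_ge0.
have [h h0 hf] := uf _ _ T0 e0.
have h1 : 0 < Num.min h 1 by rewrite lt_min h0 ltr01.
near=> s.
have : `|t - s| <= Num.min h 1 by near: s; exact: cvgr_dist_le.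
rewrite le_min => /andP[sh s1].
have aux a b : `|a - b| <= h -> a <= b -> b <= `|t| + 1 -> `|g b - g a| <= e.
  move=> abh ab bt; rewrite /g; apply: hf.
  - by rewrite le_max lexx.
  - by rewrite ge_max !le_max lexx/= ab orbT.
  - by rewrite ge_max T0.
  - rewrite distrC ger0_norm ?subr_ge0// in abh.
    by case: (leP 0 b); case: (leP 0 a) => ? ?; lra.
have tt : t <= `|t| + 1 by rewrite (le_trans (ler_norm t))// lerDl.
have st : s <= `|t| + 1.
  have := ler_norm (- (t - s)); rewrite normrN => ?; have := ler_norm t; lra.
have [ts|/ltW ts] := leP s t.
  by apply: aux => //; rewrite distrC.
by rewrite distrC; apply: aux.
Unshelve. all: by end_near. Qed.

Lemma unif_cont_integrable (f : R -> R) T : unif_cont f ->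
  mu.-integrable `[0, T] (EFin \o f).
Proof.
move=> uf; apply: continuous_compact_integrable; first exact: segment_compact.
by apply: unif_cont_within => // t /=; rewrite in_itv/= => /andP[].
Qed.

(** A one-sided difference quotient that converges uniformly to a continuous function
    is two-sided: the left quotient at [x] is the right quotient at a nearby point. *)
Lemma ftc_unif (F G : R -> R) : unif_cont G ->
  (forall T e : R, 0 <= T -> 0 < e -> exists2 h, 0 < h & forall s t : R, 0 <= s -> s <= t ->
    t <= T -> t - s <= h -> `|F t - F s - (t - s) * G s| <= (t - s) * e) ->
  unif_cont F ->
  forall T : R, 0 <= T -> (\int[mu]_(s in `[0%R, T]) (G s)%:E = (F T)%:E - (F 0%R)%:E)%E.
Proof.
move=> uG dF uF T; rewrite le_eqVlt => /predU1P[<-|T0].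
  by rewrite set_itv1 integral_set1 subee.
have A0 t : `[0, T]%classic t -> 0 <= t by rewrite /= in_itv/= => /andP[].
have dlim (x : R) : x \in `]0, T[ ->
    (fun h => h^-1 *: (F (h + x) - F x)) @ 0^' --> G x.
  rewrite in_itv/= => /andP[x0 xT]; apply/cvgrPdist_le => e e0.
  have e2 : 0 < e / 2 by rewrite divr_gt0.
  have [h1 h10 H1] := dF T (e / 2) (ltW T0) e2.
  have [h2 h20 H2] := uG T (e / 2) (ltW T0) e2.
  have m0 : 0 < Num.min (Num.min h1 h2) (Num.min x (T - x)).
    by rewrite !lt_min h10 h20 x0 subr_gt0.
  near=> h.
  have h0 : h != 0 by near: h; exact: nbhs_dnbhs_neq.
  have : `|h| <= Num.min (Num.min h1 h2) (Num.min x (T - x)).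
    by near: h; exact: dnbhs0_le.
  rewrite !le_min => /andP[/andP[hh1 hh2] /andP[hx hT]].
  suff : `|h * G x - (F (h + x) - F x)| <= `|h| * e.
    rewrite -{1}(mulVKf h0 (F (h + x) - F x)) -mulrBr normrM ler_pM2l ?normr_gt0//.
  have [hp|hn] := leP 0 h.
    rewrite (ger0_norm hp) in hh1 hh2 hx hT *.
    have := H1 x (h + x) (ltW x0); rewrite lerDr hp -lerBrDr => /(_ isT hT).
    rewrite (_ : h + x - x = h); last ring.
    by move=> /(_ hh1); rewrite distrC => /le_trans; apply; rewrite ler_wpM2l//; lra.
  rewrite (ltr0_norm hn) in hh1 hh2 hx hT *.
  have hx0 : 0 <= h + x by lra.
  have hxx : h + x <= x by lra.
  have := H1 (h + x) x hx0 hxx (ltW xT); rewrite (_ : x - (h + x) = - h); last ring.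
  move=> /(_ hh1) a1.
  have := H2 (h + x) x hx0 hxx (ltW xT); rewrite (_ : x - (h + x) = - h); last ring.
  move=> /(_ hh2) a2.
  rewrite (_ : h * G x - (F (h + x) - F x) = (F x - F (h + x) - (- h) * G (h + x)) -
     (- h) * (G x - G (h + x))); last ring.
  rewrite (le_trans (ler_normB _ _))// normrM.
  have hn' : 0 <= - h by lra.
  rewrite (ger0_norm hn') (_ : - h * e = - h * (e / 2) + - h * (e / 2)); last by field.
  by rewrite lerD// ler_wpM2l.
apply: continuous_FTC2 => //.
- exact: unif_cont_within.
- have [c0 c1 c2] := (continuous_within_itvP F T0).1 (unif_cont_within uF A0).
  split=> // x xT; have := dlim x xT => c.
  apply/cvg_ex; exists (G x); move: c; rewrite (_ : (fun h => _ *: _) =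
    (fun h => h^-1 *: ((F \o shift x) (h *: 1) - F x)))//.
  by apply/funext => h /=; rewrite [h *: 1]mulr1.
- by move=> x xT; rewrite /derive1; apply/cvg_lim => //; exact: dlim.
Unshelve. all: by end_near. Qed.

End ftc_unif.

(** * Passage to the limit in the weak form *)

Section grid.
Context (R : realType).
Implicit Types (a b d e h s t x : R).

Lemma grid_dist a b d h s t x : a <= x -> x <= b -> b <= t -> s < a + d ->
  d <= h -> t - s <= h -> `|x - s| <= h.
Proof. by move=> *; rewrite ler_norml; apply/andP; split; lra. Qed.

Lemma grid_length a b d e s t : a <= s -> s < a + d -> b <= t -> t < b + d ->
  d <= e -> `|b - a - (t - s)| <= e.
Proof. by move=> *; rewrite ler_norml; apply/andP; split; lra. Qed.

Lemma increment_split (a b c d s x : R) : a = b + s ->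
  c - d - x = s - x - (a - c) + (b - d).
Proof. by move=> ->; ring. Qed.

End grid.

Section weak_form.
Context (R : realType) (D : coag_data R).
Notation cb := (cb D).
Notation bd_integrable := (bd_integrable D).
Notation bd_norm := (bd_norm D).
Notation bd_tail := (bd_tail D).
Notation dt := (dt D).
Notation euler := (euler D).
Notation bnd := (bnd D).
Notation approx := (approx D).
Notation idx := (idx D).
Notation ker := (ker D).
Notation kern := (kern D).

Hypothesis tails : uniform_tails D.

Variable phi : nat -> nat.
Hypothesis phi_ge : forall k, (k <= phi k)%N.
Hypothesis phi_cauchy : forall k t, 0 <= t <= k.+1%:R ->
  head k.+1%:R (fun p => approx (phi k) t p - approx (phi k.+1) t p) <= 2 ^- k.

Notation zeta := (zeta D phi).

Variables (w : R -> R) (W : R).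
Hypothesis w_m : measurable_fun setT w.
Hypothesis w_le : forall p, `|w p| <= W.

Let W0 : 0 <= W. Proof. exact: le_trans (w_le 0). Qed.

Definition coll_term (x : R -> R) : R := pair_int ker (coll_incr w) x.
Definition src_term (x : R -> R) : R := \int[mu]_p (w p * (src D p - rem D p * x p)).
Definition test (x : R -> R) : R := \int[mu]_p (w p * x p).
Definition rhs (x : R -> R) : R := 2^-1 * coll_term x + src_term x.
Definition rhsn (n : nat) (x : R -> R) : R :=
  2^-1 * pair_int (kern n) (coll_incr w) x +
  \int[mu]_p (w p * (src D p - remn D n p * x p)).

Lemma coll_incr_m : measurable_fun setT (coll_incr w).
Proof.
apply: measurable_funB; [apply: measurable_funB|].
- exact: measurable_sum2.
- exact: measurable_fst.
- exact: measurable_snd.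
Qed.

Lemma coll_incr_le x : `|coll_incr w x| <= 3 * W.
Proof.
rewrite /coll_incr (le_trans (ler_normB _ _))//.
have := ler_normB (w (x.1 + x.2)) (w x.1).
have := w_le (x.1 + x.2); have := w_le x.1; have := w_le x.2; lra.
Qed.

Lemma test_integ x : bd_integrable x -> integ (fun p => w p * x p).
Proof.
move=> [mx xi]; apply: integ_le (integZ W xi) => [|p].
  exact: measurable_funM.
rewrite normrM ler_pM// ler_peMl// bd_ge1//.
Qed.

Lemma test_le (x : R -> R) : bd_integrable x -> `|test x| <= W * bd_norm x.
Proof.
move=> [mx xi]; rewrite -intZ//; apply: int_abs_le => //.
- exact: integZ.
- exact: measurable_funM.
- by move=> p; rewrite normrM ler_pM// ler_peMl// bd_ge1.
Qed.

Lemma test_diff x y : bd_integrable x -> bd_integrable y ->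
  `|test x - test y| <= W * bd_norm (fun p => x p - y p).
Proof.
move=> bx by_; rewrite -intB; [|exact: test_integ|exact: test_integ].
apply: le_trans (test_le (bd_integrableB bx by_)).
by rewrite le_eqVlt; apply/orP; left; apply/eqP; congr `|_|;
  apply: eq_int => p; ring.
Qed.

Lemma coll_term_diff x y : bd_integrable x -> bd_integrable y ->
  `|coll_term x - coll_term y| <=
  3 * W * ((bd_norm x + bd_norm y) * bd_norm (fun p => x p - y p)).
Proof.
move=> bx by_.
exact: (pair_int_diff (ker_m D) (ker_ge0 D) (fun _ _ => lexx _) coll_incr_m coll_incr_le bx by_).
Qed.

Lemma rem_integ (rr : R -> R) x : measurable_fun setT rr ->
  (forall p, 0 <= rr p) -> (forall p, rr p <= rem D p) -> bd_integrable x ->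
  integ (fun p => w p * (rr p * x p)).
Proof.
move=> mr r0 rr_le [mx xi]; apply: integ_le (integZ W xi) => [|p].
  by apply: measurable_funM => //; exact: measurable_funM.
rewrite !normrM ler_pM// ?mulr_ge0// ler_wpM2r// ger0_norm//.
exact: le_trans (rr_le p) (rem_le _ _).
Qed.

Lemma src_integ : integ (fun p => w p * src D p).
Proof. exact: test_integ (conc_bd_integrable D (src_conc D)). Qed.

Lemma src_term_diff x y : bd_integrable x -> bd_integrable y ->
  `|src_term x - src_term y| <= W * bd_norm (fun p => x p - y p).
Proof.
move=> bx by_; have bxy := bd_integrableB bx by_; have [mxy xyi] := bxy.
have ri z : bd_integrable z -> integ (fun p => w p * (rem D p * z p)).
  by move=> bz; apply: rem_integ => //; [exact: rem_m|exact: rem_ge0].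
have si z : bd_integrable z -> integ (fun p => w p * (src D p - rem D p * z p)).
  move=> bz; apply: integ_ext (integB src_integ (ri z bz)) => p.
  by rewrite mulrBr.
rewrite /src_term -intB; [|exact: si|exact: si].
rewrite -intZ//; apply: int_abs_le.
- exact: integZ.
- by apply: integ_mfun; apply: integB; exact: si.
move=> p; rewrite -mulrBr normrM ler_pM//.
rewrite (_ : _ - _ = rem D p * (y p - x p)); last ring.
by rewrite normrM distrC ler_wpM2r// ger0_norm ?rem_ge0// rem_le.
Qed.

Lemma rhs_trunc n x : bd_integrable x ->
  `|rhsn n x - rhs x| <= 2^-1 * (3 * W * (2 * (bd_norm x * bd_tail n%:R x))) + W * bd_tail n%:R x.
Proof.
move=> bx; have [mx xi] := bx.
rewrite /rhsn /rhs opprD addrACA -mulrBr (le_trans (ler_normD _ _))// lerD//.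
  rewrite normrM ger0_norm ?invr_ge0// ler_wpM2l ?invr_ge0//.
  exact: (pair_int_trunc n coll_incr_m coll_incr_le bx).
have si (rr : R -> R) : measurable_fun setT rr -> (forall p, 0 <= rr p) ->
    (forall p, rr p <= rem D p) -> integ (fun p => w p * (src D p - rr p * x p)).
  move=> mr r0 rle; apply: integ_ext (integB src_integ (rem_integ mr r0 rle bx)) => p.
  by rewrite mulrBr.
have i1 := si _ (remn_m D n) (remn_ge0 D n) (remn_le_rem D n).
have i2 := si _ (rem_m D) (rem_ge0 D) (fun _ => lexx _).
have ti := integ_bd_tail n%:R bx.
rewrite /src_term /bd_tail -intB// -(intZ W ti); apply: int_abs_le.
- exact: integZ.
- exact: (integ_mfun (integB i1 i2)).
move=> p; rewrite -mulrBr normrM ler_pM//.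
rewrite /remn (_ : _ - _ = (1 - chi n%:R p) * (rem D p * x p)); last ring.
rewrite normrM (ger0_norm (chi_compl_ge0 _ _)) ler_wpM2l ?chi_compl_ge0//.
by rewrite normrM ler_wpM2r// ger0_norm ?rem_ge0// rem_le.
Qed.

Lemma rhs_diff x y : bd_integrable x -> bd_integrable y -> `|rhs x - rhs y| <=
  2^-1 * (3 * W * ((bd_norm x + bd_norm y) * bd_norm (fun p => x p - y p))) +
  W * bd_norm (fun p => x p - y p).
Proof.
move=> bx by_; rewrite /rhs opprD addrACA -mulrBr.
rewrite (le_trans (ler_normD _ _))// lerD//; last exact: src_term_diff.
rewrite normrM ger0_norm ?invr_ge0// ler_wpM2l ?invr_ge0//.
exact: coll_term_diff.
Qed.

Let zb t T : 0 <= t <= T -> bd_integrable (zeta t) /\ bd_norm (zeta t) <= cb * bnd T.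
Proof.
move=> tT; have [c m] := zeta_conc phi_ge phi_cauchy tT.
split; first exact: conc_bd_integrable.
by rewrite (le_trans (bd_norm_mom D c))// ler_wpM2l// cb_ge0.
Qed.

Let B_ge0 T : 0 <= T -> 0 <= cb * bnd T.
Proof. by move=> T0; rewrite mulr_ge0 ?cb_ge0// bnd_ge0. Qed.

Let uc_of (f : (R -> R) -> R) (C : R -> R) : (forall T, 0 <= T -> 0 <= C T) ->
  (forall x y T, 0 <= T -> bd_integrable x -> bd_integrable y -> bd_norm x <= cb * bnd T -> bd_norm y <= cb * bnd T ->
     `|f x - f y| <= C T * bd_norm (fun p => x p - y p)) ->
  unif_cont (fun t => f (zeta t)).
Proof.
move=> C0 hf T e T0 e0; have C1 : 0 < C T + 1 by rewrite ltr_wpDl// C0.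
have e1 : 0 < e / (C T + 1) by rewrite divr_gt0.
have [h h0 hh] := zeta_cont tails phi_ge phi_cauchy T0 e1.
exists h => // s t s0 st tT tsh.
have [bt Bt] := @zb t T (introT andP (conj (le_trans s0 st) tT)).
have [bs Bs] := @zb s T (introT andP (conj s0 (le_trans st tT))).
rewrite (le_trans (hf _ _ T T0 bt bs Bt Bs))//.
have := hh s t s0 st tT tsh; rewrite ler_pdivlMr// mulrC; apply: le_trans.
by rewrite ler_wpM2r ?bd_norm_ge0// lerDl.
Qed.

Lemma coll_term_uc : unif_cont (fun t => coll_term (zeta t)).
Proof.
apply: (@uc_of _ (fun T => 3 * W * (cb * bnd T + cb * bnd T))) => [T T0|].
  by rewrite !mulr_ge0// addr_ge0// B_ge0.
move=> x y T T0 bx by_ Bx By; rewrite (le_trans (coll_term_diff bx by_))//.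
rewrite -[leRHS]mulrA ler_wpM2l ?mulr_ge0// ler_wpM2r ?bd_norm_ge0//.
exact: lerD.
Qed.

Lemma src_term_uc : unif_cont (fun t => src_term (zeta t)).
Proof.
apply: (@uc_of _ (fun T => W)) => // x y T T0 bx by_ Bx By.
exact: src_term_diff.
Qed.

Lemma test_uc : unif_cont (fun t => test (zeta t)).
Proof.
apply: (@uc_of _ (fun T => W)) => // x y T T0 bx by_ Bx By.
exact: test_diff.
Qed.

Lemma rhs_uc : unif_cont (fun t => rhs (zeta t)).
Proof.
apply: (@uc_of _ (fun T => 2^-1 * (3 * W * (cb * bnd T + cb * bnd T)) + W)) => [T T0|].
  rewrite addr_ge0// !mulr_ge0// ?invr_ge0// addr_ge0// B_ge0//.
move=> x y T T0 bx by_ Bx By; rewrite (le_trans (rhs_diff bx by_))//.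
rewrite [leRHS]mulrDl lerD// -[leRHS]mulrA ler_wpM2l ?invr_ge0//.
rewrite -[leRHS]mulrA ler_wpM2l ?mulr_ge0// ler_wpM2r ?bd_norm_ge0//.
exact: lerD.
Qed.

(** The right-hand side of the weak form is locally Lipschitz in the weighted norm, and
    the truncation costs a tail. *)
Lemma rhsn_close T e : 0 <= T -> 0 < e -> exists2 h, 0 < h & exists K : nat,
  T <= K%:R /\ forall k (j : nat) s, (K <= k)%N -> 0 <= s <= T ->
    j%:R * dt (phi k) <= T -> `|j%:R * dt (phi k) - s| <= h ->
    `|rhsn (phi k) (euler (phi k) j) - rhs (zeta s)| <= e.
Proof.
move=> T0 e0; pose B := cb * bnd T.
have B0 : 0 <= B by exact: B_ge0.
pose C := 3 * W * B + W.
have C0 : 0 <= C by rewrite addr_ge0// mulr_ge0// mulr_ge0.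
pose e' := e / (3 * (C + 1)).
have e'0 : 0 < e' by rewrite divr_gt0// mulr_gt0// ltr_wpDl.
have Ce : C * (3 * e') <= e.
  have -> : C * (3 * e') = e * (C / (C + 1)).
    by rewrite /e'; field; rewrite gt_eqF// ltr_wpDl.
  by rewrite ler_piMr ?(ltW e0)// ler_pdivrMr ?ltr_wpDl// mul1r lerDl.
have [h h0 hh] := zeta_cont tails phi_ge phi_cauchy T0 e'0.
have [K [KT hK]] := zeta_conv tails phi_ge phi_cauchy T0 e'0.
have [Q Q0 tQ] := tails T0 e'0.
have [N [NQ NT _ _]] := nat_above Q T 0 0.
exists h => //; exists (maxn K N); split; first by rewrite (le_trans KT)// ler_nat leq_maxl.
move=> k j s; rewrite geq_max => /andP[Kk Nk] sT jT jsh.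
set n := phi k in jT jsh *; set t := j%:R * dt n in jT jsh *.
have kn : k%:R <= n%:R :> R by rewrite ler_nat.
have Nk' : N%:R <= k%:R :> R by rewrite ler_nat.
have Tn : T <= n%:R by rewrite (le_trans NT)// (le_trans Nk').
have t0 : 0 <= t by rewrite mulr_ge0// dt_ge0.
have tT : 0 <= t <= T by rewrite t0.
have zE : euler n j = approx n t by rewrite /approx idx_grid.
have [cz mz] := approx_conc D tT Tn.
have bz := conc_bd_integrable D cz.
have Bz : bd_norm (approx n t) <= B by rewrite (le_trans (bd_norm_mom D cz))// ler_wpM2l// cb_ge0.
have [bs Bs] := zb sT; have [cs _] := zeta_conc phi_ge phi_cauchy sT.
have [ct _] := zeta_conc phi_ge phi_cauchy tT.
have d1 : bd_norm (fun p => approx n t p - zeta t p) <= e' by apply: hK.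
have d2 : bd_norm (fun p => zeta t p - zeta s p) <= e'.
  have /andP[s0 sT'] := sT.
  have [st|/ltW ts] := leP s t.
    by apply: hh => //; rewrite (le_trans (ler_norm _)).
  by rewrite bd_norm_sym; apply: hh => //; rewrite (le_trans (ler_norm _))// distrC.
have d3 := bd_norm_tri D cz ct cs.
have d4 : bd_tail n%:R (approx n t) <= e'.
  apply: le_trans (tQ n t Tn tT); apply: bd_tail_le => //.
  by rewrite (le_trans NQ)// (le_trans Nk').
rewrite zE (_ : _ - _ = (rhsn n (approx n t) - rhs (approx n t)) +
  (rhs (approx n t) - rhs (zeta s))); last ring.
rewrite (le_trans (ler_normD _ _))//.
have h1 := rhs_trunc n bz; have h2 := rhs_diff bz bs.
have d30 := bd_norm_ge0 D (fun p => approx n t p - zeta s p).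
move: h2 d3 d30; set u := bd_norm (fun p => approx n t p - zeta s p) => h2 d3 d30.
have u2 : u <= 2 * e' by rewrite mulr_natl mulr2n; exact: le_trans d3 (lerD d1 d2).
have t0' := bd_tail_ge0 D n%:R (approx n t).
have h1' : 2^-1 * (3 * W * (2 * (bd_norm (approx n t) * bd_tail n%:R (approx n t)))) + W * bd_tail n%:R (approx n t)
    <= C * e'.
  rewrite (_ : 2^-1 * _ = 3 * W * bd_norm (approx n t) * bd_tail n%:R (approx n t)); last by field.
  rewrite -mulrDl; apply: ler_pM => //.
    by rewrite addr_ge0// mulr_ge0// ?bd_norm_ge0// mulr_ge0// mulr_ge0.
  by rewrite lerD2r ler_wpM2l// mulr_ge0.
have h2' : 2^-1 * (3 * W * ((bd_norm (approx n t) + bd_norm (zeta s)) * u)) + W * u <= C * (2 * e').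
  rewrite (_ : 2^-1 * _ = 3 * W * (2^-1 * (bd_norm (approx n t) + bd_norm (zeta s))) * u); last ring.
  rewrite -mulrDl; apply: ler_pM => //.
    rewrite addr_ge0// mulr_ge0 ?mulr_ge0 ?invr_ge0//.
    by rewrite addr_ge0 ?bd_norm_ge0.
  rewrite lerD2r ler_wpM2l ?mulr_ge0//.
  have Bs' : bd_norm (zeta s) <= B by exact: Bs.
  by rewrite mulrC ler_pdivrMr// mulr_natr mulr2n lerD.
apply: le_trans (lerD (le_trans h1 h1') (le_trans h2 h2')) _.
by rewrite -mulrDr (_ : e' + 2 * e' = 3 * e')//; ring.
Qed.

Let euler_sum n j i T : T <= n%:R -> (j + i)%:R * dt n <= T ->
  test (euler n (j + i)) = test (euler n j) +
    dt n * \sum_(l < i) rhsn n (euler n (j + l)).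
Proof.
move=> Tn; elim: i => [|i IH] jT; first by rewrite addn0 big_ord0 mulr0 addr0.
have jT' : (j + i)%:R * dt n <= T.
  by rewrite (le_trans _ jT)// ler_wpM2r ?dt_ge0// ler_nat leq_add2l.
have [cz _] := euler_conc_bnd Tn jT'.
rewrite big_ord_recr/= mulrDr addrA -IH// addnS /test.
have wW p : `|w p| <= W * wt p by rewrite (le_trans (w_le p))// ler_peMr// wt_ge1.
by rewrite (euler_weak cz w_m wW W0).
Qed.

(** The weak form of the scheme, summed over the steps between [s] and [t], where the
    right-hand side is nearly constant. *)
Lemma test_deriv T e : 0 <= T -> 0 < e -> exists2 h, 0 < h & forall s t, 0 <= s ->
  s <= t -> t <= T -> t - s <= h ->
  `|test (zeta t) - test (zeta s) - (t - s) * rhs (zeta s)| <= (t - s) * e.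
Proof.
move=> T0 e0; have [h h0 [K [KT hK]]] := rhsn_close T0 e0.
exists h => // s t s0 st tT tsh.
have t0 := le_trans s0 st.
have tT' : 0 <= t <= T by rewrite t0.
have sT' : 0 <= s <= T by rewrite s0 (le_trans st).
set G := rhs (zeta s).
apply/ler_addgt0Pr => e1 e10.
have C0 : 0 < 2 * W + e + `|G| by rewrite ltr_wpDr// ltr_wpDl// mulr_ge0.
pose eta := e1 / (2 * W + e + `|G|).
have eta0 : 0 < eta by rewrite divr_gt0.
have [K1 [_ hK1]] := zeta_conv tails phi_ge phi_cauchy T0 eta0.
have [K2 [K2a K2b _ _]] := nat_above eta^-1 h^-1 0 0.
pose k := maxn (maxn K K1) K2.
have Kk : (K <= k)%N by rewrite /k -maxnA leq_maxl.
have K1k : (K1 <= k)%N by rewrite /k (maxnC K) -maxnA leq_maxl.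
have K2k : (K2 <= k)%N by rewrite leq_maxr.
set n := phi k.
have kn : k%:R <= n%:R :> R by rewrite ler_nat.
have K2n : K2%:R <= n%:R :> R by rewrite (le_trans _ kn)// ler_nat.
have Tn : T <= n%:R by rewrite (le_trans KT)// (le_trans _ kn)// ler_nat.
have dn : dt n <= eta by apply: dt_small => //; exact: le_trans K2n.
have dh : dt n <= h by apply: dt_small => //; exact: le_trans K2n.
have dn0 := dt_ge0 D n.
have [ct _] := zeta_conc phi_ge phi_cauchy tT'; have [cs _] := zeta_conc phi_ge phi_cauchy sT'.
have [czt _] := approx_conc D tT' Tn; have [czs _] := approx_conc D sT' Tn.
have a1 := test_diff (conc_bd_integrable D czt) (conc_bd_integrable D ct).
have a2 := test_diff (conc_bd_integrable D czs) (conc_bd_integrable D cs).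
have b1 := hK1 k t K1k tT'; have b2 := hK1 k s K1k sT'.
have c1 := ler_wpM2l W0 b1; have c2 := ler_wpM2l W0 b2.
have /andP[s1 s2] := idx_itv D n s0; have /andP[t1 t2] := idx_itv D n t0.
have ij : (idx n s <= idx n t)%N by rewrite le_truncn// ler_pM2r ?invr_gt0 ?dt_gt0.
pose i := (idx n t - idx n s)%N.
have ijE : (idx n s + i = idx n t)%N by rewrite subnKC.
have iT : (idx n s + i)%:R * dt n <= T by rewrite ijE (le_trans t1).
have := euler_sum Tn iT; rewrite ijE -/(approx n t) -/(approx n s).
set Sg := \sum_(_ < _) _ => ES.
have idE : i%:R * dt n = (idx n t)%:R * dt n - (idx n s)%:R * dt n.
  by rewrite natrB// mulrBl.
have Sle : `|Sg - i%:R * G| <= i%:R * e.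
  rewrite (_ : Sg - i%:R * G = \sum_(l < i) (rhsn n (euler n (idx n s + l)) - G)); last first.
    by rewrite sumrB sumr_const card_ord mulr_natl.
  rewrite (le_trans (ler_norm_sum _ _ _))//.
  rewrite (_ : i%:R * e = \sum_(l < i) e); last by rewrite sumr_const card_ord mulr_natl.
  apply: ler_sum => l _.
  have l1 : (idx n s)%:R * dt n <= (idx n s + l)%:R * dt n.
    by rewrite ler_wpM2r// ler_nat leq_addr.
  have l2 : (idx n s + l)%:R * dt n <= (idx n t)%:R * dt n.
    by rewrite ler_wpM2r// ler_nat -ijE leq_add2l ltnW.
  apply: hK => //; first by rewrite (le_trans l2)// (le_trans t1).
  move: s2; rewrite -natr1 mulrDl mul1r => s2.
  exact: (grid_dist l1 l2 t1 s2 dh tsh).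
have main : `|dt n * Sg - (t - s) * G| <= (t - s) * e + eta * (e + `|G|).
  rewrite (_ : dt n * Sg - _ = dt n * (Sg - i%:R * G) + (i%:R * dt n - (t - s)) * G);
    last ring.
  rewrite (le_trans (ler_normD _ _))// !normrM (ger0_norm dn0).
  move: s2 t2; rewrite -natr1 mulrDl mul1r -natr1 mulrDl mul1r => s2 t2.
  have idle : `|i%:R * dt n - (t - s)| <= eta.
    by rewrite idE; apply: (grid_length s1 s2 t1 t2 dn).
  have m1 : dt n * `|Sg - i%:R * G| <= (t - s + eta) * e.
    apply: (@le_trans _ _ (dt n * (i%:R * e))); first by rewrite ler_wpM2l.
    rewrite mulrA ler_wpM2r ?(ltW e0)// mulrC.
    by rewrite addrC -lerBlDr (le_trans (ler_norm _) idle).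
  have m2 : `|i%:R * dt n - (t - s)| * `|G| <= eta * `|G| by rewrite ler_wpM2r.
  by rewrite (le_trans (lerD m1 m2))// mulrDl mulrDr addrA.
have etaE : eta * (2 * W + e + `|G|) = e1 by rewrite /eta mulrVK// unitfE gt_eqF.
rewrite (increment_split _ _ _ ES).
rewrite (le_trans (ler_normD _ _))//.
apply: le_trans (lerD (ler_normB _ _) (lexx _)) _.
apply: le_trans (lerD (lerD main (le_trans a1 c1)) (le_trans a2 c2)) _.
by rewrite -etaE le_eqVlt; apply/orP; left; apply/eqP; ring.
Qed.

Lemma weak_identity t : 0 <= t ->
  ((test (zeta t) - test (zin D))%:E =
   (2^-1)%:E * \int[mu]_(s in `[0%R, t]) (coll_term (zeta s))%:E +
   \int[mu]_(s in `[0%R, t]) (src_term (zeta s))%:E)%E.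
Proof.
move=> t0; have ftc := ftc_unif rhs_uc test_deriv test_uc t0.
have ci := unif_cont_integrable t coll_term_uc.
have si := unif_cont_integrable t src_term_uc.
have z0 : zeta 0 = zin D by apply/funext => p; rewrite zeta0.
rewrite -z0 EFinB -ftc.
under eq_integral do rewrite EFinD EFinM.
rewrite integralD//; last exact: integrableZl.
by rewrite integralZl.
Qed.

End weak_form.

(** * Uniform tails *)

Section vanishing.
Context (R : realType).

Lemma int_vanish (v : nat -> R -> R) (f : R -> R) : integ f -> (forall p, 0 <= f p) ->
  (forall n, measurable_fun setT (v n)) -> (forall n p, 0 <= v n p <= 1) ->
  (forall p, v n p @[n --> \oo] --> (0 : R)) ->
  forall e, 0 < e -> exists N : nat, forall n, (N <= n)%N ->
    \int[mu]_p (v n p * f p) <= e.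
Proof.
move=> fi f0 mv v01 v0 e e0; have mf := integ_mfun fi.
have bnd n p : `|v n p * f p| <= f p.
  have /andP[a b] := v01 n p.
  by rewrite ger0_norm ?mulr_ge0// ler_piMl.
have vi n : integ (fun p => v n p * f p).
  exact: (integ_le (mu := mu) (measurable_funM (mv n) mf) (bnd n) fi).
have := @dominated_cvg _ _ _ mu _ measurableT (fun n p => (v n p * f p)%:E)
  (fun=> 0%E) (EFin \o f) _ _ _ fi _.
rewrite integral0 => c.
have {}c : (\int[mu]_p (v n p * f p)%:E)%E @[n --> \oo] --> (0 : \bar R)%E.
  apply: c => //.
  - by move=> n; apply/measurable_EFinP; exact: (measurable_funM (mv n) mf).
  - move=> p _; apply: cvg_EFin; first exact: nearW.
    rewrite -(mul0r (f p)); apply: cvgM; [exact: v0|exact: cvg_cst].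
  - by move=> n p _ /=; rewrite lee_fin; exact: bnd.
have c' : \int[mu]_p (v n p * f p) @[n --> \oo] --> (0 : R).
  exact: (fine_cvg c).
have /cvgrPdist_le/(_ e e0) [N _ hN] := c'.
exists N => n Nn; have := hN n Nn; rewrite sub0r normrN.
by apply: le_trans; exact: ler_norm.
Qed.

Lemma chi_vanish (p : R) : 1 - chi n%:R p @[n --> \oo] --> (0 : R).
Proof.
have [N [pN _ _ _]] := nat_above (p + 1) 0 0 0.
apply: cvg_near_cst; exists N => // n /= Nn.
rewrite /chi (_ : p < n%:R) ?subrr//.
by rewrite (lt_le_trans (_ : p < p + 1))// ?ltrDl// (le_trans pN)// ler_nat.
Qed.

End vanishing.

Section tails.
Context (R : realType) (D : coag_data R).
Notation bd := (bd D).
Notation cb := (cb D).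
Notation bd_tail := (bd_tail D).
Notation dt := (dt D).
Notation euler := (euler D).
Notation bnd := (bnd D).
Notation approx := (approx D).
Notation idx := (idx D).
Notation ker := (ker D).
Notation kern := (kern D).

(** If the weight is of smaller order than 1 + p, the moment bound suffices. *)
Lemma sublinear_tails :
  (forall e, 0 < e -> exists2 Q, 0 <= Q & forall p, Q <= p -> bd p <= e * wt p) ->
  uniform_tails D.
Proof.
move=> sub T e T0 e0; have M0 := bnd_ge0 D T0.
have e1 : 0 < e / (bnd T + 1) by rewrite divr_gt0// ltr_wpDl.
have [Q Q0 hQ] := sub _ e1; exists Q => // n t Tn tT.
have [cz mz] := approx_conc D tT Tn; have [_ z0 _ zi] := cz.
apply: (@le_trans _ _ (e / (bnd T + 1) * mom (approx n t))); last first.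
  rewrite mulrAC ler_pdivrMr ?ltr_wpDl// ler_wpM2l ?(ltW e0)//.
  by rewrite (le_trans mz)// lerDl.
rewrite /mom -intZ//; apply: int_le.
- exact: (integ_bd_tail Q (conc_bd_integrable D cz)).
- exact: integZ.
move=> p; rewrite (ger0_norm (z0 p)) /chi; case: (ltP p Q) => pQ.
  by rewrite subrr mul0r mulr_ge0 ?(ltW e1)// mulr_ge0 ?wt_ge0.
by rewrite subr0 mul1r mulrA ler_wpM2r// hQ.
Qed.

Section linear.
Variable A : R.
Hypothesis A0 : 0 <= A.
Hypothesis bd_lin : forall p, bd p = cb * wt p.
Hypothesis ker_lin : forall p q, 0 < p -> 0 < q -> ker p q <= A * (1 + p + q).

(** A substitute for the indicator of the sizes beyond [P] that tends to 0 pointwise as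
    [P] grows and increases so slowly that collisions under a linear kernel remain
    under control. *)
Definition ramp (P p : R) : R := Num.min 1 (`|p| / P).
Definition ramp_mom (P : R) (z : R -> R) : R := \int[mu]_p (wt p * ramp P p * z p).

Section fixed_P.
Variable P : R.
Hypothesis P1 : 1 <= P.
Let P0 : 0 < P. Proof. exact: lt_le_trans P1. Qed.

Lemma ramp_ge0 p : 0 <= ramp P p.
Proof. by rewrite /ramp le_min ler01 divr_ge0// ltW. Qed.
Lemma ramp_le1 p : ramp P p <= 1.
Proof. by rewrite /ramp ge_min lexx. Qed.

Lemma ramp_m : measurable_fun setT (ramp P).
Proof.
by apply: measurable_minr => //; apply: measurable_funM => //; exact: measurableT_comp.
Qed.

Lemma ramp_sub p q : 0 < p -> 0 < q -> ramp P (p + q) <= ramp P p + ramp P q.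
Proof.
move=> p0 q0; rewrite /ramp !gtr0_norm ?addr_gt0// mulrDl.
have a : 0 <= p / P by rewrite divr_ge0// ltW.
have b : 0 <= q / P by rewrite divr_ge0// ltW.
by case: (leP 1 (p / P)); case: (leP 1 (q / P)); case: (leP 1 (p / P + q / P)) => *; lra.
Qed.

(** The quotient of [ramp P p] by [p] is nonincreasing in [p]. *)
Lemma ramp_incr p q : 0 < p -> 0 < q -> p * (ramp P (p + q) - ramp P p) <= q * ramp P p.
Proof.
move=> p0 q0; rewrite /ramp !gtr0_norm ?addr_gt0//.
have pP : p * (q / P) = q * (p / P) by rewrite mulrCA.
have a : 0 <= q * (p / P) by rewrite mulr_ge0 ?(ltW q0)// divr_ge0// ltW.
have qP0 : 0 <= q / P by rewrite divr_ge0// ltW.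
rewrite (_ : (p + q) / P = p / P + q / P); last by rewrite mulrDl.
case: (leP 1 (p / P)) => h1; case: (leP 1 (p / P + q / P)) => h2.
- by rewrite subrr mulr0 mulr1 ltW.
- by move: h1 h2 qP0; lra.
- rewrite -pP ler_wpM2l ?(ltW p0)//; lra.
- by rewrite -pP ler_wpM2l ?(ltW p0)//; lra.
Qed.

Let om p : R := wt p * ramp P p.

Lemma om_m : measurable_fun setT om.
Proof. by apply: measurable_funM; [exact: measurable_wt|exact: ramp_m]. Qed.
Lemma om_ge0 p : 0 <= om p. Proof. by rewrite mulr_ge0 ?wt_ge0 ?ramp_ge0. Qed.
Lemma om_le p : `|om p| <= 1 * wt p.
Proof. by rewrite ger0_norm ?om_ge0// mul1r ler_piMr ?wt_ge0 ?ramp_le1. Qed.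

(** On the right one factor always carries the ramp, so the resulting bound for the
    collision term is linear in the ramped moment, which is what Gronwall needs. *)
Lemma om_coll p q : 0 < p -> 0 < q ->
  coll_incr om (p, q) * (1 + p + q) <= 2 * (om p * wt q + wt p * om q).
Proof.
move=> p0 q0; rewrite /coll_incr /om /wt /= !gtr0_norm ?addr_gt0//.
have := ramp_incr p0 q0; have := ramp_incr q0 p0; rewrite (addrC q).
have := ramp_sub p0 q0; have := ramp_ge0 p; have := ramp_ge0 q.
move: (ramp P p) (ramp P q) (ramp P (p + q)) => a b c a0 b0 cab cq cp.
pose X := p * (c - a) + q * (c - b).
have X1 : X * 1 <= p * b + q * a.
  rewrite mulr1 /X; apply: lerD; rewrite ler_wpM2l//; [exact: ltW|lra|exact: ltW|lra].
have Xp : p * X <= p * q * a + p * q * a.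
  rewrite /X mulrDr; apply: lerD.
    by rewrite -mulrA ler_wpM2l// ltW.
  by rewrite mulrA; apply: ler_wpM2l; [exact/ltW/mulr_gt0|lra].
have Xq : q * X <= p * q * b + p * q * b.
  rewrite /X mulrDr; apply: lerD.
    by rewrite mulrA (mulrC q p); apply: ler_wpM2l; [exact/ltW/mulr_gt0|lra].
  by rewrite (mulrC p q) -mulrA ler_wpM2l// ltW.
have E : (1 + (p + q)) * c - (1 + p) * a - (1 + q) * b = X + (c - a - b).
  by rewrite /X; ring.
rewrite E (@le_trans _ _ (X * (1 + p + q)))//.
  apply: ler_wpM2r; last by rewrite gerDl; lra.
  by rewrite addr_ge0 ?addr_ge0// ltW.
have := mulr_ge0 (ltW p0) a0; have := mulr_ge0 (ltW q0) b0.
have := mulr_ge0 (ltW p0) b0; have := mulr_ge0 (ltW q0) a0.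
have := mulr_ge0 (mulr_ge0 (ltW p0) (ltW q0)) a0.
have := mulr_ge0 (mulr_ge0 (ltW p0) (ltW q0)) b0.
move: X1 Xp Xq; rewrite mulr1; move: X {E} => X X1 Xp Xq h1 h2 h3 h4 h5 h6.
rewrite (_ : X * (1 + p + q) = X + p * X + q * X); last ring.
apply: (@le_trans _ _ (p * b + q * a + (p * q * a + p * q * a) + (p * q * b + p * q * b))).
  by rewrite !lerD.
rewrite -subr_ge0 (_ : _ - _ = 2 * a + 2 * b + 2 * (p * a) + 2 * (q * b) +
  (p * b) + (q * a)); last ring.
lra.
Qed.

Lemma coll_om n z : conc z -> pair_int (kern n) (coll_incr om) z <= A * (4 * (ramp_mom P z * mom z)).
Proof.
move=> cz; have [mz z0 zp zi] := cz.
have oi : integ (fun p => om p * z p) by exact: conc_integ_le om_m om_le cz.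
have [t1 e1] := integ_tensor oi zi; have [t2 e2] := integ_tensor zi oi.
have -> : A * (4 * (ramp_mom P z * mom z)) =
    \int[mu2]_x ((A * 2) * ((om x.1 * z x.1) * (wt x.2 * z x.2) +
      (wt x.1 * z x.1) * (om x.2 * z x.2))).
  rewrite intZ; last exact: integD.
  rewrite intD// e1 e2 -/(mom z) -/(ramp_mom P z); ring.
apply: int_le.
- apply: (integ2_pair_int (kern_m D n) (kern_ge0 D n) (kern_le D n) cz (c := 3)) => //.
    by apply: coll_incr_m; exact: om_m.
  move=> [p q]; rewrite /coll_incr/=.
  have a := om_le (p + q); have b := om_le p; have c := om_le q.
  rewrite !mul1r in a b c.
  have := wtD p q; have := wt_ge1 p; have := wt_ge1 q => h1 h2 h3.
  rewrite (le_trans (ler_normB _ _))//.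
  have := ler_normB (om (p + q)) (om p).
  have : wt p <= wt p * wt q by rewrite ler_peMr ?wt_ge0.
  have : wt q <= wt p * wt q by rewrite ler_peMl ?wt_ge0.
  lra.
- by apply: integZ; exact: integD.
move=> [p q] /=.
have rhs0 : 0 <= A * 2 * (om p * z p * (wt q * z q) + wt p * z p * (om q * z q)).
  apply: mulr_ge0; first by rewrite mulr_ge0.
  by apply: addr_ge0; rewrite mulr_ge0// mulr_ge0 ?om_ge0 ?wt_ge0.
have [p0|p0] := leP p 0; first by rewrite kern_pos// mul0r mulr0.
have [q0|q0] := leP q 0; first by rewrite kern_sym kern_pos// mul0r mulr0.
have [w0|w0] := leP (coll_incr om (p, q)) 0.
  by rewrite (le_trans _ rhs0)// mulr_le0_ge0// mulr_ge0 ?kern_ge0// mulr_ge0.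
rewrite [leRHS](_ : _ = (A * (2 * (om p * wt q + wt p * om q))) * (z p * z q)); last ring.
rewrite mulrA ler_wpM2r ?mulr_ge0//.
apply: (@le_trans _ _ (coll_incr om (p, q) * (A * (1 + p + q)))).
  rewrite ler_wpM2l ?(ltW w0)// (le_trans (kern_le_ker _ _ _ _))//.
  exact: ker_lin.
by rewrite mulrCA ler_wpM2l// om_coll.
Qed.

Lemma ramp_mom_euler n j T : 0 <= T -> T <= n%:R -> j%:R * dt n <= T ->
  ramp_mom P (euler n j) <= (ramp_mom P (zin D) + T * ramp_mom P (src D)) * expR (2 * A * bnd T * T).
Proof.
move=> T0 Tn jT; have M0 := bnd_ge0 D T0; have d0 := dt_ge0 D n.
have V0 z : conc z -> 0 <= ramp_mom P z.
  by move=> [_ z0 _ _]; apply: int_ge0 => p; rewrite mulr_ge0 ?om_ge0.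
have a0 : 0 <= dt n * (2 * A * bnd T) by rewrite mulr_ge0// mulr_ge0// mulr_ge0.
have vs := V0 _ (src_conc D); have vz := V0 _ (zin_conc D).
have g0 : 0 <= dt n * ramp_mom P (src D) by rewrite mulr_ge0.
apply: le_trans (@discrete_gronwall R (fun j => ramp_mom P (euler n j))
  (dt n * (2 * A * bnd T)) (dt n * ramp_mom P (src D)) (ramp_mom P (zin D)) j a0 g0 vz (lexx _) _) _.
  move=> l lj; have lT : l%:R * dt n <= T.
    by rewrite (le_trans _ jT)// ler_wpM2r// ler_nat ltnW.
  have [cz mz] := euler_conc_bnd Tn lT; have [mmz z0 zp zi] := cz.
  rewrite /ramp_mom (euler_weak cz om_m om_le ler01) -/(ramp_mom P _) mulrDl mul1r -addrA lerD2l.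
  rewrite -mulrA -mulrDr ler_wpM2l// lerD//.
    have := coll_om n cz => h.
    have : ramp_mom P (euler n l) * mom (euler n l) <= ramp_mom P (euler n l) * bnd T.
      by rewrite ler_wpM2l// V0.
    move=> /(ler_wpM2l A0) h2.
    move: h h2; move: (pair_int _ _ _) (ramp_mom P _) (mom _) => c v m h h2.
    rewrite (_ : 2 * A * bnd T * v = 2^-1 * (4 * (A * (v * bnd T)))); last by field.
    by rewrite ler_wpM2l ?invr_ge0// (le_trans h)// mulrCA ler_wpM2l.
  have si := conc_integ_le om_m om_le (src_conc D).
  apply: int_le => //.
    have ri : integ (fun p => om p * remn D n p * euler n l p).
      apply: (@conc_integ_le _ _ (fun p => om p * remn D n p) (rho D n)) => //.
        by apply: measurable_funM; [exact: om_m|exact: remn_m].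
      move=> p; rewrite normrM mulrC ler_pM//.
        by rewrite ger0_norm ?remn_ge0 ?remn_le.
      by have := om_le p; rewrite mul1r.
    by apply: integ_ext (integB si ri) => p; ring.
  move=> p; rewrite ler_wpM2l ?om_ge0// gerBl mulr_ge0 ?remn_ge0//.
rewrite (_ : j%:R * (dt n * ramp_mom P (src D)) = (j%:R * dt n) * ramp_mom P (src D)); last ring.
rewrite (_ : j%:R * (dt n * (2 * A * bnd T)) = (2 * A * bnd T) * (j%:R * dt n)); last ring.
apply: ler_pM; rewrite ?expR_ge0//.
- by rewrite addr_ge0// mulr_ge0// mulr_ge0.
- by rewrite lerD2l ler_wpM2r.
- by rewrite ler_expR ler_wpM2l// mulr_ge0// mulr_ge0.
Qed.

Lemma bd_tail_ramp_mom z : conc z -> bd_tail P z <= cb * ramp_mom P z.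
Proof.
move=> cz; have [mz z0 zp zi] := cz.
have oi : integ (fun p => om p * z p) by exact: conc_integ_le om_m om_le cz.
rewrite /ramp_mom -intZ//; apply: int_le.
- exact: (integ_bd_tail P (conc_bd_integrable D cz)).
- exact: integZ.
move=> p; rewrite (ger0_norm (z0 p)) bd_lin /chi; case: (ltP p P) => pP.
  by rewrite subrr mul0r mulr_ge0 ?cb_ge0// mulr_ge0 ?om_ge0.
rewrite subr0 mul1r -!mulrA ler_wpM2l ?cb_ge0//.
rewrite /ramp min_l ?mul1r// ler_pdivlMr// mul1r (le_trans pP)// ler_norm//.
Qed.

End fixed_P.

Lemma ramp_mom_vanish z e : conc z -> 0 < e -> exists N : nat, forall n, (N <= n)%N ->
  ramp_mom n.+1%:R z <= e.
Proof.
move=> cz e0; have [mz z0 zp zi] := cz.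
have [] := @int_vanish _ (fun n => ramp n.+1%:R) (fun p => wt p * z p) zi _ _ _ _ e e0.
- by move=> p; rewrite mulr_ge0 ?wt_ge0.
- by move=> n; exact: ramp_m.
- by move=> n p; rewrite ramp_ge0 ?ler1n// ramp_le1.
- move=> p; apply/cvgrPdist_le => d d0.
  have [N [hN _ _ _]] := nat_above (`|p| / d) 0 0 0.
  exists N => // n /= Nn; rewrite sub0r normrN ger0_norm ?ramp_ge0 ?ler1n//.
  rewrite /ramp ge_min ler_pdivrMr ?ltr0n// mulrC -ler_pdivrMr//.
  by rewrite (le_trans hN) ?orbT// ler_nat leqW.
move=> N hN; exists N => n Nn; apply: le_trans (hN n Nn).
by rewrite le_eqVlt; apply/orP; left; apply/eqP; apply: eq_int => p; ring.
Qed.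

(** Here the weight is comparable to 1 + p, and the moment bound gives nothing. The
    ramped moment dominates the tail beyond [P], satisfies a Gronwall estimate with a
    constant independent of [P], and tends to 0 for initial value and source. *)
Lemma linear_tails : uniform_tails D.
Proof.
move=> T e T0 e0.
pose X := expR (2 * A * bnd T * T).
have X0 : 0 < X := expR_gt0 _.
have c0 : 0 < cb by rewrite (lt_le_trans ltr01)// cb_ge1.
pose e1 := e / (cb * X * (1 + T)).
have e10 : 0 < e1 by rewrite divr_gt0// mulr_gt0 ?mulr_gt0// ltr_wpDr.
have [N1 h1] := ramp_mom_vanish (zin_conc D) e10.
have [N2 h2] := ramp_mom_vanish (src_conc D) e10.
pose N := maxn N1 N2; exists N.+1%:R => // n t Tn tT.
have P1 : 1 <= N.+1%:R :> R by rewrite ler1n.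
have [cz _] := approx_conc D tT Tn.
rewrite (le_trans (bd_tail_ramp_mom P1 cz))//.
have /andP[t0 tT'] := tT; have /andP[i1 _] := idx_itv D n t0.
have := ramp_mom_euler P1 T0 Tn (le_trans i1 tT'); rewrite -/(approx n t) -/X => hV.
have v1 : ramp_mom N.+1%:R (zin D) <= e1 by apply: h1; rewrite leq_maxl.
have v2 : ramp_mom N.+1%:R (src D) <= e1 by apply: h2; rewrite leq_maxr.
have hs : ramp_mom N.+1%:R (zin D) + T * ramp_mom N.+1%:R (src D) <= e1 * (1 + T).
  by rewrite mulrDr mulr1 lerD// mulrC ler_wpM2r.
rewrite (le_trans (ler_wpM2l (ltW c0) hV))//.
apply: (@le_trans _ _ (cb * (e1 * (1 + T) * X))).
  by apply: ler_wpM2l; [exact: ltW|apply: ler_wpM2r => //; exact: ltW].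
rewrite (_ : cb * _ = e1 * (cb * X * (1 + T))); last ring.
by rewrite /e1 mulrVK// unitfE gt_eqF// mulr_gt0 ?mulr_gt0// ltr_wpDr.
Qed.

End linear.
End tails.

(** * Integrals over the positive sizes as integrals over the line *)

Section conversion.
Context (R : realType).

Lemma RposE (p : R) : (p \in Rpos R) = (0 < p).
Proof. by rewrite /Rpos mem_setE in_itv/= andbT. Qed.

Lemma Rpos_gt0 (p : R) : Rpos R p -> 0 < p.
Proof. by rewrite /Rpos/= in_itv/= andbT. Qed.

Lemma gt0_Rpos (p : R) : 0 < p -> Rpos R p.
Proof. by rewrite /Rpos/= in_itv/= andbT. Qed.

Lemma measurable_Rpos : measurable (Rpos R).
Proof. exact: measurable_itv. Qed.

Lemma aeI (P Q : R -> Prop) : {ae mu, forall p, P p} -> {ae mu, forall p, Q p} ->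
  {ae mu, forall p, P p /\ Q p}.
Proof.
move=> hP hQ; have := negligibleU hP hQ; apply: negligibleS => p /= nPQ.
by have [Pp|nP] := pselect (P p); [right => Qp; exact: nPQ|left].
Qed.

Lemma ae_shift (P : R -> Prop) (a : R) : {ae mu, forall p, P p} ->
  {ae mu, forall p, P (p + a)}.
Proof.
move=> [N [mN N0 PN]].
have msh : measurable_fun setT (fun x : R => x + a) by exact: measurable_funD.
have mNa : measurable ((fun x : R => x + a) @^-1` N).
  by rewrite -[X in measurable X]setTI; exact: msh.
exists ((fun x : R => x + a) @^-1` N); split=> //; last first.
  by move=> p /= nP; apply: PN.
have mi : measurable_fun setT (fun x : R => (\1_N x : R)%:E).
  by apply/measurable_EFinP; exact: measurable_indic.
have i0 (x : R) : (0 <= (\1_N x : R)%:E)%E by rewrite lee_fin.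
have NE : (\int[mu]_x (\1_N x : R)%:E = 0)%E by rewrite integral_indic// setIT.
rewrite -NE -(ge0_integral_shift a mi i0) -[LHS](congr1 mu (setIT _)).
by rewrite -integral_indic.
Qed.

Lemma conv1 (f g : R -> R) : measurable_fun (Rpos R) f -> integ g ->
  (forall p, p <= 0 -> g p = 0) -> {ae mu, forall p, 0 < p -> f p = g p} ->
  (\int[mu]_(p in Rpos R) (f p)%:E = (\int[mu]_p g p)%:E)%E.
Proof.
move=> mf gi g0 fg; rewrite EFin_int// [LHS]integral_mkcond.
have mg := integ_mfun gi.
apply: ae_eq_integral => //.
- apply: (measurable_restrictT _ measurable_Rpos).1.
  exact/measurable_EFinP.
- exact/measurable_EFinP.
apply: aeS fg => p fp _; rewrite patchE RposE.
by case: ltP => [p0|p0]; [rewrite fp|rewrite g0].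
Qed.

(** Equality almost everywhere is asked for on almost every vertical line. This is the
    form in which it is known for a kernel that is unspecified where p + q = 1. *)
Lemma conv2 (F u : R * R -> R) : measurable_fun setT F -> integ2 u ->
  {ae mu, forall p, {ae mu, forall q, F (p, q) = u (p, q)}} ->
  (\int[mu]_p \int[mu]_q (F (p, q))%:E = (\int[mu2]_z u z)%:E)%E.
Proof.
move=> mF ui Fu.
have mu_ : measurable_fun setT u by exact: integ_mfun ui.
have mFE : measurable_fun setT (EFin \o F) by exact/measurable_EFinP.
have muE : measurable_fun setT (EFin \o u) by exact/measurable_EFinP.
have sec (v : R * R -> R) p : measurable_fun setT v -> measurable_fun setT (fun q => v (p, q)).
  move=> mv; exact: (measurableT_comp mv (pair1_measurable p)).
have maF : measurable_fun setT (fun z => `|F z|%:E) by apply/measurable_EFinP; exact: measurableT_comp.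
have mau : measurable_fun setT (fun z => `|u z|%:E) by apply/measurable_EFinP; exact: measurableT_comp.
have Fi : integ2 F.
  apply: ((integrable12ltyP mu mu mFE).2).
  have := (integrable12ltyP mu mu muE).1 ui; apply: le_lt_trans.
  rewrite le_eqVlt; apply/orP; left; apply/eqP.
  apply: ge0_ae_eq_integral => //.
  - apply: (measurable_fun_fubini_tonelli_F (m2 := mu) (fun z => `|F z|%:E)) => //.
  - apply: (measurable_fun_fubini_tonelli_F (m2 := mu) (fun z => `|u z|%:E)) => //.
  - by move=> p _; apply: integral_ge0.
  - by move=> p _; apply: integral_ge0.
  apply: aeS Fu => p Fup _; apply: ge0_ae_eq_integral => //.
  - by apply/measurable_EFinP; apply: measurableT_comp => //; exact: sec.
  - by apply/measurable_EFinP; apply: measurableT_comp => //; exact: sec.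
  by apply: aeS Fup => q Fq _ /=; rewrite Fq.
rewrite EFin_int// -(integral12_prod_meas1 ui).
apply: ae_eq_integral => //.
- exact: (measurable_int mu (integrable_fubini_F Fi)).
- exact: (measurable_int mu (integrable_fubini_F ui)).
apply: aeS Fu => p Fup _; apply: ae_eq_integral => //.
- by apply/measurable_EFinP; exact: sec.
- by apply/measurable_EFinP; exact: sec.
by apply: aeS Fup => q Fq _ /=; rewrite Fq.
Qed.

(** Clamping at the essential bound changes the function only on a null set. *)
Lemma Linfty_clamp (w : R -> R) : Linfty w -> exists (w' : R -> R) (W : R),
  [/\ measurable_fun setT w', forall p, `|w' p| <= W &
      {ae mu, forall p, 0 < p -> w p = w' p}].
Proof.
move=> [mw [M wM]].
pose c (x : R) := Num.max (- `|M|) (Num.min `|M| x).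
exists ((c \o w) \_ (Rpos R)), `|M|; split.
- apply: (measurable_restrictT _ measurable_Rpos).1.
  by apply: measurable_maxr => //; exact: measurable_minr.
- move=> p; rewrite patchE; case: ifP => _; last by rewrite normr0.
  rewrite /c/= ler_norml le_max lexx/= ge_max ge_min lexx/= andbT.
  by rewrite (le_trans _ (normr_ge0 M))// oppr_le0.
apply: aeS wM => p wp p0; rewrite patchE RposE p0 /c/=.
have := wp (gt0_Rpos p0) => {}wp; have := le_trans wp (ler_norm M).
by rewrite ler_norml => /andP[a b]; rewrite min_r// max_r.
Qed.

Lemma measurable_RposX (F : R * R -> R) : measurable_fun (Rpos R `*` Rpos R) F ->
  measurable_fun setT (F \_ (Rpos R `*` Rpos R)).
Proof.
move=> mF; apply: (measurable_restrictT _ _).1 => //.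
by apply: measurableX; exact: measurable_Rpos.
Qed.

Lemma iterated_Rpos (F : R -> R -> R) :
  (\int[mu]_(p in Rpos R) \int[mu]_(q in Rpos R) (F p q)%:E =
   \int[mu]_p \int[mu]_q
     (((fun z => F z.1 z.2) \_ (Rpos R `*` Rpos R)) (p, q))%:E)%E.
Proof.
rewrite integral_mkcond; apply: eq_integral => p _; rewrite patchE RposE.
case: ifP => p0.
  rewrite integral_mkcond; apply: eq_integral => q _; rewrite !patchE in_setX/= !RposE p0.
  by case: ifP.
rewrite -[LHS](integral0 mu setT); apply: eq_integral => q _.
by rewrite patchE in_setX/= !RposE p0.
Qed.

Lemma measurable_Rpos_fst (f : R -> R) : measurable_fun (Rpos R) f ->
  measurable_fun (Rpos R `*` Rpos R) (fun z : R * R => f z.1).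
Proof.
move=> mf; apply: (measurable_comp (F := Rpos R)) mf _; first exact: measurable_Rpos.
  by move=> _ [z [z1 _] <-].
exact: measurable_funTS.
Qed.

Lemma measurable_Rpos_snd (f : R -> R) : measurable_fun (Rpos R) f ->
  measurable_fun (Rpos R `*` Rpos R) (fun z : R * R => f z.2).
Proof.
move=> mf; apply: (measurable_comp (F := Rpos R)) mf _; first exact: measurable_Rpos.
  by move=> _ [z [_ z2] <-].
exact: measurable_funTS.
Qed.

Lemma measurable_Rpos_sum (f : R -> R) : measurable_fun (Rpos R) f ->
  measurable_fun (Rpos R `*` Rpos R) (fun z : R * R => f (z.1 + z.2)).
Proof.
move=> mf; apply: (measurable_comp (F := Rpos R)) mf _; first exact: measurable_Rpos.
  move=> _ [z [/Rpos_gt0 z1 /Rpos_gt0 z2] <-]; apply: gt0_Rpos.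
  exact: addr_gt0.
by apply: measurable_funTS; exact: measurable_funD.
Qed.

End conversion.

Section solution.
Context (R : realType) (D : coag_data R).

Variables (zin0 S0 Rm : R -> R) (K0 : R -> R -> R).
Hypothesis zin0_m : measurable_fun (Rpos R) zin0.
Hypothesis zin0E : {ae mu, forall p, 0 < p -> zin0 p = zin D p}.
Hypothesis S0_m : measurable_fun (Rpos R) S0.
Hypothesis S0E : forall p, 0 < p -> S0 p = src D p.
Hypothesis Rm_m : measurable_fun (Rpos R) Rm.
Hypothesis RmE : forall p, 0 < p -> Rm p = rem D p.
Hypothesis K0_m : measurable_fun (Rpos R `*` Rpos R) (fun z : R * R => K0 z.1 z.2).
Hypothesis K0E : {ae mu, forall p, 0 < p -> {ae mu, forall q, 0 < q -> K0 p q = ker D p q}}.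

Section one_time.
Variable x : R -> R.
Hypothesis cx : conc x.
Let bx : bd_integrable D x. Proof. exact: conc_bd_integrable. Qed.
Let mx : measurable_fun setT x. Proof. by case: cx. Qed.
Let xp p : p <= 0 -> x p = 0. Proof. by case: cx => [_ _ h _]; exact: h. Qed.
Let mxR : measurable_fun (Rpos R) x. Proof. exact: measurable_funTS. Qed.

Variables (w w' : R -> R) (W : R).
Hypothesis w_m : measurable_fun (Rpos R) w.
Hypothesis w'_m : measurable_fun setT w'.
Hypothesis w'_le : forall p, `|w' p| <= W.
Hypothesis ww' : {ae mu, forall p, 0 < p -> w p = w' p}.

Lemma test_conv :
  (\int[mu]_(p in Rpos R) ((x p - zin0 p) * w p)%:E = (test w' x - test w' (zin D))%:E)%E.
Proof.
have cz := zin_conc D; have bz := conc_bd_integrable D cz.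
have [_ _ zp _] := cz.
have i1 := test_integ w'_m w'_le bx; have i2 := test_integ w'_m w'_le bz.
rewrite /test -intB//; apply: conv1.
- by apply: measurable_funM => //; exact: measurable_funB.
- exact: integB.
- by move=> p p0; rewrite xp// zp// subrr.
by apply: aeS (aeI zin0E ww') => p [h1 h2] p0; rewrite h1// h2//; ring.
Qed.

Lemma src_conv :
  (\int[mu]_(p in Rpos R) (w p * (S0 p - Rm p * x p))%:E = (src_term D w' x)%:E)%E.
Proof.
have cs := src_conc D; have bs := conc_bd_integrable D cs; have [_ _ sp _] := cs.
have i1 := src_integ D w'_m w'_le.
have i2 := rem_integ w'_m w'_le (rem_m D) (rem_ge0 D) (fun _ => lexx _) bx.
apply: conv1.
- apply: measurable_funM => //; apply: measurable_funB => //.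
  exact: measurable_funM.
- by apply: integ_ext (integB i1 i2) => p; rewrite mulrBr.
- by move=> p p0; rewrite xp// sp// mulr0 subrr mulr0.
by apply: aeS ww' => p h p0; rewrite h// S0E// RmE.
Qed.

Lemma coll_conv :
  (\int[mu]_(p in Rpos R) \int[mu]_(q in Rpos R)
     (wtilde w p q * K0 p q * x p * x q)%:E = (coll_term D w' x)%:E)%E.
Proof.
rewrite iterated_Rpos.
have [ui _] := form_le (ker_m D) (ker_ge0 D) (fun _ _ => lexx _)
  (coll_incr_m w'_m) (coll_incr_le w'_le) bx bx.
apply: (conv2 _ ui).
  apply: measurable_RposX; apply: measurable_funM; last exact: measurable_Rpos_snd.
  apply: measurable_funM; last exact: measurable_Rpos_fst.
  apply: measurable_funM => //; apply: measurable_funB.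
    apply: measurable_funB; first exact: measurable_Rpos_sum.
    exact: measurable_Rpos_fst.
  exact: measurable_Rpos_snd.
apply: aeS (aeI ww' K0E) => p [wp Kp].
have [p0|p0] := leP p 0.
  apply: aeS ww' => q _; rewrite patchE in_setX/= RposE ltNge p0/=.
  by rewrite ker_pos// mul0r mulr0.
apply: aeS (aeI (ae_shift p ww') (aeI ww' (Kp p0))) => q [wpq [wq Kq]].
rewrite patchE in_setX/= !RposE p0/=; have [q0|q0] := leP q 0.
  by rewrite ker_pos2// mul0r mulr0.
rewrite /wtilde /coll_incr/= wp// wq// Kq// [p + q]addrC wpq ?addr_gt0//.
by ring.
Qed.

End one_time.

Lemma mom_conv x : conc x ->
  (\int[mu]_(p in Rpos R) ((1 + p) * `|x p|)%:E = (mom x)%:E)%E.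
Proof.
move=> [mx x0 xp xi]; apply: conv1 => //.
- apply: measurable_funTS; apply: measurable_funM; first exact: measurable_funD.
  exact: measurableT_comp.
- by move=> p p0; rewrite xp// mulr0.
apply: aeW => p p0.
by rewrite (ger0_norm (x0 p)) /wt gtr0_norm.
Qed.

End solution.

(** * The constructed solution *)

(** What the construction delivers; the subsequence is no longer visible. *)
Record solves (R : realType) (D : coag_data R) (z : R -> R -> R) : Prop := Solves {
  sol_m : measurable_fun setT (fun x : R * R => z x.1 x.2);
  sol_conc : forall t T, 0 <= t <= T -> conc (z t) /\ mom (z t) <= bnd D T;
  sol_ge0 : forall t p, 0 <= z t p;
  sol_cont : forall T e, 0 <= T -> 0 < e -> exists2 h, 0 < h &
    forall s t, 0 <= s -> s <= t -> t <= T -> t - s <= h ->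
      bd_norm D (fun p => z t p - z s p) <= e;
  sol_coll : forall (w : R -> R) (W : R), measurable_fun setT w -> (forall p, `|w p| <= W) ->
    unif_cont (fun t => coll_term D w (z t));
  sol_src : forall (w : R -> R) (W : R), measurable_fun setT w -> (forall p, `|w p| <= W) ->
    unif_cont (fun t => src_term D w (z t));
  sol_weak : forall (w : R -> R) (W t : R), measurable_fun setT w -> (forall p, `|w p| <= W) -> 0 <= t ->
    ((test w (z t) - test w (zin D))%:E =
     (2^-1)%:E * \int[@lebesgue_measure R]_(s in `[0%R, t]) (coll_term D w (z s))%:E +
     \int[@lebesgue_measure R]_(s in `[0%R, t]) (src_term D w (z s))%:E)%E }.

Section existence.
Context (R : realType) (D : coag_data R).

Lemma solves_exists : uniform_tails D -> exists z, solves D z.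
Proof.
move=> tails; have [phi phi_ge phi_cauchy] := cauchy_subsequence tails.
exists (zeta D phi); split.
- exact: zeta_m.
- by move=> t T tT; exact: (zeta_conc phi_ge phi_cauchy tT).
- by move=> t p; exact: zeta_ge0.
- by move=> T e T0 e0; exact: (zeta_cont tails phi_ge phi_cauchy T0 e0).
- by move=> w W wm wW; exact: (coll_term_uc tails phi_ge phi_cauchy wm wW).
- by move=> w W wm wW; exact: (src_term_uc tails phi_ge phi_cauchy wm wW).
- by move=> w W t wm wW t0; exact: (weak_identity tails phi_ge phi_cauchy wm wW t0).
Qed.

Variable z : R -> R -> R.
Hypothesis sz : solves D z.

Lemma solves_conc t : 0 <= t -> conc (z t).
Proof. by move=> t0; have [] := sol_conc sz (t := t) (T := t); rewrite ?lexx ?t0. Qed.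

(** Continuity in the weighted norm admits test functions that grow like the weight. *)
Lemma weighted_uc (w : R -> R) (W : R) : measurable_fun setT w -> (forall p, `|w p| <= W * bd D p) ->
  unif_cont (fun t => \int[mu]_p (w p * z t p)).
Proof.
move=> wm wW T e T0 e0.
have W0 : 0 <= W.
  have := le_trans (normr_ge0 _) (wW 0); rewrite pmulr_lge0// (lt_le_trans ltr01)//.
  exact: bd_ge1.
have e1 : 0 < e / (W + 1) by rewrite divr_gt0// ltr_wpDl.
have [h h0 hh] := sol_cont sz T0 e1; exists h => // s t s0 st tT tsh.
have t0 := le_trans s0 st.
have b1 := conc_bd_integrable D (solves_conc t0); have b2 := conc_bd_integrable D (solves_conc s0).
have dom x : bd_integrable D x -> integ (fun p => w p * x p).
  move=> [xm xi]; apply: integ_le (integZ W xi) => [|p]; first exact: measurable_funM.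
  by rewrite normrM mulrA ler_wpM2r.
have [dm di] := bd_integrableB b1 b2.
rewrite -intB; [|exact: dom|exact: dom].
apply: (@le_trans _ _ (W * bd_norm D (fun p => z t p - z s p))); last first.
  rewrite (@le_trans _ _ (W * (e / (W + 1))))// ?ler_wpM2l ?hh//.
  by rewrite mulrCA ger_pMr// ler_pdivrMr ?mul1r ?lerDl// ltr_wpDl.
rewrite -intZ//; apply: int_abs_le.
- exact: integZ.
- exact: (integ_mfun (integB (dom _ b1) (dom _ b2))).
- by move=> p; rewrite -mulrBr normrM mulrA ler_wpM2r.
Qed.

End existence.

(** * The constructed solution solves the original problem *)

Section original_problem.
Context (R : realType) (D : coag_data R).

Variables (zin0 S0 Rm : R -> R) (K0 : R -> R -> R).
Hypothesis zin0_m : measurable_fun (Rpos R) zin0.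
Hypothesis zin0E : {ae mu, forall p, 0 < p -> zin0 p = zin D p}.
Hypothesis S0_m : measurable_fun (Rpos R) S0.
Hypothesis S0E : forall p, 0 < p -> S0 p = src D p.
Hypothesis Rm_m : measurable_fun (Rpos R) Rm.
Hypothesis RmE : forall p, 0 < p -> Rm p = rem D p.
Hypothesis K0_m : measurable_fun (Rpos R `*` Rpos R) (fun z : R * R => K0 z.1 z.2).
Hypothesis K0E : {ae mu, forall p, 0 < p -> {ae mu, forall q, 0 < q -> K0 p q = ker D p q}}.

Variable z : R -> R -> R.
Hypothesis sz : solves D z.

Lemma weighted_integ (w : R -> R) (W : R) (x : R -> R) : measurable_fun setT w ->
  (forall p, `|w p| <= W * wt p) -> conc x -> integ (fun p => w p * x p).
Proof. by move=> wm wW cx; exact: (conc_integ_le wm wW cx). Qed.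

Lemma weighted_conv (w w' : R -> R) (W : R) (x : R -> R) : measurable_fun (Rpos R) w ->
  measurable_fun setT w' -> (forall p, `|w' p| <= W * wt p) ->
  {ae mu, forall p, 0 < p -> w p = w' p} -> conc x ->
  (\int[mu]_(p in Rpos R) (w p * x p)%:E = (\int[mu]_p (w' p * x p))%:E)%E.
Proof.
move=> wm w'm w'W ww' cx; have [mx _ xp _] := cx.
apply: conv1.
- by apply: measurable_funM => //; exact: measurable_funTS.
- exact: weighted_integ w'm w'W cx.
- by move=> p p0; rewrite xp// mulr0.
by apply: aeS ww' => p h p0; rewrite h.
Qed.

Let collision_lty T : 0 < T ->
  (\int[mu]_(s in `[0%R, T]) \int[mu]_(p in Rpos R) \int[mu]_(q in Rpos R)
     (K0 p q * z s p * z s q)%:E < +oo)%E.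
Proof.
(* The test function -1 changes by 1 in every collision, so the collision term is
   the total collision rate. *)
move=> T0; pose m1 : R -> R := fun=> -1.
have m1m A : measurable_fun A m1 by exact: measurable_cst.
have m1W p : `|m1 p| <= 1 by rewrite /m1 normrN1.
rewrite (_ : integral _ _ _ = \int[mu]_(s in `[0%R, T]) (coll_term D m1 (z s))%:E)%E.
  by apply: integrable_lty => //; exact: (unif_cont_integrable T (sol_coll sz (m1m _) m1W)).
apply: eq_integral => s; rewrite inE/= in_itv/= => /andP[s0 _].
rewrite -(coll_conv (w := m1) K0_m K0E (solves_conc sz s0) (m1m _) (m1m _) m1W) //.
  apply: eq_integral => p _; apply: eq_integral => q _.
  by rewrite /wtilde /m1 subrr sub0r opprK mul1r.
by apply: aeW.
Qed.

Let removal_lty T : 0 < T ->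
  (\int[mu]_(s in `[0%R, T]) \int[mu]_(p in Rpos R) (Rm p * z s p)%:E < +oo)%E.
Proof.
move=> T0.
have remb p : `|rem D p| <= 1 * bd D p by rewrite mul1r ger0_norm ?rem_ge0 ?rem_le.
rewrite (_ : integral _ _ _ = \int[mu]_(s in `[0%R, T]) (\int[mu]_p (rem D p * z s p))%:E)%E.
  by apply: integrable_lty => //; exact: (unif_cont_integrable T (weighted_uc sz (rem_m D) remb)).
apply: eq_integral => s; rewrite inE/= in_itv/= => /andP[s0 _].
apply: (weighted_conv (W := cb D) Rm_m (rem_m D)).
- by move=> p; rewrite (le_trans (remb p))// mul1r bd_le.
- exact: aeW.
- exact: (solves_conc sz s0).
Qed.

Let weak_form t w : 0 <= t -> Linfty w -> weak_formulation K0 S0 Rm zin0 z w t.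
Proof.
move=> t0 wL; have [w' [W [w'm w'W ww']]] := Linfty_clamp wL.
have [wm _] := wL.
rewrite /weak_formulation (test_conv zin0_m zin0E (solves_conc sz t0) wm w'm w'W ww').
rewrite (sol_weak sz w'm w'W t0); congr (_ * _ + _)%E.
- apply: eq_integral => s; rewrite inE/= in_itv/= => /andP[s0 _].
  by rewrite -(coll_conv K0_m K0E (solves_conc sz s0) wm w'm w'W ww').
- apply: eq_integral => s; rewrite inE/= in_itv/= => /andP[s0 _].
  by rewrite -(src_conv S0_m S0E Rm_m RmE (solves_conc sz s0) wm w'm w'W ww').
Qed.

Lemma solves_weak_solution : weak_solution K0 S0 Rm zin0 z.
Proof.
split.
- exact: measurable_funTS (sol_m sz).
- by move=> t p _ _; exact: (sol_ge0 sz).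
- exact: collision_lty.
- exact: removal_lty.
- by move=> T T0 t /andP[t0 _] w wL; exact: weak_form.
Qed.

Lemma solves_Linfty T : 0 < T -> Linfty_L1_01 T z.
Proof.
move=> T0; split; first exact: measurable_funTS (sol_m sz).
exists (bnd D T); apply: aeW => t /=; rewrite in_itv/= => /andP[t0 tT].
have tT0 : 0 <= t <= T by rewrite !ltW.
have [cz le] := sol_conc sz tT0.
by rewrite mom_conv// lee_fin.
Qed.

Let weak_cont (a a' : R -> R) (W : R) : measurable_fun setT a' ->
  (forall p, `|a' p| <= W * wt p) -> (forall p, `|a' p| <= W * bd D p) ->
  (forall p, 0 < p -> a p = a' p) -> forall w, Linfty w ->
  {within `[0 : R, +oo[, continuous (fun t => \int[mu]_(p in Rpos R) (w p * a p * z t p))}.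
Proof.
move=> a'm a'wt a'bd aa' w wL; have [w' [V [w'm w'V ww']]] := Linfty_clamp wL.
have V0 : 0 <= V by exact: le_trans (w'V 0).
have [wm _] := wL.
have pm : measurable_fun setT (fun p => w' p * a' p) by exact: measurable_funM.
have dom (b : R -> R) : (forall p, `|a' p| <= W * b p) ->
    forall p, `|w' p * a' p| <= V * W * b p.
  by move=> a'b p; rewrite normrM -mulrA ler_pM.
apply: (@subspace_eq_continuous _ _ _ (fun t => \int[mu]_p (w' p * a' p * z t p))).
  move=> t; rewrite inE/= in_itv/= andbT => t0.
  rewrite -[LHS]/(fine (\int[mu]_p (w' p * a' p * z t p)%:E)) [RHS]/Rintegral.
  have am : measurable_fun (Rpos R) a.
    apply: (eq_measurable_fun a'); last exact: measurable_funTS.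
    by move=> p; rewrite RposE => p0; rewrite aa'.
  rewrite (weighted_conv (W := V * W) (measurable_funM wm am) pm (dom _ a'wt))//=.
    by apply: aeS ww' => p h p0; rewrite h// aa'.
  exact: (solves_conc sz t0).
apply: unif_cont_within; first exact: (weighted_uc sz pm (dom _ a'bd)).
by move=> t /=; rewrite in_itv/= andbT.
Qed.

Lemma solves_weakly_continuous_L1 : weakly_continuous_L1 z.
Proof.
split.
- move=> t t0; have zi := conc_integ (solves_conc sz t0).
  by apply: integrableS zi => //; exact: measurable_Rpos.
- move=> w wL.
  rewrite (_ : (fun t => _) = fun t => \int[mu]_(p in Rpos R) (w p * 1 * z t p)); last first.
    by apply/funext => t; apply: eq_Rintegral => p _; rewrite mulr1.
  apply: (weak_cont (a := fun=> 1) (a' := fun=> 1) (W := 1)) => // p;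
    by rewrite normr1 mul1r ?wt_ge1 ?bd_ge1.
Qed.

Lemma solves_weakly_continuous_L1_01 : (forall p, wt p <= bd D p) -> weakly_continuous_L1_01 z.
Proof.
move=> wb; split.
- move=> t t0; have [_ _ _ zi] := solves_conc sz t0.
  have zi' : mu.-integrable (Rpos R) (EFin \o (fun p => wt p * z t p)).
    by apply: integrableS zi => //; exact: measurable_Rpos.
  rewrite /L1_01; apply: eq_integrable zi'; first exact: measurable_Rpos.
  by move=> p; rewrite RposE => p0 /=; rewrite /wt gtr0_norm.
- apply: (weak_cont (a' := @wt R) (W := 1)) => [|p|p|p p0].
  + exact: measurable_wt.
  + by rewrite mul1r ger0_norm ?wt_ge0.
  + by rewrite mul1r ger0_norm ?wt_ge0.
  + by rewrite /wt gtr0_norm.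
Qed.

End original_problem.

(** * Conservation of mass for a linear kernel *)

Section mass.
Context (R : realType) (D : coag_data R).
Notation bd := (bd D).
Notation ker := (ker D).

Variable A : R.
Hypothesis A0 : 0 <= A.
Hypothesis wt_bd : forall p, wt p <= bd p.
Hypothesis ker_lin : forall p q, 0 < p -> 0 < q -> ker p q <= A * (1 + p + q).

(** Size, truncated at [2 * n] so that only collisions with a partner beyond [n] are
    noticed. *)
Definition cut (n : nat) (p : R) : R := Num.min `|p| (2 * n%:R).

Lemma cut_m n : measurable_fun setT (cut n).
Proof. by apply: measurable_minr => //; exact: normr_measurable. Qed.

Lemma cut_ge0 n p : 0 <= cut n p.
Proof. by rewrite /cut le_min normr_ge0 mulr_ge0. Qed.

Lemma cut_abs n p : cut n p <= `|p|.
Proof. by rewrite /cut ge_min lexx. Qed.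

Lemma cut_le n p : `|cut n p| <= 2 * n%:R.
Proof. by rewrite ger0_norm ?cut_ge0// /cut ge_min lexx orbT. Qed.

Lemma abs_le_wt (p : R) : `|p| <= wt p.
Proof. by rewrite /wt lerDr. Qed.

Lemma int_cut_cvg (x : R -> R) : conc x ->
  test (cut n) x @[n --> \oo] --> \int[mu]_p (`|p| * x p).
Proof.
move=> cx; have [mx x0 xp xi] := cx.
have cm n : measurable_fun setT (fun p : R => 1 - chi n%:R p).
  by apply: measurable_funB => //; exact: measurable_chi.
have c01 n (p : R) : 0 <= 1 - chi n%:R p <= 1 by rewrite chi_compl_ge0 chi_compl_le1.
have i1 : integ (fun p => `|p| * x p).
  apply: (conc_integ_le (c := 1)) cx => [|p]; first exact: normr_measurable.
  by rewrite normr_id mul1r abs_le_wt.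
have i2 n : integ (fun p => cut n p * x p).
  apply: (conc_integ_le (c := 1)) cx => [|p]; first exact: cut_m.
  by rewrite ger0_norm ?cut_ge0// mul1r (le_trans (cut_abs _ _))// abs_le_wt.
have f0 p : 0 <= wt p * x p by rewrite mulr_ge0 ?wt_ge0.
apply/cvgrPdist_le => e e0.
have [N hN] := int_vanish xi f0 cm c01 (@chi_vanish R) e0.
exists N => // n /= Nn; rewrite /test -intB// ger0_norm; last first.
  by apply: int_ge0 => p; rewrite -mulrBl mulr_ge0// subr_ge0 cut_abs.
apply: le_trans (hN n Nn); apply: int_le => [||p]; first exact: integB.
  apply: integ_le (xi) => [|p].
    by apply: measurable_funM; [exact: cm|exact: integ_mfun xi].
  by rewrite normrM (ger0_norm (chi_compl_ge0 _ _)) (ger0_norm (f0 _)) ler_piMl ?chi_compl_le1.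
have [p0|p0] := leP p 0; first by rewrite xp// !mulr0 subrr.
rewrite -mulrBl mulrA ler_wpM2r// /chi; case: (ltP p n%:R) => pn /=.
  rewrite subrr mul0r subr_le0 /cut le_min lexx/= gtr0_norm//.
  by rewrite (le_trans (ltW pn))// mulrDl mul1r lerDl.
by rewrite subr0 mul1r (le_trans _ (abs_le_wt p))// lerBlDr lerDl cut_ge0.
Qed.

Let arith (a b : R) : 0 <= a -> 0 <= b -> a <= b -> (1 + a + b) * a <= 2 * ((1 + a) * (1 + b)).
Proof.
move=> a0 b0 ab; have := mulr_ge0 a0 b0; have := ler_wpM2l a0 ab; nra.
Qed.

(** In a collision the truncated mass changes by at most the smaller size, and not at
    all when both sizes are below [n]. *)
Lemma cut_coll n p q : 0 < p -> 0 < q ->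
  `|coll_incr (cut n) (p, q)| * (1 + p + q) <=
  2 * (((1 - chi n%:R p) + (1 - chi n%:R q)) * (wt p * wt q)).
Proof.
wlog pq : p q / p <= q => [hw|] p0 q0.
  have [pq|/ltW qp] := leP p q; first by exact: (hw _ _ pq p0 q0).
  have := hw _ _ qp q0 p0.
  rewrite /coll_incr/= (addrC q p) (addrAC 1 q p) [X in 2 * (X * _)]addrC (mulrC (wt q)).
  by rewrite (addrAC (cut n (p + q))).
have r0 : 0 <= 2 * (((1 - chi n%:R p) + (1 - chi n%:R q)) * (wt p * wt q)).
  rewrite mulr_ge0//; apply: mulr_ge0; first by rewrite addr_ge0 ?chi_compl_ge0.
  by rewrite mulr_ge0 ?wt_ge0.
have [qn|nq] := ltP q n%:R.
  rewrite (_ : coll_incr _ _ = 0) ?normr0 ?mul0r//.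
  have pn := le_lt_trans pq qn.
  rewrite /coll_incr /cut /= !gtr0_norm ?addr_gt0// !min_l; [ring|..]; lra.
have wb : `|coll_incr (cut n) (p, q)| <= p.
  rewrite ler_norml /coll_incr /cut/= !gtr0_norm ?addr_gt0//.
  have : 0 <= n%:R :> R by [].
  case: (leP p (2 * n%:R)) => h1; case: (leP q (2 * n%:R)) => h2;
    case: (leP (p + q) (2 * n%:R)) => h3 h4; apply/andP; split; lra.
have c1 : 1 <= (1 - chi n%:R p) + (1 - chi n%:R q).
  rewrite {2}/chi ltNge nq/= subr0 lerDr; exact: chi_compl_ge0.
have a := arith (ltW p0) (ltW q0) pq.
apply: (@le_trans _ _ ((1 + p + q) * p)).
  by rewrite mulrC ler_wpM2l// !addr_ge0// ltW.
apply: le_trans a _; rewrite /wt !gtr0_norm// ler_wpM2l// ler_peMl//.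
by rewrite mulr_ge0// addr_ge0// ltW.
Qed.

Lemma coll_cut n x : conc x ->
  `|coll_term D (cut n) x| <= 4 * A * (bd_tail D n%:R x * bd_norm D x).
Proof.
move=> cx; have bx := conc_bd_integrable D cx; have [mx xi] := bx; have [_ x0 _ _] := cx.
have ti := integ_bd_tail n%:R bx.
have [t1 e1] := integ_tensor ti xi; have [t2 e2] := integ_tensor xi ti.
have -> : 4 * A * (bd_tail D n%:R x * bd_norm D x) =
  \int[mu2]_a (2 * A * ((1 - chi n%:R a.1) * (bd a.1 * `|x a.1|) * (bd a.2 * `|x a.2|) +
    (bd a.1 * `|x a.1|) * ((1 - chi n%:R a.2) * (bd a.2 * `|x a.2|)))).
  rewrite intZ; last exact: integD.
  rewrite intD// e1 e2 -/(bd_norm D x) -/(bd_tail D n%:R x); ring.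
have [i1 _] := form_le (ker_m D) (ker_ge0 D) (fun _ _ => lexx _)
  (coll_incr_m (cut_m n)) (coll_incr_le (cut_le n)) bx bx.
apply: int_abs_le.
- by apply: integZ; exact: integD.
- exact: (integ_mfun i1).
move=> [p q] /=; rewrite !normrM (ger0_norm (ker_ge0 _ _ _)).
rewrite [leRHS](_ : _ = 2 * A * (((1 - chi n%:R p) + (1 - chi n%:R q)) * (bd p * bd q)) *
  (`|x p| * `|x q|)); last by ring.
rewrite mulrA ler_wpM2r ?mulr_ge0//.
have r0 : 0 <= ((1 - chi n%:R p) + (1 - chi n%:R q)) by rewrite addr_ge0 ?chi_compl_ge0.
have rr : 0 <= 2 * A * (((1 - chi n%:R p) + (1 - chi n%:R q)) * (bd p * bd q)).
  by rewrite mulr_ge0 ?mulr_ge0 ?bd_ge0.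
have [p0|p0] := leP p 0; first by rewrite ker_pos// mulr0.
have [q0|q0] := leP q 0; first by rewrite ker_pos2// mulr0.
apply: (@le_trans _ _ (`|coll_incr (cut n) (p, q)| * (A * (1 + p + q)))).
  by rewrite ler_wpM2l// ker_lin.
rewrite mulrCA (mulrC 2) -(mulrA A) ler_wpM2l//.
apply: le_trans (cut_coll n p0 q0) _.
by rewrite ler_wpM2l// ler_wpM2l// ler_pM ?wt_ge0.
Qed.

Variable z : R -> R -> R.
Hypothesis sz : solves D z.
Hypothesis rem_i : forall s, 0 <= s -> integ (fun p => `|p| * (rem D p * z s p)).
Hypothesis balance : forall s, 0 <= s ->
  \int[mu]_p (`|p| * src D p) = \int[mu]_p (`|p| * (rem D p * z s p)).

Let rem_conc s : 0 <= s -> conc (fun p => rem D p * z s p).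
Proof.
move=> s0; have cz := solves_conc sz s0; have [mz z0 zp _] := cz.
split.
- by apply: measurable_funM => //; exact: rem_m.
- by move=> p; rewrite mulr_ge0// rem_ge0.
- by move=> p p0; rewrite zp// mulr0.
have i1 : integ (fun p => rem D p * z s p).
  apply: (conc_integ_le (c := cb D)) cz => [|p]; first exact: rem_m.
  by rewrite ger0_norm ?rem_ge0// (le_trans (rem_le _ _))// bd_le.
by apply: integ_ext (integD i1 (rem_i s0)) => p; rewrite /wt; ring.
Qed.

Let src_cut n s : 0 <= s ->
  src_term D (cut n) (z s) = test (cut n) (src D) - test (cut n) (fun p => rem D p * z s p).
Proof.
move=> s0; have b := conc_bd_integrable D (rem_conc s0).
rewrite /test -intB; last 2 first.
- exact: (src_integ D (cut_m n) (cut_le n)).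
- exact: (test_integ (cut_m n) (cut_le n) b).
by apply: eq_int => p; rewrite mulrBr.
Qed.

Let test_cut_le n x : conc x -> 0 <= test (cut n) x <= \int[mu]_p (`|p| * x p).
Proof.
move=> cx; have [mx x0 xp xi] := cx.
rewrite int_ge0 => [|p]; last by rewrite mulr_ge0 ?cut_ge0.
apply: int_le => [||p].
- exact: (test_integ (cut_m n) (cut_le n) (conc_bd_integrable D cx)).
- apply: (conc_integ_le (c := 1)) cx => [|p]; first exact: normr_measurable.
  by rewrite normr_id mul1r abs_le_wt.
- by rewrite ler_wpM2r// cut_abs.
Qed.

Let vanish_itv (f : nat -> R -> R) (t C : R) : 0 <= t ->
  (forall n, unif_cont (f n)) -> (forall n s, 0 <= s <= t -> `|f n s| <= C) ->
  (forall s, 0 <= s -> f n s @[n --> \oo] --> (0 : R)) ->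
  (\int[mu]_(s in `[0%R, t]) (f n s)%:E @[n --> \oo] --> 0)%E.
Proof.
move=> t0 fu fC f0.
have <- : (\int[mu]_(s in `[0%R, t]) cst 0%:E s = 0)%E by rewrite integral0_eq.
apply: (@dominated_cvg _ _ _ mu _ _ (fun n s => (f n s)%:E) _ (fun=> C%:E)) => //.
- by move=> n; exact: (measurable_int mu (unif_cont_integrable t (fu n))).
- move=> s /=; rewrite in_itv/= => /andP[s0 _].
  by apply: cvg_EFin; [exact: nearW|exact: f0].
- apply: (unif_cont_integrable t (f := fun=> C)) => T e T0 e0; exists 1 => // *.
  by rewrite subrr normr0 ltW.
Qed.

(** In the weak identity for [cut n], the collision terms tend to 0 because of the
    tails, the source terms because source and removal balance at every time. *)
Lemma mass_conservation t : 0 <= t ->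
  \int[mu]_p (`|p| * z t p) = \int[mu]_p (`|p| * zin D p).
Proof.
move=> t0; have ct := solves_conc sz t0.
have s_conc s : 0 <= s -> conc (z s) by exact: (solves_conc sz).
have c1 : (\int[mu]_(s in `[0%R, t]) (coll_term D (cut n) (z s))%:E @[n --> \oo] --> 0)%E.
  pose B := cb D * bnd D t.
  apply: (vanish_itv (C := 4 * A * (B * B))) => //.
  - by move=> n; exact: (sol_coll sz (cut_m n) (cut_le n)).
  - move=> n s st; have [cs ms] := sol_conc sz st.
    have bs : bd_norm D (z s) <= B.
      by rewrite (le_trans (bd_norm_mom D cs))// ler_wpM2l// cb_ge0.
    have ts : bd_tail D n%:R (z s) <= B.
      apply: le_trans bs; apply: int_le; [exact: integ_bd_tail (conc_bd_integrable D cs)|by case: (conc_bd_integrable D cs)|].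
      by move=> p; rewrite ler_piMl ?mulr_ge0 ?bd_ge0 ?chi_compl_le1.
    rewrite (le_trans (coll_cut n cs))// ler_wpM2l ?mulr_ge0// ler_pM ?bd_tail_ge0//.
    by apply: int_ge0 => p; rewrite mulr_ge0 ?bd_ge0.
  - move=> s s0; have [_ bi] := conc_bd_integrable D (s_conc s s0).
    have b0 : 0 <= 4 * A * bd_norm D (z s).
      by rewrite mulr_ge0 ?mulr_ge0//; apply: int_ge0 => p; rewrite mulr_ge0 ?bd_ge0.
    apply/cvgr0Pnorm_le => e e0.
    have e1 : 0 < e / (4 * A * bd_norm D (z s) + 1) by rewrite divr_gt0// ltr_wpDl.
    have g0 p : 0 <= bd p * `|z s p| by rewrite mulr_ge0 ?bd_ge0.
    have cm n : measurable_fun setT (fun p : R => 1 - chi n%:R p).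
      by apply: measurable_funB => //; exact: measurable_chi.
    have c01 n (p : R) : 0 <= 1 - chi n%:R p <= 1 by rewrite chi_compl_ge0 chi_compl_le1.
    have [N hN] := int_vanish bi g0 cm c01 (@chi_vanish R) e1.
    exists N => // n /= Nn; apply: le_trans (coll_cut n (s_conc s s0)) _.
    rewrite [bd_tail _ _ _ * _]mulrC mulrA.
    apply: le_trans (ler_wpM2l b0 (hN n Nn)) _.
    by rewrite mulrCA ger_pMr// ler_pdivrMr ?mul1r ?lerDl// ltr_wpDl.
have c2 : (\int[mu]_(s in `[0%R, t]) (src_term D (cut n) (z s))%:E @[n --> \oo] --> 0)%E.
  apply: (vanish_itv (C := \int[mu]_p (`|p| * src D p))) => //.
  - by move=> n; exact: (sol_src sz (cut_m n) (cut_le n)).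
  - move=> n s /andP[s0 _]; rewrite src_cut//.
    have /andP[a1 a2] := test_cut_le n (src_conc D).
    have /andP[b1 b2] := test_cut_le n (rem_conc s0).
    rewrite -balance// in b2; rewrite ler_norml; lra.
  - move=> s s0; under eq_fun do rewrite src_cut//.
    have := cvgB (int_cut_cvg (src_conc D)) (int_cut_cvg (rem_conc s0)).
    by rewrite -(balance s0) subrr; exact.
have isd : ((2^-1)%:E * 0 +? (0 : \bar R))%E by rewrite mule0.
have c3 : (test (cut n) (z t) - test (cut n) (zin D))%:E @[n --> \oo] --> 0%:E.
  under eq_fun do rewrite (sol_weak sz (cut_m _) (cut_le _) t0).
  have := cvgeD (a := ((2^-1)%:E * 0)%E) (b := 0%E) isd (cvgeZl (y := (2^-1)%:E) isT c1) c2.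
  by rewrite mule0 adde0; exact.
have c4 : test (cut n) (z t) - test (cut n) (zin D) @[n --> \oo] -->
    \int[mu]_p (`|p| * z t p) - \int[mu]_p (`|p| * zin D p).
  by apply: cvgB; apply: int_cut_cvg => //; exact: zin_conc.
apply/eqP; rewrite -subr_eq0; apply/eqP.
apply: (cvg_unique _ c4); first exact: Rhausdorff.
exact: (fine_cvg c3).
Qed.

End mass.

(** * The input, and the data of class I *)

Section input.
Context (R : realType).

Lemma L1_01_m (g : R -> R) : L1_01 g -> measurable_fun (Rpos R) g.
Proof.
move=> gi; have mg : measurable_fun (Rpos R) (fun p => (1 + p) * g p).
  by apply/measurable_EFinP; exact: (measurable_int mu gi).
apply: (eq_measurable_fun (fun p => wt p `^ (-1) * ((1 + p) * g p))).
  move=> p; rewrite RposE => p0; rewrite powR_inv1 ?wt_ge0// /wt gtr0_norm//.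
  by rewrite mulKf// gt_eqF// addr_gt0.
apply: measurable_funM => //; apply: measurable_funTS.
by apply: (measurableT_comp (measurable_powR _)); exact: measurable_wt.
Qed.

(** Truncating at zero changes an almost everywhere nonnegative function only on
    a null set. *)
Definition pospart (g : R -> R) : R -> R := (fun p => Num.max 0 (g p)) \_ (Rpos R).

Lemma pospartE g p : 0 < p -> 0 <= g p -> pospart g p = g p.
Proof. by move=> p0 g0; rewrite /pospart patchE RposE p0 max_r. Qed.

Lemma pospart_conc g : L1_01 g -> conc (pospart g).
Proof.
move=> gi; have gm := L1_01_m gi.
have pm : measurable_fun setT (pospart g).
  rewrite /pospart; apply: (measurable_restrictT _ (@measurable_Rpos R)).1.
  by apply: measurable_maxr => //; exact: measurable_cst.
split=> //.
- by move=> p; rewrite /pospart patchE; case: ifP => // _; rewrite le_max lexx.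
- by move=> p p0; rewrite /pospart patchE RposE ltNge p0.
have gi' : integ ((fun p => (1 + p) * g p) \_ (Rpos R)).
  rewrite (_ : EFin \o _ = (fun p => ((1 + p) * g p)%:E) \_ (Rpos R)).
    by apply: (integrable_mkcond _ _).1; [exact: measurable_Rpos|exact: gi].
  by apply/funext => p /=; rewrite !patchE; case: ifP.
apply: integ_le (integ_abs gi') => [|p].
  by apply: measurable_funM => //; exact: measurable_wt.
rewrite /pospart !patchE RposE; case: ltP => p0; last by rewrite mulr0 normr0.
rewrite !normrM /wt (gtr0_norm p0) ler_wpM2l//.
by case: (leP 0 (g p)) => // _; rewrite normr0.
Qed.

Lemma ae_neq (a : R) : {ae mu, forall p, p <> a}.
Proof.
exists [set a]; split; [exact: measurable_set1|exact: lebesgue_measure_set1|].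
by move=> p /= /contrapT.
Qed.

Definition pos (p : R) : R := (0 < p)%R%:R.

Lemma pos_m : measurable_fun setT pos.
Proof.
rewrite (_ : pos = \1_(Rpos R)); first by apply: measurable_indic; exact: measurable_Rpos.
by apply/funext => p; rewrite /pos indicE RposE.
Qed.

Lemma pos_ge0 p : 0 <= pos p.
Proof. exact: ler0n. Qed.

Lemma pos_le1 p : pos p <= 1.
Proof. by rewrite /pos lern1 leq_b1. Qed.

Lemma posT p : 0 < p -> pos p = 1.
Proof. by rewrite /pos => ->. Qed.

Lemma posF p : p <= 0 -> pos p = 0.
Proof. by rewrite /pos ltNge => ->. Qed.

End input.

Section linear_kernel.
Context (R : realType).
Variables (z0 s0 r0 : R -> R) (A k : R).
Hypothesis z0_conc : conc z0.
Hypothesis s0_conc : conc s0.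
Hypothesis r0_m : measurable_fun setT r0.
Hypothesis r0_ge0 : forall p, 0 <= r0 p.
Hypothesis r0_pos : forall p, p <= 0 -> r0 p = 0.
Hypothesis r0_le : forall p, r0 p <= k * wt p.
Hypothesis k0 : 0 <= k.
Hypothesis A0 : 0 <= A.

Definition lin_ker (p q : R) : R := pos p * pos q * (A * Num.max 1 (p + q)).
Definition lin_bd (p : R) : R := (1 + A + k) * wt p.
Definition lin_sa (i : bool) (p : R) : R := pos p * (if i then A * p else A).
Definition lin_sb (i : bool) (q : R) : R := if i then 1 else `|q|.

Lemma lin_ker_le_sum p q : 0 < p -> 0 < q -> lin_ker p q <= A * (1 + p + q).
Proof.
move=> p0 q0; rewrite /lin_ker !posT// !mul1r ler_wpM2l//.
by rewrite ge_max -addrA lerDl lerDr ler01 addr_ge0// ltW.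
Qed.

Let wt_le_bd p : wt p <= lin_bd p.
Proof. by rewrite ler_peMl ?wt_ge0// -addrA lerDl addr_ge0. Qed.

Let lin_ker_m : measurable_fun setT (fun x : R * R => lin_ker x.1 x.2).
Proof.
apply: measurable_funM.
  apply: measurable_funM; [apply: measurable_fst|apply: measurable_snd]; exact: pos_m.
apply: measurable_funM => //; apply: measurable_maxr => //.
exact: (measurable_sum2 (f := id)).
Qed.

Let lin_ker_ge0 p q : 0 <= lin_ker p q.
Proof.
by rewrite mulr_ge0 ?mulr_ge0 ?pos_ge0// le_max ler01.
Qed.

Let lin_ker_le p q : lin_ker p q <= lin_bd p * lin_bd q.
Proof.
have [p0|p0] := leP p 0.
  by rewrite /lin_ker posF// !mul0r mulr_ge0// (le_trans _ (wt_le_bd _))// wt_ge0.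
have [q0|q0] := leP q 0.
  by rewrite /lin_ker (posF q0) mulr0 mul0r mulr_ge0// (le_trans _ (wt_le_bd _))// wt_ge0.
apply: le_trans (lin_ker_le_sum p0 q0) _.
apply: (@le_trans _ _ ((1 + A + k) * wt p * wt q)); last first.
  by rewrite ler_wpM2l// mulr_ge0 ?wt_ge0// !addr_ge0.
rewrite -mulrA ler_pM//.
- by rewrite !addr_ge0// ltW.
- by rewrite -addrA addrCA lerDl addr_ge0.
have pq := mulr_gt0 p0 q0; rewrite /wt !gtr0_norm//; nra.
Qed.

Let lin_ker_sep p q : 1 <= q ->
  lin_ker p q = lin_sa true p * lin_sb true q + lin_sa false p * lin_sb false q.
Proof.
move=> q1; have q0 : 0 < q by rewrite (lt_le_trans ltr01).
rewrite /lin_ker /lin_sa /lin_sb; have [p0|p0] := leP p 0.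
  by rewrite (posF p0) !mul0r addr0.
rewrite !posT// gtr0_norm// max_r; first by ring.
by rewrite (le_trans q1)// lerDr ltW.
Qed.

Let lin_sa_ge0 i p : 0 <= lin_sa i p.
Proof.
rewrite /lin_sa; have [p0|p0] := leP p 0; first by rewrite posF// mul0r.
by rewrite mulr_ge0 ?pos_ge0//; case: i => //; rewrite mulr_ge0// ltW.
Qed.

Let lin_sa_le i p : lin_sa i p <= lin_bd p.
Proof.
have [p0|p0] := leP p 0.
  by rewrite /lin_sa posF// mul0r (le_trans _ (wt_le_bd _))// wt_ge0.
rewrite /lin_sa posT// mul1r /lin_bd /wt gtr0_norm//.
have a := mulr_ge0 A0 (ltW p0); have b := mulr_ge0 k0 (ltW p0).
by case: i; nra.
Qed.

Definition linear_data : coag_data R.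
Proof.
refine (@CoagData R z0 s0 r0 lin_ker lin_bd (1 + A + k) lin_sa lin_sb
  z0_conc s0_conc r0_m r0_ge0 r0_pos _ lin_ker_m lin_ker_ge0 _ _ lin_ker_le _ _ _
  lin_ker_sep lin_sa_ge0 lin_sa_le _ _ _).
- move=> p; apply: le_trans (r0_le p) _; rewrite ler_wpM2r ?wt_ge0//.
  by rewrite lerDr addr_ge0.
- by move=> p q; rewrite /lin_ker [pos p * _]mulrC [p + q]addrC.
- by move=> p q p0; rewrite /lin_ker posF// !mul0r.
- by apply: measurable_funM => //; exact: measurable_wt.
- by move=> p; apply: le_trans (wt_le_bd p); exact: wt_ge1.
- by [].
- by case; rewrite /lin_sb; [exact: measurable_cst|exact: normr_measurable].
- by move=> [|] p; rewrite /lin_sb ?ler01 ?normr_ge0.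
- move=> [|] p; apply: le_trans (wt_le_bd p); first exact: wt_ge1.
  by rewrite /wt lerDr.
Defined.

End linear_kernel.

(** * The data of class II *)

Section product_kernel.
Context (R : realType).
Variables (z0 s0 r0 e : R -> R) (A k U alpha : R).
Hypothesis z0_conc : conc z0.
Hypothesis s0_conc : conc s0.
Hypothesis r0_m : measurable_fun setT r0.
Hypothesis r0_ge0 : forall p, 0 <= r0 p.
Hypothesis r0_pos : forall p, p <= 0 -> r0 p = 0.
Hypothesis r0_le : forall p, r0 p <= k * wt p `^ alpha.
Hypothesis k0 : 0 <= k.
Hypothesis alpha_lt1 : 0 <= alpha < 1.
Hypothesis A0 : 0 <= A.
Hypothesis e_m : measurable_fun setT e.
Hypothesis e_ge1 : forall p, 1 <= e p.
Hypothesis e_le : forall p, e p <= U * wt p.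
Hypothesis e_sub : forall d, 0 < d -> exists2 Q, 0 <= Q & forall p, Q <= p -> e p <= d * wt p.

Definition prod_ker (p q : R) : R := pos p * pos q * (A * (e p * e q)).
Definition prod_bd (p : R) : R := (1 + A + k) * (e p + wt p `^ alpha).
Definition prod_sa (i : bool) (p : R) : R := if i then pos p * (A * e p) else 0.
Definition prod_sb (i : bool) (q : R) : R := if i then e q else 0.

Let e_ge0 p : 0 <= e p. Proof. exact: le_trans (e_ge1 p). Qed.
Let c0 : 0 <= 1 + A + k. Proof. by rewrite !addr_ge0. Qed.
Let c1 : 1 <= 1 + A + k. Proof. by rewrite -addrA lerDl addr_ge0. Qed.
Let cA : A <= 1 + A + k. Proof. by rewrite addrAC lerDr addr_ge0. Qed.

Let e_le_bd p : (1 + A + k) * e p <= prod_bd p.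
Proof. by rewrite ler_wpM2l// lerDl powR_ge0. Qed.

Let e_le_bd1 p : e p <= prod_bd p.
Proof. by apply: le_trans (e_le_bd p); rewrite ler_peMl. Qed.

Let bd0 p : 0 <= prod_bd p. Proof. exact: le_trans (e_le_bd1 p). Qed.

Let Ae_le p : A * e p <= prod_bd p.
Proof. by apply: le_trans (e_le_bd p); rewrite ler_wpM2r. Qed.

Let ker_m : measurable_fun setT (fun x : R * R => prod_ker x.1 x.2).
Proof.
apply: measurable_funM.
  apply: measurable_funM; [apply: measurable_fst|apply: measurable_snd]; exact: pos_m.
apply: measurable_funM => //; apply: measurable_funM;
  [exact: measurable_fst|exact: measurable_snd].
Qed.

Let ker_ge0 p q : 0 <= prod_ker p q.
Proof. by rewrite mulr_ge0 ?mulr_ge0 ?pos_ge0// mulr_ge0. Qed.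

Let ker_le p q : prod_ker p q <= prod_bd p * prod_bd q.
Proof.
apply: (@le_trans _ _ (1 * (A * (e p * e q)))).
  rewrite ler_wpM2r ?mulr_ge0// mulr_ile1 ?pos_ge0 ?pos_le1//.
by rewrite mul1r mulrA ler_pM// mulr_ge0.
Qed.

Let wt_pow_le p : wt p `^ alpha <= wt p.
Proof. by case/andP: alpha_lt1 => _ /ltW; apply: ler1_powR; exact: wt_ge1. Qed.

Definition product_data : coag_data R.
Proof.
refine (@CoagData R z0 s0 r0 prod_ker prod_bd ((1 + A + k) * (U + 1)) prod_sa prod_sb
  z0_conc s0_conc r0_m r0_ge0 r0_pos _ ker_m ker_ge0 _ _ ker_le _ _ _
  _ _ _ _ _ _).
- move=> p; apply: le_trans (r0_le p) _; apply: ler_pM; rewrite ?powR_ge0//.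
    by rewrite lerDr addr_ge0.
  by rewrite lerDr.
- by move=> p q; rewrite /prod_ker [pos p * _]mulrC [e p * _]mulrC.
- by move=> p q p0; rewrite /prod_ker posF// !mul0r.
- apply: measurable_funM => //; apply: measurable_funD => //.
  by apply: (measurableT_comp (measurable_powR _)); exact: measurable_wt.
- by move=> p; apply: le_trans (e_le_bd1 p).
- move=> p; rewrite /prod_bd -mulrA ler_wpM2l// mulrDl mul1r lerD//.
- move=> p q q1; rewrite /prod_ker (posT (lt_le_trans ltr01 q1)) /prod_sa /prod_sb.
  by ring.
- by move=> [|] p; rewrite /prod_sa ?mulr_ge0 ?pos_ge0// mulr_ge0.
- move=> [|] p; rewrite /prod_sa//; apply: le_trans (Ae_le p).
  by rewrite ler_piMl ?pos_le1// mulr_ge0.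
- by case; rewrite /prod_sb; [exact: e_m|exact: measurable_cst].
- by move=> [|] p; rewrite /prod_sb.
- by move=> [|] p; rewrite /prod_sb.
Defined.

(** Both summands of the weight are small compared with [wt] at infinity. *)
Lemma product_sublinear d : 0 < d ->
  exists2 Q, 0 <= Q & forall p, Q <= p -> bd product_data p <= d * wt p.
Proof.
move=> d0; case/andP: alpha_lt1 => a0 a1; have b0 : 0 < 1 - alpha by rewrite subr_gt0.
have cp : 0 < 1 + A + k by rewrite (lt_le_trans ltr01).
pose d' := d / (1 + A + k) / 2; have d'0 : 0 < d' by rewrite !divr_gt0.
have [Q Q0 eQ] := e_sub d'0.
pose P := d'^-1 `^ (1 - alpha)^-1.
exists (Num.max Q P) => [|p]; first by rewrite le_max Q0.
rewrite ge_max => /andP[Qp Pp].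
have P0 : 0 <= P by exact: powR_ge0.
have wp : wt p `^ alpha <= d' * wt p.
  have w0 : 0 < wt p by rewrite (lt_le_trans ltr01) ?wt_ge1.
  have Pw : P <= wt p by rewrite (le_trans Pp)// (le_trans (ler_norm p))// /wt lerDr.
  have h : d'^-1 <= wt p `^ (1 - alpha).
    have := ge0_ler_powR (ltW b0) P0 (ltW w0) Pw.
    by rewrite /P -powRrM mulVf ?gt_eqF// powRr1// invr_ge0 ltW.
  have wE : wt p = wt p `^ alpha * wt p `^ (1 - alpha).
    rewrite -powRD; last by rewrite (gt_eqF w0) implybT.
    by rewrite subrKC powRr1// ltW.
  rewrite [in leRHS]wE mulrCA ler_peMr ?powR_ge0//.
  apply: (@le_trans _ _ (d' * d'^-1)); first by rewrite mulfV ?lt0r_neq0.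
  by rewrite ler_wpM2l// ltW.
rewrite /= /prod_bd.
apply: (@le_trans _ _ ((1 + A + k) * (d' * wt p + d' * wt p))).
  by rewrite ler_wpM2l// lerD// eQ.
rewrite -mulrDl mulrA ler_wpM2r ?wt_ge0// /d' -splitr.
by rewrite mulrC divfK// gt_eqF.
Qed.

End product_kernel.

(** On [(1, +oo)] the profile of a nonzero product kernel is a section of that
    kernel, which is how it inherits measurability. *)
Lemma class_II_profile (R : realType) (K : R -> R -> R) :
  measurable_fun (Rpos R `*` Rpos R) (fun z : R * R => K z.1 z.2) -> class_II K ->
  exists (A U : R) (e : R -> R),
  [/\ 0 <= A, measurable_fun setT e, forall p, 1 <= e p,
      (forall p, e p <= U * wt p) /\
      (forall d, 0 < d -> exists2 Q, 0 <= Q & forall p, Q <= p -> e p <= d * wt p) &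
      forall p q, 0 < p -> 0 < q -> p <> 1 -> q <> 1 -> K p q = A * (e p * e q)].
Proof.
move=> Km [A [eta [A0 eta1 [U0 etaU] eta_sub KE]]].
have [Az|An] := eqVneq A 0.
  exists 0, 1, (fun=> 1); split => //.
    split=> [p|d d0]; first by rewrite mul1r wt_ge1.
    exists d^-1 => [|p dp]; first by rewrite invr_ge0 ltW.
    have p0 : 0 < p by rewrite (lt_le_trans _ dp)// invr_gt0.
    rewrite -ler_pdivrMl// mulr1 (le_trans dp)// (le_trans (ler_norm _))//.
    by rewrite /wt lerDr.
  move=> p q p0 q0 p1 q1; have [] := KE p q p0 q0; rewrite Az !mul0r.
  have /eqP/lt_total := p1; have /eqP/lt_total := q1.
  by move=> /orP[] hq /orP[] hp h1 h2 h3 h4; [exact: h1|exact: h3|exact: h2|exact: h4].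
have Ap : 0 < A by rewrite lt_neqAle eq_sym An.
pose e (p : R) := if p <= 1 then 1 else eta p.
pose F := (fun z : R * R => K z.1 z.2) \_ (Rpos R `*` Rpos R).
have Fm : measurable_fun setT F by exact: measurable_RposX.
have h0 : 0 < 2^-1 :> R by rewrite invr_gt0.
have h1 : 2^-1 < 1 :> R by rewrite invf_lt1// ltr1n.
have eE : e = fun p => if p <= 1 then 1 else A^-1 * F (2^-1, p).
  apply/funext => p; rewrite /e; case: (leP p 1) => // p1.
  have p0 : 0 < p by rewrite (lt_trans ltr01).
  rewrite /F patchE in_setX/= !RposE h0 p0/=.
  by have [_ -> // _ _] := KE _ _ h0 p0; rewrite mulKf.
have em : measurable_fun setT e.
  rewrite eE; apply: measurable_fun_ifT => //; first exact: measurable_fun_ler.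
  apply: measurable_funM => //; exact: (measurableT_comp Fm (pair1_measurable _)).
have e1 p : 1 <= e p by rewrite /e; case: (leP p 1) => // p1; apply/eta1/(lt_trans ltr01 p1).
exists A, (1 + `|U0|), e; split => //.
  split=> [p|d d0].
    rewrite /e; case: (leP p 1) => p1.
      by rewrite (le_trans (wt_ge1 p))// ler_peMl ?wt_ge0// lerDl.
    have p0 : 0 < p by rewrite (lt_trans ltr01).
    have /etaU : [set eta p / (1 + p) | p in `[1, +oo[] (eta p / (1 + p)).
      by exists p => //=; rewrite in_itv/= andbT ltW.
    rewrite ler_pdivrMr ?addr_gt0// /wt (gtr0_norm p0) => /le_trans; apply.
    rewrite ler_wpM2r ?addr_ge0 ?(ltW p0)//.
    by rewrite (le_trans (ler_norm _))// lerDr.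
  have := cvgr_le _ eta_sub _ d0 => /= -[Q [_ hQ]].
  exists (Num.max 2 (Q + 1)) => [|p]; first by rewrite le_max ler0n.
  rewrite ge_max => /andP[p2 Qp].
  have p1 : 1 < p by rewrite (lt_le_trans _ p2)// ltr1n.
  have p0 : 0 < p by rewrite (lt_trans ltr01).
  rewrite /e (leNgt p 1) p1/=.
  have := hQ p; rewrite (lt_le_trans _ Qp) ?ltrDl// => /(_ isT).
  rewrite ler_pdivrMr// => /le_trans; apply.
  by rewrite ler_wpM2l ?(ltW d0)// /wt gtr0_norm// lerDr.
move=> p q p0 q0 p1 q1; have [k1 k2 k3 k4] := KE p q p0 q0.
have e_lt x : x < 1 -> e x = 1 by move=> x1; rewrite /e ltW.
have e_gt x : 1 < x -> e x = eta x by move=> x1; rewrite /e (leNgt x 1) x1.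
have /eqP/lt_total/orP[hp|hp] := p1; have /eqP/lt_total/orP[hq|hq] := q1.
- by rewrite k1// !e_lt// !mulr1.
- by rewrite k2// e_lt// e_gt// mul1r.
- by rewrite k3// e_gt// e_lt// mulr1.
- by rewrite k4// !e_gt// mulrA.
Qed.

(** * Existence and conservation of mass *)

(** Integrability of the removed mass comes for free: its integral equals that of
    the source, which is finite. *)
Lemma balanced_removal (R : realType) (D : coag_data R) (S Rm z : R -> R) :
  measurable_fun (Rpos R) S -> (forall p, 0 < p -> S p = src D p) ->
  measurable_fun (Rpos R) Rm -> (forall p, 0 < p -> Rm p = rem D p) -> conc z ->
  (\int[@lebesgue_measure R]_(p in Rpos R) (p * S p)%:E
   = \int[@lebesgue_measure R]_(p in Rpos R) (p * Rm p * z p)%:E)%E ->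
  (@lebesgue_measure R).-integrable setT (EFin \o (fun p => `|p| * (rem D p * z p))) /\
  \int[@lebesgue_measure R]_p (`|p| * src D p) =
  \int[@lebesgue_measure R]_p (`|p| * (rem D p * z p)).
Proof.
move=> Sm SE Rmm RmE cz bal; have [mz z0 zp zi] := cz.
have am (B : set R) : measurable_fun B (fun p : R => `|p|) by exact: normr_measurable.
have aW (p : R) : `| `|p| | <= 1 * wt p by rewrite normr_id mul1r abs_le_wt.
have si := conc_integ_le (am _) aW (src_conc D).
have sE : (\int[mu]_(p in Rpos R) (p * S p)%:E = (\int[mu]_p (`|p| * src D p))%:E)%E.
  have [_ _ sp _] := src_conc D.
  apply: conv1 => //; first exact: measurable_funM.
    by move=> p p0; rewrite sp// mulr0.
  by apply: aeW => p p0; rewrite SE// gtr0_norm.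
have fm : measurable_fun setT (fun p : R => `|p| * (rem D p * z p)).
  by apply: measurable_funM => //; apply: measurable_funM => //; exact: rem_m.
have f0 p : 0 <= `|p| * (rem D p * z p) by rewrite mulr_ge0// mulr_ge0// rem_ge0.
have rE : (\int[mu]_(p in Rpos R) (p * Rm p * z p)%:E =
    \int[mu]_p (`|p| * (rem D p * z p))%:E)%E.
  rewrite integral_mkcond; apply: eq_integral => p _; rewrite patchE RposE.
  case: ltP => p0; last by rewrite zp// !mulr0.
  by rewrite RmE// gtr0_norm// mulrA.
have ri : mu.-integrable setT (EFin \o (fun p => `|p| * (rem D p * z p))).
  apply/integrableP; split; first exact/measurable_EFinP.
  rewrite (_ : integral _ _ _ = (\int[mu]_p (`|p| * src D p))%:E)%E ?ltry//.
  rewrite -sE bal rE; apply: eq_integral => p _ /=.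
  by rewrite ger0_norm.
split=> //; apply: EFin_inj; rewrite -sE bal rE.
by rewrite EFin_int.
Qed.

Theorem theorem2p1 (R : realType) (zin S Rm : R -> R) (K : R -> R -> R)
  (k alpha : R)
  (zin_L1 : L1_01 zin)
  (zin_ge0 : {ae @lebesgue_measure R, forall p : R, Rpos R p -> 0 <= zin p})
  (S_ge0 : forall p : R, 0 < p -> 0 <= S p)
  (S_exp : exponentially_decreasing S)
  (S_L1 : L1_01 S)
  (k_ge0 : 0 <= k) (alpha_bnd : 0 <= alpha < 1)
  (Rm_meas : measurable_fun (Rpos R) Rm)
  (Rm_ge0 : forall p : R, 0 < p -> 0 <= Rm p)
  (Rm_le : forall p : R, 0 < p -> Rm p <= k * (1 + p) `^ alpha)
  (K_meas : measurable_fun (Rpos R `*` Rpos R) (fun z : R * R => K z.1 z.2))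
  (K_ge0 : forall p q : R, 0 < p -> 0 < q -> 0 <= K p q)
  (K_sym : forall p q : R, 0 < p -> 0 < q -> K p q = K q p) :
  (class_I K ->
   exists zeta : R -> R -> R,
     [/\ weak_solution K S Rm zin zeta,
         weakly_continuous_L1_01 zeta,
         forall T : R, 0 < T -> Linfty_L1_01 T zeta &
         (forall s : R, 0 <= s ->
            (\int[@lebesgue_measure R]_(p in Rpos R) (p * S p)%:E
             = \int[@lebesgue_measure R]_(p in Rpos R)
                 (p * Rm p * zeta s p)%:E)%E) ->
         forall t : R, 0 <= t ->
           (\int[@lebesgue_measure R]_(p in Rpos R) (p * zeta t p)%:E
            = \int[@lebesgue_measure R]_(p in Rpos R) (p * zin p)%:E)%E])
  /\
  (class_II K ->
   (forall p q : R, 0 < p -> p <= q -> Rm p <= Rm q) ->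
   exists zeta : R -> R -> R,
     [/\ weak_solution K S Rm zin zeta,
         weakly_continuous_L1 zeta &
         forall T : R, 0 < T -> Linfty_L1_01 T zeta]).
Proof.
have zin_m := L1_01_m zin_L1; have S_m := L1_01_m S_L1.
have cz := pospart_conc zin_L1; have cs := pospart_conc S_L1.
have SE p : 0 < p -> S p = pospart S p by move=> p0; rewrite pospartE ?S_ge0.
have zinE : {ae @lebesgue_measure R, forall p, 0 < p -> zin p = pospart zin p}.
  apply: aeS zin_ge0 => p zp p0; rewrite pospartE// zp//; exact: gt0_Rpos.
pose r0 := Rm \_ (Rpos R).
have r0m : measurable_fun setT r0.
  by apply: (measurable_restrictT _ _).1 => //; exact: measurable_Rpos.
have RmE p : 0 < p -> Rm p = r0 p by move=> p0; rewrite /r0 patchE RposE p0.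
have r0_0 p : p <= 0 -> r0 p = 0 by move=> p0; rewrite /r0 patchE RposE ltNge p0.
have r0_ge0 p : 0 <= r0 p.
  by have [p0|p0] := leP p 0; [rewrite r0_0|rewrite -RmE ?Rm_ge0].
have r0_le p : r0 p <= k * wt p `^ alpha.
  have [p0|p0] := leP p 0; first by rewrite r0_0// mulr_ge0// powR_ge0.
  by rewrite -RmE// (le_trans (Rm_le _ p0))// /wt gtr0_norm.
split.
  move=> [A [A0 KE]].
  have r0_lin p : r0 p <= k * wt p.
    rewrite (le_trans (r0_le p))// ler_wpM2l//.
    by case/andP: alpha_bnd => _ /ltW; apply: ler1_powR; exact: wt_ge1.
  pose D := linear_data cz cs r0m r0_ge0 r0_0 r0_lin k_ge0 A0.
  have D_lin p q : 0 < p -> 0 < q -> ker D p q <= A * (1 + p + q).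
    by move=> p0 q0; exact: lin_ker_le_sum.
  have wt_bd p : wt p <= bd D p.
    by rewrite /= /lin_bd ler_peMl ?wt_ge0// -addrA lerDl addr_ge0.
  have KD : {ae @lebesgue_measure R, forall p, 0 < p ->
      {ae @lebesgue_measure R, forall q, 0 < q -> K p q = ker D p q}}.
    apply: aeW => p p0; apply: aeS (ae_neq (1 - p)) => q qp q0.
    have [K1 K2] := KE p q p0 q0.
    rewrite /= /lin_ker !posT// !mul1r.
    (* The kernel is unspecified at p + q = 1, that is, at a single q. *)
    case: (ltgtP (p + q) 1) => h.
    - by rewrite K1// mulr1.
    - by rewrite K2.
    - by case: qp; rewrite -h addrAC subrr add0r.
  have [z sz] : exists z, solves D z by apply/solves_exists/(linear_tails A0).
  exists z; split.
  - exact: (solves_weak_solution (D := D) zin_m zinE S_m SE Rm_meas RmE K_meas KD sz).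
  - exact: (solves_weakly_continuous_L1_01 sz wt_bd).
  - by move=> T T0; exact: (solves_Linfty sz T0).
  move=> bal t t0; have ct := solves_conc sz t0; have [_ _ cz0 _] := cz.
  have bal' s (s0 : 0 <= s) :=
    balanced_removal (D := D) S_m SE Rm_meas RmE (solves_conc sz s0) (bal s s0).
  have mass := mass_conservation A0 wt_bd D_lin sz
    (fun s s0 => (bal' s s0).1) (fun s s0 => (bal' s s0).2) t0.
  have am (B : set R) : measurable_fun B (fun p : R => `|p|) by exact: normr_measurable.
  have aW (p : R) : `| `|p| | <= 1 * wt p by rewrite normr_id mul1r abs_le_wt.
  rewrite (weighted_conv _ (am _) aW _ ct) ?mass//; last first.
    by apply: aeW => p p0; rewrite gtr0_norm.
  apply/esym/conv1.
  - exact: measurable_funM.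
  - exact: conc_integ_le (am _) aW cz.
  - by move=> p p0; rewrite [X in _ * X](cz0 p p0) mulr0.
  - by apply: aeS zinE => p zp p0; rewrite zp// gtr0_norm.
move=> /(class_II_profile K_meas) [A [U [e [A0 em e1 [eU esub] KE]]]] _.
pose D := product_data cz cs r0m r0_ge0 r0_0 r0_le k_ge0 alpha_bnd A0 em e1 eU.
have KD : {ae @lebesgue_measure R, forall p, 0 < p ->
    {ae @lebesgue_measure R, forall q, 0 < q -> K p q = ker D p q}}.
  apply: aeS (ae_neq 1) => p p1 p0; apply: aeS (ae_neq 1) => q q1 q0.
  by rewrite KE//= /prod_ker !posT// !mul1r.
have [z sz] : exists z, solves D z.
  by apply/solves_exists/sublinear_tails/product_sublinear.
exists z; split.
- exact: (solves_weak_solution (D := D) zin_m zinE S_m SE Rm_meas RmE K_meas KD sz).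
- exact: (solves_weakly_continuous_L1 sz).
- by move=> T T0; exact: (solves_Linfty sz T0).
Qed.
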